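(* Let $\vartheta\in\mathbb{R}$ and $T>0$, and set $$\vartheta_0=\vartheta+2\alpha T\exp\left(c_\phi e^{-\vartheta}\right).$$ Then for every $k_0\in\mathcal{K}_{\vartheta_0}$ the Cauchy problem $$\frac{d}{dt}k_t=L^\Delta k_t,\qquad k_t|_{t=0}=k_0,$$ has a unique classical solution $k_t\in\mathcal{K}_\vartheta$ on $[0,T)$.
   Context: Data. $a:\mathbb{R}^d\to[0,+\infty)$ and $\phi:\mathbb{R}^d\to[0,+\infty)$ are measurable, $a(x)=a(-x)$, $\phi(x)=\phi(-x)$, with $$\alpha:=\int_{\mathbb{R}^d}a(x)\,dx<\infty,\qquad c_\phi:=\int_{\mathbb{R}^d}\left(1-e^{-\phi(x)}\right)dx<\infty.$$ Finite configurations. $\Gamma_0=\bigsqcup_{n\ge 0}\Gamma^{(n)}$, where $\Gamma^{(0)}=\{\emptyset\}$ and $\Gamma^{(n)}=\{\eta\subset\mathbb{R}^d:|\eta|=n\}$, with the Borel $\sigma$-field of the disjoint union topology ($\Gamma^{(n)}$ is identified with the symmetrization of $\{(x_1,\dots,x_n):x_i\ne x_j,\ i\neq j\}$). A measurable $k:\Gamma_0\to\mathbb{R}$ is identified with a sequence of symmetric functions $k^{(n)}:(\mathbb{R}^d)^n\to\mathbb{R}$, $k(\{x_1,\dots,x_n\})=k^{(n)}(x_1,\dots,x_n)$, with $k^{(0)}$ constant. The Lebesgue-Poisson measure on $\Gamma_0$ is $\lambda=\delta_\emptyset+\sum_{n\ge1}\frac1{n!}m^{(n)}$, where $m^{(n)}$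 is the restriction of the measure $dx_1\cdots dx_n$ to $\Gamma^{(n)}$; thus $\int_{\Gamma_0}G\,d\lambda=G^{(0)}+\sum_{n\ge1}\frac1{n!}\int_{(\mathbb{R}^d)^n}G^{(n)}(x_1,\dots,x_n)\,dx_1\cdots dx_n$. Single points $x$ are also written for the configurations $\{x\}$. Operator. For $f:\mathbb{R}^d\to\mathbb{R}$, $e(f,\eta)=\prod_{x\in\eta}f(x)$, $e(f,\emptyset)=1$. Let $t_x(y)=e^{-\phi(x-y)}-1$, $\tau_x(y)=t_x(y)+1$. Then $$(L^\Delta k)(\eta)=\sum_{y\in\eta}\int_{\mathbb{R}^d}a(x-y)\,e(\tau_y,\eta\setminus y\cup x)\left(\int_{\Gamma_0}e(t_y,\xi)\,k(\xi\cup x\cup\eta\setminus y)\,\lambda(d\xi)\right)dx$$ $$\qquad-\int_{\Gamma_0}k(\xi\cup\eta)\left(\sum_{x\in\eta}\int_{\mathbb{R}^d}a(x-y)\,e(\tau_y,\eta)\,e(t_y,\xi)\,dy\right)\lambda(d\xi).$$ Spaces. For $\vartheta\in\mathbb{R}$, $\mathcal{K}_\vartheta$ is the Banach space of ($\lambda$-a.e. classes of) $k:\Gamma_0\to\mathbb{R}$ with $\|k\|_\vartheta=\sup_{n\ge0}e^{\vartheta n}\nu_n(k)<\infty$, where $\nu_0(k)=|k^{(0)}|$ and $\nu_n(k)=\|k^{(n)}\|_{L^\infty((\mathbb{R}^d)^n)}$. One has $\mathcal{K}_{\vartheta}\subset\mathcal{K}_{\vartheta'}$ for $\vartheta>\vartheta'$.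 In $\mathcal{K}_\vartheta$ the operator $L^\Delta$ has domain $\mathrm{Dom}(L^\Delta)=\{k\in\mathcal{K}_\vartheta:L^\Delta k\in\mathcal{K}_\vartheta\}$. A classical solution in $\mathcal{K}_\vartheta$ on a time interval $I$ is a map $I\ni t\mapsto k_t\in\mathcal{K}_\vartheta$ which is continuous on $I$, continuously differentiable on the interior of $I$, takes values in $\mathrm{Dom}(L^\Delta)$, and solves the problem. *)

(* Defs.v *)
From HB Require Import structures.
From mathcomp Require Import all_boot all_order all_algebra.
From mathcomp Require Import finmap.
From mathcomp Require Import all_classical all_reals all_analysis.
From mathcomp Require Import ess_sup_inf measurable_realfun.

Set Implicit Arguments.
Unset Strict Implicit.
Unset Printing Implicit Defensive.

Import Order.TTheory GRing.Theory Num.Theory.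
Import numFieldNormedType.Exports.

Local Open Scope classical_set_scope.
Local Open Scope ring_scope.

(* n-fold product of a sigma-finite measure, on the product sigma-algebra of
   n.-tuple T. *)
Section tuple_measure.
Context {disp : measure_display} {T : measurableType disp} {R : realType}.
Variable mu : {sigma_finite_measure set T -> \bar R}.

Definition tuple_cons n (p : T * n.-tuple T) : n.+1.-tuple T :=
  [tuple of p.1 :: p.2].

Lemma measurable_tuple_cons n : measurable_fun [set: T * n.-tuple T] (@tuple_cons n).
Proof. by apply: measurable_cons => //; exact: measurable_snd. Qed.

Section step.
Variables (n : nat) (nu : {sigma_finite_measure set (n.-tuple T) -> \bar R}).

Definition tuple_measureS := pushforward (mu \x nu)%E (@tuple_cons n).

Let tuple_measureS0 : (tuple_measureS set0 = 0)%E.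
Proof. by rewrite /tuple_measureS /pushforward preimage_set0 measure0. Qed.

Let tuple_measureS_ge0 A : (0 <= tuple_measureS A)%E.
Proof. exact: (measure_ge0 (mu \x nu)%E). Qed.

Let tuple_measureS_sigma_additive : semi_sigma_additive tuple_measureS.
Proof.
move=> F mF tF mUF; rewrite /tuple_measureS /pushforward preimage_bigcup.
apply: measure_semi_sigma_additive.
- by move=> i; rewrite -[X in measurable X]setTI; exact: measurable_tuple_cons.
- apply/trivIsetP => /= i j _ _ ij; rewrite -preimage_setI.
  by move/trivIsetP : tF => /(_ _ _ _ _ ij) ->//; rewrite preimage_set0.
- rewrite -preimage_bigcup -[X in measurable X]setTI.
  exact: measurable_tuple_cons.
Qed.

HB.instance Definition _ := isMeasure.Build _ _ _ tuple_measureS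
  tuple_measureS0 tuple_measureS_ge0 tuple_measureS_sigma_additive.

Let tuple_measureS_sigma_finite : sigma_finite setT tuple_measureS.
Proof.
have /sigma_finiteP[F [FT ndF Foo]] := sigma_finiteT mu.
have /sigma_finiteP[G [GT ndG Goo]] := sigma_finiteT nu.
pose uncons (t : n.+1.-tuple T) : T * n.-tuple T :=
  (thead t, [tuple of behead t]).
have munc : measurable_fun [set: n.+1.-tuple T] uncons.
  by apply/measurable_fun_pair; [exact: measurable_tnth|exact: measurable_behead].
have uncK : uncons \o @tuple_cons n = id.
  apply/funext => -[x t]; rewrite /= /uncons /tuple_cons theadE; congr pair.
  exact/val_inj.
exists (fun i => uncons @^-1` (F i `*` G i)).
  rewrite -preimage_bigcup; apply/esym; rewrite -subTset => t _ /=.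
  have [i _ Fi] : (\bigcup_i F i) (thead t) by rewrite -FT.
  have [j _ Gj] : (\bigcup_i G i) [tuple of behead t] by rewrite -GT.
  exists (maxn i j) => //; split => /=.
  - by move: Fi; exact/subsetPset/ndF/leq_maxl.
  - by move: Gj; exact/subsetPset/ndG/leq_maxr.
move=> i; have [mF Fi] := Foo i; have [mG Gi] := Goo i.
split.
  by rewrite -[X in measurable X]setTI; apply: munc => //; exact: measurableX.
rewrite /tuple_measureS /pushforward -comp_preimage uncK.
rewrite [X in (X < _)%E](product_measure1E mu nu mF mG).
by rewrite lte_mul_pinfty// ge0_fin_numE.
Qed.

HB.instance Definition _ := Measure_isSigmaFinite.Build _ _ _ tuple_measureS
  tuple_measureS_sigma_finite.

End step.

Fixpoint tuple_measure n : {sigma_finite_measure set (n.-tuple T) -> \bar R} :=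
  match n with
  | 0 => \d_[tuple]
  | n'.+1 => tuple_measureS (tuple_measure n')
  end.

End tuple_measure.

(* measurableTypeR R is R with its Borel sigma-algebra, the type on which
   lebesgue_measure is defined. *)
Notation Rd R d := (d.-tuple (measurableTypeR R)).

Section configurations.
Variables (R : realType) (d : nat).

Definition lebesgue_Rd : {sigma_finite_measure set (Rd R d) -> \bar R} :=
  tuple_measure (@lebesgue_measure R) d.

Definition subRd (x y : Rd R d) : Rd R d :=
  [tuple tnth x i - tnth y i | i < d].
Definition oppRd (x : Rd R d) : Rd R d := [tuple - tnth x i | i < d].

(* Gamma_0: finite subsets of R^d. *)
Definition conf := {fset (Rd R d)}.
HB.instance Definition _ := Choice.on conf.
HB.instance Definition _ := isPointed.Build conf fset0.

Definition conf_of n (xs : n.-tuple (Rd R d)) : conf := [fset x in tval xs]%fset.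

Definition off_diag n : set (n.-tuple (Rd R d)) := [set xs | uniq xs].
Arguments off_diag n : clear implicits.

Lemma measurable_off_diag n : measurable (off_diag n).
Proof.
have -> : off_diag n =
  \bigcap_(i in [set: 'I_n]) \bigcap_(j in [set j : 'I_n | i != j])
  ~` \bigcap_(l in [set: 'I_d])
    [set xs | tnth (tnth xs i) l = tnth (tnth xs j) l].
  apply/seteqP; split => xs.
    move=> /= /tuple_uniqP inj i _ j /= ij H.
    move/eqP: ij; apply; apply: inj; apply: eq_from_tnth => l.
    by apply: H.
  move=> /= H; apply/tuple_uniqP => i j xij; apply/eqP/negPn/negP => ij.
  by apply: (H i I j ij) => l _ /=; rewrite xij.
apply: fin_bigcap_measurable => [|i _]; first exact: finite_finset.
apply: fin_bigcap_measurable => [|j _]; first exact: finite_finset.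
apply: measurableC; apply: fin_bigcap_measurable => [|l _].
  exact: finite_finset.
have m (i' : 'I_n) : measurable_fun setT
    (fun xs : n.-tuple (Rd R d) => tnth (tnth xs i') l).
  apply: (measurableT_comp (measurable_tnth l)); exact: measurable_tnth.
have := measurable_fun_eqr (m i) (m j) measurableT
  (I : measurable ([set true] : set bool)).
rewrite setTI; congr measurable; apply/seteqP.
by split=> xs /= /eqP.
Qed.

(* Each layer Gamma^(n) is the quotient of off_diag n by permutations, with
   projection conf_of; Borel sets of the disjoint union are those whose preimage
   in every off_diag n is Borel. *)
Definition measurable_conf : set (set conf) :=
  [set A | forall n, measurable (off_diag n `&` @conf_of n @^-1` A)].

Let measurable_conf0 : measurable_conf set0.
Proof. by move=> n; rewrite preimage_set0 setI0; exact: measurable0. Qed.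

Let measurable_confC A : measurable_conf A -> measurable_conf (~` A).
Proof.
move=> mA n; rewrite (_ : _ `&` _ = off_diag n `\` (off_diag n `&` @conf_of n @^-1` A)).
  by apply: measurableD; [exact: measurable_off_diag|exact: mA].
by apply/seteqP; split=> xs /= [Dx Ax]; split=> //; tauto.
Qed.

Let measurable_conf_bigcup (F : (set conf)^nat) :
  (forall i, measurable_conf (F i)) -> measurable_conf (\bigcup_i F i).
Proof.
move=> mF n; rewrite preimage_bigcup setI_bigcupr.
by apply: bigcupT_measurable => i; exact: mF.
Qed.

HB.instance Definition _ := isMeasurable.Build default_measure_display conf
  measurable_conf0 measurable_confC measurable_conf_bigcup.

(* m^(n), as a measure on Gamma_0 carried by Gamma^(n). *)
Definition conf_measure n (A : set conf) : \bar R :=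
  tuple_measure lebesgue_Rd n (off_diag n `&` @conf_of n @^-1` A).

Section conf_measure.
Variable n : nat.

Let conf_measure0 : (conf_measure n set0 = 0)%E.
Proof. by rewrite /conf_measure preimage_set0 setI0 measure0. Qed.

Let conf_measure_ge0 A : (0 <= conf_measure n A)%E.
Proof. exact: measure_ge0. Qed.

Let conf_measure_sigma_additive : semi_sigma_additive (conf_measure n).
Proof.
move=> F mF tF mUF; rewrite /conf_measure preimage_bigcup setI_bigcupr.
apply: measure_semi_sigma_additive.
- by move=> i; exact: mF.
- apply/trivIsetP => /= i j _ _ ij.
  move/trivIsetP : tF => /(_ i j I I ij) /seteqP[FF _].
  by apply/seteqP; split=> // xs [[_ Fi] [_ Fj]]; exact: (FF (conf_of xs)).
- by rewrite -setI_bigcupr -preimage_bigcup; exact: mUF.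
Qed.

HB.instance Definition _ := isMeasure.Build _ _ _ (conf_measure n)
  conf_measure0 conf_measure_ge0 conf_measure_sigma_additive.

End conf_measure.

(* The n = 0 term is the Dirac mass at the empty configuration. *)
Definition lebesgue_poisson : {measure set conf -> \bar R} :=
  mseries (fun n => mscale (n`!%:R^-1)%:nng (conf_measure n)) 0.

End configurations.
Arguments off_diag {R d} n xs.

(* The library's {mfun_ mu, T >-> R} (measurable functions modulo mu-a.e.
   equality) carries no algebraic structure; L0 mu is a copy of it with the
   lmodType structure of pointwise operations. *)
Section L0.
Local Open Scope quotient_scope.
Context {disp : measure_display} {T : measurableType disp} {R : realType}.
Variable mu : {measure set T -> \bar R}.

Definition L0 := {mfun_ mu, T >-> R}.
HB.instance Definition _ := Choice.on L0.
HB.instance Definition _ := EqQuotient.on L0.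

Definition L0_fun (f : L0) : T -> R := repr f.

Definition L0_class (f : {mfun T >-> R}) : L0 := \pi_L0 f.

Lemma L0_classK f : L0_fun (L0_class f) = f %[ae mu].
Proof.
have /eqmodP/asboolP : \pi_L0 (repr (L0_class f)) = \pi_L0 f by rewrite reprK.
exact.
Qed.

Lemma L0_eqP (f g : L0) : L0_fun f = L0_fun g %[ae mu] <-> f = g.
Proof.
split=> [fg|->]; last exact: ae_eq_refl.
rewrite -[f]reprK -[g]reprK; apply/eqmodP; exact/asboolP.
Qed.

Definition L0_zero := L0_class 0.
Definition L0_opp (f : L0) := L0_class (- repr f).
Definition L0_add (f g : L0) := L0_class (repr f + repr g).
Definition L0_scale (a : R) (f : L0) := L0_class (a *: repr f).

Lemma L0_zeroE : L0_fun L0_zero = cst 0 %[ae mu].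
Proof. exact: L0_classK. Qed.

Lemma L0_oppE f : L0_fun (L0_opp f) = \- L0_fun f %[ae mu].
Proof. exact: L0_classK. Qed.

Lemma L0_addE f g : L0_fun (L0_add f g) = L0_fun f \+ L0_fun g %[ae mu].
Proof. exact: L0_classK. Qed.

Lemma L0_scaleE a f : L0_fun (L0_scale a f) = (fun x => a * L0_fun f x) %[ae mu].
Proof. exact: L0_classK. Qed.

Let addA : associative L0_add.
Proof.
move=> f g h; apply/L0_eqP.
apply: filter_app (L0_addE f g).
apply: filter_app (L0_addE (L0_add f g) h).
apply: filter_app (L0_addE g h).
apply: filter_app (L0_addE f (L0_add g h)).
apply: aeW.
move=> x /(_ I) /= -> /(_ I) /= -> /(_ I) /= -> /(_ I) /= -> _.
exact: addrA.
Qed.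

Let addC : commutative L0_add.
Proof.
move=> f g; apply/L0_eqP.
apply: filter_app (L0_addE g f).
apply: filter_app (L0_addE f g).
apply: aeW.
move=> x /(_ I) /= -> /(_ I) /= -> _.
exact: addrC.
Qed.

Let add0 : left_id L0_zero L0_add.
Proof.
move=> f; apply/L0_eqP.
apply: filter_app (L0_zeroE).
apply: filter_app (L0_addE L0_zero f).
apply: aeW.
move=> x /(_ I) /= -> /(_ I) /= -> _.
exact: add0r.
Qed.

Let addN : left_inverse L0_zero L0_opp L0_add.
Proof.
move=> f; apply/L0_eqP.
apply: filter_app (L0_zeroE).
apply: filter_app (L0_oppE f).
apply: filter_app (L0_addE (L0_opp f) f).
apply: aeW.
move=> x /(_ I) /= -> /(_ I) /= -> /(_ I) /= -> _.
exact: addNr.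
Qed.

HB.instance Definition _ := GRing.isZmodule.Build L0 addA addC add0 addN.

Let scaleA a b (f : L0) : L0_scale a (L0_scale b f) = L0_scale (a * b) f.
Proof.
apply/L0_eqP.
apply: filter_app (L0_scaleE (a * b) f).
apply: filter_app (L0_scaleE b f).
apply: filter_app (L0_scaleE a (L0_scale b f)).
apply: aeW.
move=> x /(_ I) /= -> /(_ I) /= -> /(_ I) /= -> _.
exact: mulrA.
Qed.

Let scale1 : left_id 1 L0_scale.
Proof.
move=> f; apply/L0_eqP.
apply: filter_app (L0_scaleE 1 f).
apply: aeW.
move=> x /(_ I) /= -> _.
exact: mul1r.
Qed.

Let scaleDr : right_distributive L0_scale +%R.
Proof.
move=> a f g; apply/L0_eqP.
apply: filter_app (L0_addE (L0_scale a f) (L0_scale a g)).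
apply: filter_app (L0_scaleE a g).
apply: filter_app (L0_scaleE a f).
apply: filter_app (L0_addE f g).
apply: filter_app (L0_scaleE a (f + g)).
apply: aeW.
move=> x /(_ I) /= -> /(_ I) /= -> /(_ I) /= fE /(_ I) /= gE /(_ I) /= -> _.
by rewrite fE gE mulrDr.
Qed.

Let scaleDl (f : L0) : {morph L0_scale^~ f : a b / a + b >-> a + b}.
Proof.
move=> a b; apply/L0_eqP.
apply: filter_app (L0_addE (L0_scale a f) (L0_scale b f)).
apply: filter_app (L0_scaleE b f).
apply: filter_app (L0_scaleE a f).
apply: filter_app (L0_scaleE (a + b) f).
apply: aeW.
move=> x /(_ I) /= -> /(_ I) /= fE /(_ I) /= gE /(_ I) /= -> _.
by rewrite fE gE mulrDl.
Qed.

HB.instance Definition _ := GRing.Zmodule_isLmodule.Build R L0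
  scaleA scale1 scaleDr scaleDl.

End L0.

Section Linfty.
Local Open Scope ereal_scope.
Context {disp : measure_display} {T : measurableType disp} {R : realType}.
Variable mu : {measure set T -> \bar R}.

Lemma LinftyE (f : T -> R) : 'N[mu]_+oo[EFin \o f] =
  if 0 < mu setT then ess_sup mu (abse \o (EFin \o f)) else 0.
Proof. by rewrite unlock /Lnorm. Qed.

Lemma Linfty_ae (f g : T -> R) : f = g %[ae mu] ->
  'N[mu]_+oo[EFin \o f] = 'N[mu]_+oo[EFin \o g].
Proof.
move=> fg; rewrite !LinftyE; case: ifP => // _; apply: eq_ess_sup.
by apply: filterS fg => x /= /(_ I) ->.
Qed.

Lemma LinftyD (f g : T -> R) : 'N[mu]_+oo[EFin \o (f \+ g)%R] <=
  'N[mu]_+oo[EFin \o f] + 'N[mu]_+oo[EFin \o g].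
Proof.
rewrite !LinftyE; case: ifP => _; last by rewrite adde0.
exact: (ess_sup_absD mu (EFin \o f) (EFin \o g)).
Qed.

Lemma LinftyZ (a : R) (f : T -> R) : 'N[mu]_+oo[EFin \o (fun x => a * f x)%R] =
  `|a|%:E * 'N[mu]_+oo[EFin \o f].
Proof.
rewrite !LinftyE; case: ifPn => mu0; last by rewrite mule0.
rewrite -ess_supZl//; apply: eq_ess_sup; apply: aeW => x /=.
by rewrite normrM EFinM.
Qed.

Lemma Linfty_eq0 (f : T -> R) :
  'N[mu]_+oo[EFin \o f] = 0 -> f = cst 0%R %[ae mu].
Proof.
rewrite LinftyE; case: ifPn => [_ /abs_sup_eq0_ae_eq|].
  by apply: filterS => x /= /(_ I) [->].
rewrite -leNgt measure_le0 => /eqP mu0 _.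
by apply: ae_eq0 => //; exact: mu0.
Qed.

End Linfty.

Section Kspace.
Context {R : realType} {d : nat}.
Local Notation lp := (lebesgue_poisson R d).
Implicit Types (k : conf R d -> R) (theta : R).

(* k^(n), set to 0 on the diagonals, where conf_of has fewer than n points; they
   are Lebesgue-null as soon as 0 < d. *)
Definition component k n : n.-tuple (Rd R d) -> R :=
  (k \o @conf_of R d n) \_ (off_diag n).
Arguments component k n xs : clear implicits.

Definition nu k n : \bar R :=
  'N[tuple_measure (lebesgue_Rd R d) n]_+oo[EFin \o component k n].

Definition Kseminorm theta k : \bar R :=
  ereal_sup (range (fun n : nat => (expR (theta * n%:R))%:E * nu k n)%E).


Lemma lebesgue_poisson_eq0 (A : set (conf R d)) :
  lp A = 0%E <-> forall n, conf_measure n A = 0%E.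
Proof.
have ge0 n : (0 <= conf_measure n A)%E by exact: measure_ge0.
have invf n : (0 < (n`!%:R^-1 : R)%:E)%E.
  by rewrite lte_fin invr_gt0 ltr0n fact_gt0.
have term_ge0 n : (0 <= (n`!%:R^-1 : R)%:E * conf_measure n A)%E.
  by rewrite mule_ge0// ltW.
rewrite /lebesgue_poisson /= /mseries /mscale /=; split => [H n|H].
  apply/eqP; rewrite eq_le ge0 andbT.
  rewrite -(@lee_pmul2l _ (n`!%:R^-1)%:E)//.
  rewrite mule0 -H.
  apply: le_trans (nneseries_lim_ge n.+1 _) => //.
  by rewrite big_nat_recr//= leeDr// sume_ge0.
by apply: eseries0 => n _ _; rewrite /= /mscale [X in (_ * X)%E](H n) mule0.
Qed.

Lemma component_ae (f g : conf R d -> R) n : f = g %[ae lp] ->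
  component f n = component g n %[ae tuple_measure (lebesgue_Rd R d) n].
Proof.
move=> [A [mA /lebesgue_poisson_eq0 A0 fgA]].
exists (off_diag n `&` @conf_of R d n @^-1` A); split.
- exact: mA.
- exact: A0.
- move=> xs /= fgxs; have [xsD|xsD] := pselect (off_diag n xs).
    split => //; apply: fgA => /= fg; apply: fgxs => _.
    by rewrite /component !patchE; case: ifP => //= _; exact: fg.
  exfalso; apply: fgxs => _; rewrite /component !patchE.
  by case: ifPn => //; rewrite inE.
Qed.

Lemma component_eq0 (f : conf R d -> R) : measurable_fun setT f ->
  (forall n, component f n = cst 0 %[ae tuple_measure (lebesgue_Rd R d) n]) ->
  f = cst 0 %[ae lp].
Proof.
move=> mf f0; exists (f @^-1` ~` [set 0]); split.
- by rewrite -[X in measurable X]setTI; apply: mf => //; exact: measurableC.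
- apply/lebesgue_poisson_eq0 => n; rewrite /conf_measure.
  have mA : measurable (off_diag n `&` @conf_of R d n @^-1` (f @^-1` ~` [set 0])).
    have : measurable (f @^-1` ~` [set 0]).
      by rewrite -[X in measurable X]setTI; apply: mf => //; exact: measurableC.
    exact.
  apply: measure_negligible => //; apply: negligibleS (f0 n).
  move=> xs /= [xsD fxs] H; apply: fxs; have := H I.
  by rewrite /component patchE mem_set.
- by move=> eta /= H Heta; apply: H.
Qed.

Lemma nu_ae (f g : conf R d -> R) n : f = g %[ae lp] -> nu f n = nu g n.
Proof. by move=> fg; apply: Linfty_ae; exact: component_ae. Qed.

Lemma nuD (f g : conf R d -> R) n : (nu (f \+ g)%R n <= nu f n + nu g n)%E.
Proof.
rewrite /nu (_ : component (f \+ g) n = component f n \+ component g n).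
  exact: LinftyD.
by apply/funext => xs; rewrite /component /= !patchE; case: ifP; rewrite ?addr0.
Qed.

Lemma nuZ (a : R) (f : conf R d -> R) n :
  nu (fun x => a * f x) n = (`|a|%:E * nu f n)%E.
Proof.
rewrite /nu -LinftyZ; congr Lnorm.
apply/funext => xs; rewrite /component /= !patchE.
by case: ifP => //=; rewrite mulr0.
Qed.

Lemma nu_ge0 (f : conf R d -> R) n : (0 <= nu f n)%E.
Proof. exact: Lnorm_ge0. Qed.

Lemma nu_le_Kseminorm theta f n :
  ((expR (theta * n%:R))%:E * nu f n <= Kseminorm theta f)%E.
Proof. by apply: ereal_sup_ubound; exists n. Qed.

Lemma Kseminorm_ge0 theta f : (0 <= Kseminorm theta f)%E.
Proof.
apply: le_trans (nu_le_Kseminorm _ _ 0).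
by rewrite mule_ge0 ?nu_ge0// lee_fin expR_ge0.
Qed.

Lemma Kseminorm_ae theta f g : f = g %[ae lp] -> Kseminorm theta f = Kseminorm theta g.
Proof.
move=> fg; rewrite /Kseminorm (_ : nu f = nu g)//.
by apply/funext => n; exact: nu_ae.
Qed.

Lemma KseminormD theta f g :
  (Kseminorm theta (f \+ g)%R <= Kseminorm theta f + Kseminorm theta g)%E.
Proof.
apply: ge_ereal_sup => _ [n _ <-].
apply: le_trans (leeD (nu_le_Kseminorm theta f n) (nu_le_Kseminorm theta g n)).
rewrite -ge0_muleDr ?nu_ge0//.
by rewrite lee_pmul2l// ?nuD// lte_fin expR_gt0.
Qed.

Lemma KseminormZ_le theta a f :
  (Kseminorm theta (fun x => (a * f x)%R) <= `|a|%:E * Kseminorm theta f)%E.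
Proof.
apply: ge_ereal_sup => _ [n _ <-].
rewrite nuZ muleCA lee_wpmul2l//.
exact: nu_le_Kseminorm.
Qed.

Lemma KseminormZ theta a f :
  Kseminorm theta (fun x => a * f x) = (`|a|%:E * Kseminorm theta f)%E.
Proof.
apply/eqP; rewrite eq_le KseminormZ_le /=.
have [->|a0] := eqVneq a 0; first by rewrite normr0 mul0e Kseminorm_ge0.
rewrite -lee_pdivlMl ?normr_gt0//.
rewrite -normfV; apply: le_trans (KseminormZ_le _ _ _).
by under [X in (_ <= Kseminorm _ X)%E]eq_fun do rewrite mulKf//.
Qed.

Definition finite_Kseminorm theta : {pred L0 lp} :=
  [pred k | (Kseminorm theta (L0_fun k) < +oo)%E].

Lemma finite_Kseminorm_submod_closed theta : submod_closed (finite_Kseminorm theta).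
Proof.
split=> [|a f g]; rewrite !inE.
  rewrite (Kseminorm_ae theta (L0_zeroE lp)).
  rewrite (_ : cst 0 = fun x : conf R d => 0 * 0).
    by rewrite KseminormZ normr0 mul0e.
  by apply/funext => x; rewrite mul0r.
move=> ff fg; rewrite (Kseminorm_ae theta (L0_addE _ _)).
apply: le_lt_trans (KseminormD _ _ _) _; apply: lte_add_pinfty => //.
by rewrite (Kseminorm_ae theta (L0_scaleE _ _)) KseminormZ lte_mul_pinfty.
Qed.

HB.instance Definition _ theta := GRing.isSubmodClosed.Build R (L0 lp)
  (finite_Kseminorm theta) (finite_Kseminorm_submod_closed theta).

End Kspace.
Arguments component {R d} k n xs.

(* K_theta, with the norm |k| = sup_n e^(theta n) nu_n(k) installed below. All
   the spaces Kspace d theta are subspaces of the same L0, so Kval realizes the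
   inclusions between them. *)
Record Kspace (R : realType) (d : nat) (theta : R) := MkKspace {
  Kval :> L0 (lebesgue_poisson R d) ;
  Kval_finite : Kval \in finite_Kseminorm theta }.

Section Kspace_normed.
Variables (R : realType) (d : nat) (theta : R).
Local Notation K := (Kspace d theta).

HB.instance Definition _ := [isSub for @Kval R d theta].
HB.instance Definition _ := [Choice of K by <:].
HB.instance Definition _ := [SubChoice_isSubLmodule of K by <:].

Definition Knorm (k : K) : R := fine (Kseminorm theta (L0_fun (\val k))).

Lemma KnormE k : (Knorm k)%:E = Kseminorm theta (L0_fun (\val k)).
Proof.
rewrite /Knorm fineK// ge0_fin_numE ?Kseminorm_ge0//.
by have := Kval_finite k; rewrite inE.
Qed.

Let KnormD (k l : K) : Knorm (k + l) <= Knorm k + Knorm l.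
Proof.
rewrite -lee_fin EFinD !KnormE raddfD /= (Kseminorm_ae theta (L0_addE _ _)).
exact: KseminormD.
Qed.

Let KnormZ (a : R) (k : K) : Knorm (a *: k) = `|a| * Knorm k.
Proof.
apply: EFin_inj; rewrite EFinM !KnormE linearZ /=.
by rewrite (Kseminorm_ae theta (L0_scaleE _ _)) KseminormZ.
Qed.

Let Knorm_eq0 (k : K) : Knorm k = 0 -> k = 0.
Proof.
move=> nk0; have k0 := KnormE k; rewrite nk0 in k0; apply: val_inj => /=.
apply/L0_eqP; apply: ae_eq_trans (ae_eq_sym (L0_zeroE _)).
apply: component_eq0 => // n; apply: Linfty_eq0.
apply/eqP; rewrite eq_le [X in _ && X]nu_ge0 andbT.
rewrite -(@lee_pmul2l _ (expR (theta * n%:R))%:E) ?lte_fin ?expR_gt0// mule0.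
by rewrite [leRHS]k0; exact: nu_le_Kseminorm.
Qed.

HB.instance Definition _ := Lmodule_isNormed.Build R K KnormD KnormZ Knorm_eq0.

Lemma Kspace_normE (k : K) : `|k| = fine (Kseminorm theta (L0_fun (Kval k))).
Proof. by []. Qed.

End Kspace_normed.

Section kinetic_operator.
Variables (R : realType) (d : nat) (a phi : Rd R d -> R).
Local Notation leb := (lebesgue_Rd R d).
Local Notation lp := (lebesgue_poisson R d).

(* e(f, eta), equal to 1 at the empty configuration. *)
Definition econf (f : Rd R d -> R) (eta : conf R d) : R := \prod_(x <- eta) f x.

Definition t_ (x y : Rd R d) : R := expR (- phi (subRd x y)) - 1.
Definition tau_ (x y : Rd R d) : R := t_ x y + 1.

(* Rintegral is total (it is fine of the extended-real integral). For k in some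
   Kspace and integrable a and 1 - exp(-phi), all the integrals below converge
   absolutely for lebesgue_poisson-almost every eta when 0 < d. *)
Definition LDelta (k : conf R d -> R) (eta : conf R d) : R :=
  \sum_(y <- eta) \int[leb]_x
    (a (subRd x y) * econf (tau_ y) (x |` (eta `\ y))%fset *
     \int[lp]_xi (econf (t_ y) xi * k (xi `|` (x |` (eta `\ y)))%fset))
  - \int[lp]_xi
    (k (xi `|` eta)%fset *
     \sum_(x <- eta) \int[leb]_y
       (a (subRd x y) * econf (tau_ y) eta * econf (t_ y) xi)).

(* LDelta is applied to a representative of k; when 0 < d, changing it on a
   null set changes LDelta only on a null set. *)
Definition LDelta_eq (theta : R) (k g : Kspace d theta) : Prop :=
  L0_fun (Kval g) = LDelta (L0_fun (Kval k)) %[ae lp].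

Definition dom_LDelta (theta : R) : set (Kspace d theta) :=
  [set k | exists g : Kspace d theta, LDelta_eq k g].

(* The equation is required on the open interval ]0, T[, where the derivative
   is; only the values of k on [0, T[ matter. *)
Record classical_solution (theta theta0 T : R) (k0 : Kspace d theta0)
    (k : R -> Kspace d theta) : Prop := {
  sol_continuous : {within `[0, T[, continuous k} ;
  sol_derivable : forall t, t \in `]0, T[ -> derivable k t 1 ;
  sol_derive_continuous : {within `]0, T[, continuous (derive1 k)} ;
  sol_dom : forall t, t \in `[0, T[ -> dom_LDelta (k t) ;
  sol_eq : forall t, t \in `]0, T[ -> LDelta_eq (k t) (derive1 k t) ;
  sol_init : Kval (k 0) = Kval k0 }.

End kinetic_operator.

(* Main.v *)
Require Import Defs.
From HB Require Import structures.
From mathcomp Require Import all_boot all_order all_algebra finmap.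
From mathcomp Require Import all_classical all_reals all_analysis.
From mathcomp Require Import ess_sup_inf measurable_realfun.
From mathcomp Require Import ring lra.

Set Implicit Arguments.
Unset Strict Implicit.
Unset Printing Implicit Defensive.

Import Order.TTheory GRing.Theory Num.Theory.
Import numFieldNormedType.Exports.

Local Open Scope classical_set_scope.
Local Open Scope ring_scope.

(**
  Write [M theta = 2 alpha exp (c_phi e^-theta)]. Since the integral over
  [lambda] of [e(f, .)] is [exp (int f)], a bound [|k(eta)| <= C e^(-theta |eta|)]
  gives [|(L k)(eta)| <= |eta| M(theta) C e^(-theta |eta|)] for almost every [eta];
  hence [L] maps [K_theta] to [K_theta'] for [theta' < theta], with norm at most
  [M(theta) / (e (theta - theta'))].

  Existence is Ovsyannikov's method: [k_t = sum_m t^m / m! L^m k_0], where [L^m k_0]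
  is estimated by going from [theta0] to [theta] in [m] equal steps; the series
  converges in [K_theta] for [t < T = (theta0 - theta) / M(theta)].

  Uniqueness: let [u] be the difference of two solutions, with [u_s = 0], and let
  [kappa > M(theta - 1)]. If the n-th components satisfy
  [nu_n(u_t) <= Q e^(-(theta - kappa (t - s)) n)] for all [n] and all [t] in
  [[s, s + 1 / kappa]], then integrating the equation gives the same bound with
  [Q] replaced by [Q M(theta - 1) / kappa]; hence [u = 0] there.
*)

(** * Product measures on tuples *)

(** A class in [Kspace] is known only up to null sets, whereas [LDelta] evaluates a representative
    at unions of the fixed configuration, possibly with one point exchanged, and an integrated one.
    Bounds on [k] must therefore survive restriction to almost every fibre. Tuples make this
    possible: Lebesgue measure on them is a product, so null sets have null sections, and the
    diagonals are null because [d] is positive.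

    In [M theta], gain and loss each contribute alpha, the mass of [a]; the exponential is the
    integral over [xi] of the product of the [e^-theta |t_y|], and the weight of the bound on [k]
    enters through its factor [e^-theta].

    The factor [|eta|] is the obstacle: it makes the operator lose index. For existence the power
    series is summed at each configuration separately, with coefficients first modified on null
    sets, so that scalar remainder estimates uniform in [eta] become norm estimates. For uniqueness
    the norm of the derivative is not controlled by that of [u], but each [nu_n] is; hence a mean
    value inequality for seminorms. The length [1 / kappa] costs at most 1 in the index and is the
    same for every [s], so the argument can be iterated. *)

Section null_prod.
Context d1 d2 (T1 : measurableType d1) (T2 : measurableType d2) (R : realType).
Variable m1 : {sigma_finite_measure set T1 -> \bar R}.
Variable m2 : {sigma_finite_measure set T2 -> \bar R}.
Local Open Scope ereal_scope.

Lemma ae_eq0_integral d (T : measurableType d) (m : {measure set T -> \bar R})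
    (f : T -> \bar R) : measurable_fun setT f -> (forall x, 0 <= f x) ->
  \int[m]_x f x = 0 <-> {ae m, forall x, f x = 0}.
Proof.
move=> mf f0.
have -> : \int[m]_x f x = \int[m]_x `|f x|.
  by apply: eq_integral => x _; rewrite gee0_abs.
rewrite ae_eq_integral_abs//.
by split; apply: filterS => x H; [exact: H|move=> _; exact: H].
Qed.

Lemma null_prodP (A : set (T1 * T2)) : measurable A ->
  (m1 \x m2) A = 0 <-> {ae m1, forall x, m2 [set y | A (x, y)] = 0}.
Proof.
move=> mA; rewrite /product_measure1 ae_eq0_integral//; last first.
  exact: measurable_fun_xsection.
have E x : xsection A x = [set y | A (x, y)].
  by apply/seteqP; split=> y; rewrite /xsection /= inE.
by split; apply: filterS => x /=; rewrite E.
Qed.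

End null_prod.

Section tuples.
Context {disp : measure_display} {T : measurableType disp} {R : realType}.
Variable mu : {sigma_finite_measure set T -> \bar R}.
Local Notation TM n := (tuple_measure mu n).
Local Open Scope ereal_scope.

Lemma ge0_integral_tuple0 (f : 0.-tuple T -> \bar R) :
  measurable_fun setT f -> \int[TM 0]_xs f xs = f [tuple].
Proof. by move=> mf; rewrite /= integral_dirac// diracT mul1e. Qed.

Lemma measurable_tuple_consl n (x : T) :
  measurable_fun setT (fun xs : n.-tuple T => tuple_cons (x, xs)).
Proof.
apply: (measurableT_comp (@measurable_tuple_cons _ T n)) => /=.
exact: measurable_pair1.
Qed.

Lemma measurable_tuple_consr n (xs : n.-tuple T) :
  measurable_fun setT (fun x : T => tuple_cons (x, xs)).
Proof.
apply: (measurableT_comp (@measurable_tuple_cons _ T n)) => /=.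
exact: measurable_pair2.
Qed.

Lemma ge0_integral_tupleS n (f : n.+1.-tuple T -> \bar R) :
  measurable_fun setT f -> (forall xs, 0 <= f xs) ->
  \int[TM n.+1]_xs f xs = \int[mu]_x \int[TM n]_xs f (tuple_cons (x, xs)).
Proof.
move=> mf f0; rewrite /= /tuple_measureS.
rewrite ge0_integral_pushforward//; last exact: measurable_tuple_cons.
rewrite preimage_setT fubini_tonelli1//=.
by apply: measurableT_comp => //; exact: measurable_tuple_cons.
Qed.

Lemma ge0_integral_tupleSr n (f : n.+1.-tuple T -> \bar R) :
  measurable_fun setT f -> (forall xs, 0 <= f xs) ->
  \int[TM n.+1]_xs f xs = \int[TM n]_xs \int[mu]_x f (tuple_cons (x, xs)).
Proof.
move=> mf f0; rewrite ge0_integral_tupleS//.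
have mF : measurable_fun setT (fun p => f (@tuple_cons _ T n p)).
  by apply: measurableT_comp => //; exact: measurable_tuple_cons.
by rewrite (fubini_tonelli (fun p => f (tuple_cons p))).
Qed.

Lemma measurable_tuple_consV n (A : set (n.+1.-tuple T)) x :
  measurable A -> measurable [set xs : n.-tuple T | A (tuple_cons (x, xs))].
Proof.
move=> mA; rewrite -[X in measurable X]setTI.
exact: (measurable_tuple_consl x).
Qed.

Lemma measurable_tuple_consVr n (A : set (n.+1.-tuple T)) xs :
  measurable A -> measurable [set x : T | A (tuple_cons (x, xs))].
Proof.
move=> mA; rewrite -[X in measurable X]setTI.
exact: (measurable_tuple_consr xs).
Qed.

Lemma null_tupleSP n (A : set (n.+1.-tuple T)) : measurable A ->
  TM n.+1 A = 0 <->
  {ae mu, forall x, TM n [set xs | A (tuple_cons (x, xs))] = 0}.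
Proof.
move=> mA; apply: (null_prodP mu (TM n) (A := [set p | A (tuple_cons p)])).
by rewrite -[X in measurable X]setTI; exact: measurable_tuple_cons.
Qed.

Definition tuple_cat m n (p : m.-tuple T * n.-tuple T) : (m + n).-tuple T :=
  [tuple of p.1 ++ p.2].

Lemma measurable_tuple_cat m n : measurable_fun setT (@tuple_cat m n).
Proof.
apply/measurable_fun_tnthP => i.
rewrite -[i](splitK i); case: (fintype.split i) => j /=.
  rewrite (_ : _ \o _ = (fun xs => tnth xs j) \o fst).
    by apply: measurableT_comp => //; exact: measurable_tnth.
  by apply/funext => -[xs ys] /=; rewrite tnth_lshift.
rewrite (_ : _ \o _ = (fun xs => tnth xs j) \o snd).
  by apply: measurableT_comp => //; exact: measurable_tnth.
by apply/funext => -[xs ys] /=; rewrite tnth_rshift.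
Qed.

Lemma tuple_cat_cons m n x (xs : m.-tuple T) (ys : n.-tuple T) :
  tuple_cat (tuple_cons (x, xs), ys) = tuple_cons (x, tuple_cat (xs, ys)).
Proof. exact: val_inj. Qed.

(** The tail is the outer variable because it will carry the fixed configuration. Induction on [m]
    peels off one entry of the inner block, and Tonelli moves that entry past the tail. *)
Lemma ge0_integral_tuple_cat m n (f : (m + n).-tuple T -> \bar R) :
  measurable_fun setT f -> (forall xs, 0 <= f xs) ->
  \int[TM (m + n)]_ws f ws = \int[TM n]_ys \int[TM m]_xs f (tuple_cat (xs, ys)).
Proof.
elim: m f => [|m IH] f mf f0.
  under [RHS]eq_integral => ys _.
    rewrite ge0_integral_tuple0; last first.
      apply: measurableT_comp => //.
      by apply: (measurableT_comp (@measurable_tuple_cat 0 n)); exact: measurable_pair2.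
    over.
  by apply: eq_integral => ys _ /=; congr f; exact: val_inj.
pose g (p : T * n.-tuple T) := \int[TM m]_xs f (tuple_cons (p.1, tuple_cat (xs, p.2))).
have mg : measurable_fun setT g.
  pose F (q : (T * n.-tuple T) * m.-tuple T) :=
    f (tuple_cons (q.1.1, tuple_cat (q.2, q.1.2))).
  rewrite (_ : g = fubini_F (TM m) F)//.
  apply: measurable_fun_fubini_tonelli_F => [|q]; last exact: f0.
  apply: measurableT_comp => //.
  apply: (measurableT_comp (@measurable_tuple_cons _ _ _)) => /=.
  apply/measurable_fun_pair => /=.
    by apply: measurableT_comp.
  apply: (measurableT_comp (@measurable_tuple_cat m n)).
  apply/measurable_fun_pair => //=.
  by apply: measurableT_comp.
transitivity (\int[mu]_x \int[TM n]_ys g (x, ys)).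
  rewrite (@ge0_integral_tupleS (m + n))//.
  apply: eq_integral => x _; rewrite IH//.
  by apply: measurableT_comp => //; exact: measurable_tuple_consl.
rewrite (fubini_tonelli g)//; last by move=> p; exact: integral_ge0.
apply: eq_integral => ys _; rewrite (ge0_integral_tupleS (n := m))//.
  apply: eq_integral => x _; apply: eq_integral => xs _ /=.
  by rewrite tuple_cat_cons.
apply: measurableT_comp => //.
by apply: (measurableT_comp (@measurable_tuple_cat m.+1 n)); exact: measurable_pair2.
Qed.

(** Fubini for null sets, in the form that turns a bound valid almost everywhere on [m + n] points
    into one valid for almost all [m] points once almost any [n] points are fixed. *)
Lemma null_tuple_cat m n (A : set ((m + n).-tuple T)) : measurable A ->
  TM (m + n) A = 0 ->
  {ae TM n, forall ys, TM m [set xs | A (tuple_cat (xs, ys))] = 0}.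
Proof.
move=> mA.
have mI : measurable_fun setT (fun w => (\1_A w)%:E : \bar R).
  by apply/measurable_EFinP; exact: measurable_indic.
have mcat : measurable [set p | A (@tuple_cat m n p)].
  by rewrite -[X in measurable X]setTI; exact: measurable_tuple_cat.
have msec ys : measurable [set xs | A (@tuple_cat m n (xs, ys))].
  rewrite (_ : [set _ | _] = ysection [set p | A (@tuple_cat m n p)] ys).
    exact: measurable_ysection.
  by apply/seteqP; split=> xs; rewrite /ysection /= inE.
rewrite -[A in TM _ A](setIT A) -(integral_indic (TM (m + n)))//.
rewrite ge0_integral_tuple_cat//.
have E ys : \int[TM m]_xs (\1_A (tuple_cat (xs, ys)))%:E =
            TM m [set xs | A (tuple_cat (xs, ys))].
  rewrite (eq_integral (fun xs => (\1_[set xs | A (tuple_cat (xs, ys))] xs)%:E)).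
    by rewrite integral_indic// setIT.
  by move=> xs _; rewrite !indicE; congr (_%:R%:E); rewrite !in_setE.
under eq_integral do rewrite E.
rewrite ae_eq0_integral//.
rewrite (_ : (fun ys => _) = (TM m) \o ysection [set p | A (@tuple_cat m n p)]).
  exact: measurable_fun_ysection.
apply/funext => ys /=; congr (TM m _).
by apply/seteqP; split=> xs; rewrite /ysection /= inE.
Qed.

Definition tuple_del n (i : 'I_n.+1) (xs : n.+1.-tuple T) : n.-tuple T :=
  [tuple tnth xs (lift i j) | j < n].

Lemma measurable_tuple_del n (i : 'I_n.+1) : measurable_fun setT (tuple_del i).
Proof.
apply/measurable_fun_tnthP => j.
rewrite (_ : _ \o _ = fun xs => tnth xs (lift i j)).
  exact: measurable_tnth.
by apply/funext => xs /=; rewrite tnth_mktuple.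
Qed.

Lemma tuple_del0 n x (xs : n.-tuple T) : tuple_del ord0 (tuple_cons (x, xs)) = xs.
Proof. by apply: eq_from_tnth => j; rewrite tnth_mktuple tnthS. Qed.

Lemma tuple_delS n (i : 'I_n.+1) x (xs : n.+1.-tuple T) :
  tuple_del (lift ord0 i) (tuple_cons (x, xs)) = tuple_cons (x, tuple_del i xs).
Proof.
apply: eq_from_tnth => j; rewrite tnth_mktuple.
have [k ->|->] := unliftP ord0 j.
  rewrite (_ : @lift n.+2 (lift ord0 i) (lift ord0 k) = lift ord0 (lift i k)).
    by rewrite !tnthS tnth_mktuple.
  by apply: val_inj => /=; rewrite /bump !leq0n !add1n ltnS addnS.
by rewrite (_ : @lift n.+2 (lift ord0 i) ord0 = ord0)//; exact: val_inj.
Qed.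

(** The preimage leaves entry [i] free, so it is a product of a null set with the whole space.
    Induction moves the free entry to the head. *)
Lemma null_tuple_del n (i : 'I_n.+1) (B : set (n.-tuple T)) : measurable B ->
  TM n B = 0 -> TM n.+1 (tuple_del i @^-1` B) = 0.
Proof.
elim: n i B => [|n IH] i B mB B0.
  apply/null_tupleSP.
    by rewrite -[X in measurable X]setTI; exact: measurable_tuple_del.
  apply: aeW => x; rewrite -B0; congr (TM 0 _); apply/seteqP.
  rewrite (ord1 i).
  by split=> xs; rewrite /= tuple_del0.
have mdB : measurable (tuple_del i @^-1` B).
  by rewrite -[X in measurable X]setTI; exact: measurable_tuple_del.
apply/null_tupleSP => //.
have [j ij|i0] := unliftP ord0 i.
  move/null_tupleSP : B0 => /(_ mB); apply: filterS => x Bx0.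
  rewrite (_ : [set _ | _] = tuple_del j @^-1` [set xs | B (tuple_cons (x, xs))]).
    exact: (IH j _ (measurable_tuple_consV x mB) Bx0).
  by apply/seteqP; split=> xs; rewrite /preimage /= ij tuple_delS.
apply: aeW => x; rewrite -B0; congr (TM _ _); apply/seteqP.
by split=> xs; rewrite /= i0 tuple_del0.
Qed.

Lemma integral_tuple_prod n (f : T -> R) : measurable_fun setT f ->
  (forall x, (0 <= f x)%R) ->
  \int[TM n]_xs (\prod_(x <- xs) f x)%:E = (\int[mu]_x (f x)%:E) ^+ n.
Proof.
move=> mf f0.
have mprod k : measurable_fun setT (fun xs : k.-tuple T => \prod_(x <- xs) f x)%R.
  under eq_fun do rewrite big_tuple.
  apply: measurable_prod => j _.
  by apply: measurableT_comp => //; exact: measurable_tnth.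
have p0 (s : seq T) : (0 <= \prod_(x <- s) f x)%R by rewrite prodr_ge0.
elim: n => [|n IH].
  by rewrite ge0_integral_tuple0 ?big_nil ?expe0//; apply/measurable_EFinP; exact: mprod.
rewrite ge0_integral_tupleS//; last 2 first.
- by apply/measurable_EFinP; exact: mprod.
- by move=> xs; rewrite lee_fin.
under eq_integral => x _.
  under eq_integral do rewrite /= big_cons EFinM.
  rewrite ge0_integralZl//; last 3 first.
  - by apply/measurable_EFinP; exact: mprod.
  - by move=> xs _; rewrite lee_fin.
  - by rewrite lee_fin.
  rewrite IH; over.
rewrite ge0_integralZr//.
- by rewrite expeS.
- exact/measurable_EFinP.
- by move=> x _; rewrite lee_fin.
- by apply: expe_ge0; apply: integral_ge0 => x _; rewrite lee_fin.
Qed.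

End tuples.

Section tuples_right.
Context {disp : measure_display} {T : measurableType disp} {R : realType}.
Variable mu : {sigma_finite_measure set T -> \bar R}.
Local Notation TM n := (tuple_measure mu n).
Local Open Scope ereal_scope.

(** The counterpart of [null_tupleSP] with the tail fixed and the head varying, as required when one
    point of a configuration is replaced by a new one. *)
Lemma null_tupleSrP n (A : set (n.+1.-tuple T)) : measurable A ->
  TM n.+1 A = 0 <->
  {ae TM n, forall xs, mu [set x | A (tuple_cons (x, xs))] = 0}.
Proof.
move=> mA.
have mI : measurable_fun setT (fun w => (\1_A w)%:E : \bar R).
  by apply/measurable_EFinP; exact: measurable_indic.
have mcons : measurable [set p | A (@tuple_cons _ T n p)].
  by rewrite -[X in measurable X]setTI; exact: measurable_tuple_cons.
rewrite -[A in TM _ A](setIT A) -(integral_indic (TM n.+1))//.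
rewrite ge0_integral_tupleSr//.
have E xs : \int[mu]_x (\1_A (tuple_cons (x, xs)))%:E =
            mu [set x | A (tuple_cons (x, xs))].
  rewrite (eq_integral (fun x => (\1_[set x | A (tuple_cons (x, xs))] x)%:E)).
    by rewrite integral_indic ?setIT//; exact: measurable_tuple_consVr.
  by move=> x _; rewrite !indicE; congr (_%:R%:E); rewrite !in_setE.
under eq_integral do rewrite E.
rewrite ae_eq0_integral//.
rewrite (_ : (fun ys => _) = mu \o ysection [set p | A (@tuple_cons _ T n p)]).
  exact: measurable_fun_ysection.
apply/funext => xs /=; congr (mu _).
by apply/seteqP; split=> x; rewrite /ysection /= inE.
Qed.

End tuples_right.

(** * Translation invariance of Lebesgue measure *)

Section translation.
Context {R : realType}.
Local Open Scope ereal_scope.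

Lemma measurable_shift (c : R) :
  measurable_fun setT (fun x : measurableTypeR R => (x - c)%R : measurableTypeR R).
Proof. by apply: (@measurable_funB _ R R). Qed.

(** By uniqueness of Lebesgue measure it suffices to compare half-open intervals. *)
Lemma lebesgue_measure_shift (c : R) (A : set (measurableTypeR R)) : measurable A ->
  pushforward lebesgue_measure (fun x : measurableTypeR R => (x - c)%R : measurableTypeR R) A =
  lebesgue_measure A.
Proof.
pose f : {mfun measurableTypeR R >-> measurableTypeR R} :=
  HB.pack (fun x : measurableTypeR R => (x - c)%R : measurableTypeR R)
    (isMeasurableFun.Build _ _ _ _ _ (measurable_shift c)).
move=> mA.
apply/esym/(@lebesgue_measure_unique _ (pushforward lebesgue_measure f)) => //= _ [[a b]] _ <-.
rewrite /pushforward.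
rewrite (_ : _ @^-1` _ = `](a + c)%R, (b + c)%R]%classic).
  rewrite !lebesgue_measure_itv/= !lte_fin ltrD2r; case: ifPn => // _.
  by congr (_%:E); ring.
by apply/seteqP; split=> x /=; rewrite !in_itv/= ltrBrDr lerBlDr.
Qed.

Lemma ge0_integral_shift (f : measurableTypeR R -> \bar R) (c : R) :
  measurable_fun setT f -> (forall x, 0 <= f x) ->
  \int[lebesgue_measure]_x f (x - c)%R = \int[lebesgue_measure]_x f x.
Proof.
move=> mf f0.
pose s : {mfun measurableTypeR R >-> measurableTypeR R} :=
  HB.pack (fun x : measurableTypeR R => (x - c)%R : measurableTypeR R)
    (isMeasurableFun.Build _ _ _ _ _ (measurable_shift c)).
transitivity (\int[pushforward lebesgue_measure s]_x f x).
  rewrite ge0_integral_pushforward// preimage_setT//.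
by apply: eq_measure_integral => A mA _; exact: lebesgue_measure_shift.
Qed.

Lemma measurable_subRd d' d (T : measurableType d') (f g : T -> Rd R d) :
  measurable_fun setT f -> measurable_fun setT g ->
  measurable_fun setT (fun t => subRd (f t) (g t)).
Proof.
move=> mf mg; apply/measurable_fun_tnthP => i.
rewrite (_ : _ \o _ = fun t => (tnth (f t) i - tnth (g t) i)%R).
  by apply: measurable_funB; apply: (measurableT_comp (measurable_tnth i)).
by apply/funext => t /=; rewrite tnth_mktuple.
Qed.

Lemma subRd_cons d (x : R) (xs : Rd R d) (y : Rd R d.+1) :
  subRd (tuple_cons (x : measurableTypeR R, xs)) y =
  tuple_cons ((x - thead y)%R : measurableTypeR R, subRd xs [tuple of behead y]).
Proof.
apply: eq_from_tnth => i; rewrite tnth_mktuple.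
have [j ->|->] := unliftP ord0 i; last by [].
by rewrite !tnthS tnth_mktuple [in LHS](tuple_eta y) tnthS.
Qed.

Lemma ge0_integral_subRd d (f : Rd R d -> \bar R) (y : Rd R d) :
  measurable_fun setT f -> (forall x, 0 <= f x) ->
  \int[lebesgue_Rd R d]_x f (subRd x y) = \int[lebesgue_Rd R d]_x f x.
Proof.
elim: d f y => [|d IH] f y mf f0.
  by apply: eq_integral => x _; congr f; apply: eq_from_tnth => -[].
have mfc (x : measurableTypeR R) : measurable_fun setT (fun xs : Rd R d => f (tuple_cons (x, xs))).
  by apply: (measurableT_comp mf); exact: measurable_tuple_consl.
rewrite /lebesgue_Rd ge0_integral_tupleS//; last first.
  apply: (measurableT_comp mf); apply: measurable_subRd; first exact: measurable_id.
  exact: measurable_cst.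
under eq_integral => x _.
  under eq_integral do rewrite subRd_cons.
  rewrite (IH (fun xs => f (tuple_cons (_, xs))))//; over.
rewrite (ge0_integral_shift (f := fun x => \int[_]_xs f (tuple_cons (x, xs))))//.
- by rewrite ge0_integral_tupleS.
- apply: (measurable_fun_fubini_tonelli_F (fun p => f (tuple_cons p))) => //.
  by apply: measurableT_comp => //; exact: measurable_tuple_cons.
- by move=> x; exact: integral_ge0.
Qed.

End translation.

(** * Points, finite sets and diagonals are null *)

Section diagonals.
Context {R : realType} {d : nat}.
Local Open Scope ereal_scope.
Local Notation leb := (lebesgue_Rd R d).
Local Notation TM n := (tuple_measure leb n).

Lemma measurable_eqRd d' (T : measurableType d') (f g : T -> Rd R d) :
  measurable_fun setT f -> measurable_fun setT g ->
  measurable [set t | f t = g t].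
Proof.
move=> mf mg.
rewrite (_ : [set _ | _] =
    \bigcap_(l in [set: 'I_d]) [set t | tnth (f t) l = tnth (g t) l]).
  apply: fin_bigcap_measurable => [|l _]; first exact: finite_finset.
  have := measurable_fun_eqr (measurableT_comp (measurable_tnth l) mf)
    (measurableT_comp (measurable_tnth l) mg) measurableT
    (I : measurable ([set true] : set bool)).
  rewrite setTI; congr measurable; apply/seteqP.
  by split=> t /= /eqP.
apply/seteqP; split=> t /=; first by move=> E l _ /=; rewrite E.
by move=> H; apply: eq_from_tnth => l; exact: H.
Qed.

Lemma measurable_fun_inRd d' (T : measurableType d') n (f : T -> Rd R d)
    (g : T -> n.-tuple (Rd R d)) :
  measurable_fun setT f -> measurable_fun setT g ->
  measurable_fun setT (fun t => f t \in g t).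
Proof.
move=> mf mg; apply: (measurable_fun_bool true); rewrite setTI.
rewrite (_ : _ @^-1` _ =
    \bigcup_(i in [set: 'I_n]) [set t | f t = tnth (g t) i]).
  apply: fin_bigcup_measurable => [|i _]; first exact: finite_finset.
  by apply: measurable_eqRd => //; exact: (measurableT_comp (measurable_tnth i)).
apply/seteqP; split=> t /=.
  by move=> /tnthP[i fi]; exists i.
by move=> [i _ /= fi]; apply/tnthP; exists i.
Qed.

Hypothesis d_gt0 : (0 < d)%N.

(** Positivity of [d] enters here: for [d = 0] the space is a single point of mass one. *)
Lemma lebesgue_Rd_set1 (x : Rd R d) : leb [set x] = 0.
Proof.
case: d d_gt0 x => // d' _ x.
have mx : measurable [set x : Rd R d'.+1].
  rewrite (_ : [set x] = [set y : Rd R d'.+1 | y = x]) ?set1_sing//.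
  rewrite (_ : [set y : Rd R d'.+1 | y = x] =
    \bigcap_(l in [set: 'I_d'.+1]) [set t | tnth t l = tnth x l]).
    apply: fin_bigcap_measurable => [|l _]; first exact: finite_finset.
    rewrite -[X in measurable X]setTI.
    exact: (measurable_tnth l measurableT (measurable_set1 (tnth x l))).
  apply/seteqP; split=> t /=; first by move=> E l _ /=; rewrite E.
  by move=> H; apply: eq_from_tnth => l; exact: H.
apply/null_tupleSP => //.
exists [set thead x]; split; first exact: measurable_set1.
  exact: lebesgue_measure_set1.
move=> y /= H; apply: contrapT => yx; apply: H.
rewrite (_ : [set _ | _] = set0) ?measure0//.
apply/seteqP; split=> // xs /= H; apply: yx.
by rewrite -H.
Qed.

Lemma lebesgue_Rd_seq (s : seq (Rd R d)) : leb.-negligible [set x | x \in s].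
Proof.
elim: s => [|x s IH].
  rewrite (_ : [set _ | _] = set0); first exact: negligible_set0.
  by apply/seteqP; split=> x.
rewrite (_ : [set _ | _] = [set x] `|` [set y | y \in s]).
  apply: negligibleU => //; exists [set x]; split => //.
  - have := measurable_eqRd (@measurable_id _ _ setT) (measurable_cst x).
    by congr measurable; apply/seteqP; split=> t.
  - exact: lebesgue_Rd_set1.
apply/seteqP; split=> y /=; rewrite inE.
  by move=> /orP[/eqP|]; [left|right].
by move=> [->|->]; rewrite ?eqxx ?orbT.
Qed.

(** Over a tail with distinct entries, the head creates a repetition only if it lies in the finite
    set of these entries, which is null. *)
Lemma tuple_measure_diag n : TM n (~` off_diag n) = 0.
Proof.
have mo k : measurable (~` @off_diag R d k).
  by apply: measurableC; exact: measurable_off_diag.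
elim: n => [|n IH].
  rewrite (_ : ~` _ = set0) ?measure0//.
  by apply/seteqP; split=> // xs; rewrite /off_diag /= tuple0.
apply/null_tupleSrP => //.
exists (~` off_diag n); split; [exact: mo|exact: IH|].
move=> xs /= H un; apply: H.
apply: measure_negligible; first exact: (measurable_tuple_consVr xs (mo n.+1)).
apply: negligibleS (lebesgue_Rd_seq (tval xs)) => x /=.
move: un; rewrite /off_diag/= => un /negP.
by rewrite negb_and negbK un orbF.
Qed.

End diagonals.

(** * Integration over finite configurations *)

Section configuration_space.
Context {R : realType} {d : nat}.
Local Notation X := (Rd R d).
Local Notation leb := (lebesgue_Rd R d).
Local Notation lp := (lebesgue_poisson R d).
Local Notation TM n := (tuple_measure leb n).

Lemma conf_ofP n (xs : n.-tuple X) x : (x \in conf_of xs) = (x \in tval xs).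
Proof. by rewrite /conf_of in_fset. Qed.

Lemma conf_of_cons n x (xs : n.-tuple X) :
  conf_of (tuple_cons (x, xs)) = (x |` conf_of xs)%fset.
Proof. by apply/fsetP => y; rewrite !inE. Qed.

Lemma conf_of_cat m n (xs : m.-tuple X) (ys : n.-tuple X) :
  conf_of (tuple_cat (xs, ys)) = (conf_of xs `|` conf_of ys)%fset.
Proof. by apply/fsetP => y; rewrite in_fsetU !conf_ofP mem_cat. Qed.

Lemma card_conf_of n (xs : n.-tuple X) : off_diag n xs -> #|` conf_of xs| = n.
Proof.
rewrite /off_diag /= => u; rewrite -[RHS](size_tuple xs).
apply/perm_size/uniq_perm; [exact: fset_uniq|exact: u|].
by move=> x; rewrite -conf_ofP.
Qed.

Lemma big_conf_of (S : Type) (idx : S) (op : Monoid.com_law idx) n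
    (xs : n.-tuple X) (F : X -> S) : off_diag n xs ->
  \big[op/idx]_(x <- conf_of xs) F x = \big[op/idx]_(i < n) F (tnth xs i).
Proof.
rewrite /off_diag /= => u.
transitivity (\big[op/idx]_(x <- tval xs) F x); last by rewrite big_tuple.
apply/perm_big/uniq_perm; [exact: fset_uniq|exact: u|].
by move=> x; rewrite -conf_ofP.
Qed.

Lemma mem_tuple_del n (i : 'I_n.+1) (xs : n.+1.-tuple X) x :
  off_diag n.+1 xs ->
  (x \in tval (tuple_del i xs)) = (x != tnth xs i) && (x \in tval xs).
Proof.
move=> /tuple_uniqP u; apply/tnthP/andP => [[j]|[xi /tnthP[j xj]]].
  rewrite tnth_mktuple => ->; split; last exact: mem_tnth.
  by apply/eqP => /u /eqP; rewrite eq_sym; apply/negP/neq_lift.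
have : i != j by apply: contra xi => /eqP ->; apply/eqP.
move=> /unlift_some[k jk _]; exists k.
by rewrite tnth_mktuple -jk.
Qed.

Lemma conf_of_del n (i : 'I_n.+1) (xs : n.+1.-tuple X) : off_diag n.+1 xs ->
  (conf_of xs `\ tnth xs i)%fset = conf_of (tuple_del i xs).
Proof.
move=> u; apply/fsetP => x; rewrite in_fsetD1 !conf_ofP.
by rewrite (mem_tuple_del _ _ u).
Qed.

Lemma off_diag_del n (i : 'I_n.+1) (xs : n.+1.-tuple X) : off_diag n.+1 xs ->
  off_diag n (tuple_del i xs).
Proof.
move=> /tuple_uniqP u; apply/tuple_uniqP => j k.
by rewrite !tnth_mktuple => /u /lift_inj.
Qed.

(** Measurable sets of configurations are tested on tuples with distinct entries only. On the
    diagonals, deleting a repeated entry does not change the configuration, which reduces to shorter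
    tuples. *)
Lemma measurable_conf_of n : measurable_fun setT (@conf_of R d n).
Proof.
elim: n => [|n IH] _ A mA; rewrite setTI.
  rewrite (_ : _ @^-1` A = off_diag 0 `&` @conf_of R d 0 @^-1` A); first exact: mA.
  by apply/seteqP; split=> xs /=; [split => //; rewrite /off_diag /= tuple0|case].
rewrite (_ : _ @^-1` A = (off_diag n.+1 `&` @conf_of R d n.+1 @^-1` A) `|`
   \bigcup_(i in [set: 'I_n.+1]) \bigcup_(j in [set: 'I_n])
     ([set xs | tnth xs i = tnth xs (lift i j)] `&`
      tuple_del i @^-1` (@conf_of R d n @^-1` A))).
  apply: measurableU; first exact: mA.
  apply: fin_bigcup_measurable => [|i _]; first exact: finite_finset.
  apply: fin_bigcup_measurable => [|j _]; first exact: finite_finset.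
  apply: measurableI; first by apply: measurable_eqRd; exact: measurable_tnth.
  rewrite -[X in measurable X]setTI; apply: measurable_tuple_del => //.
  by rewrite -[X in measurable X]setTI; exact: IH.
have E (xs : n.+1.-tuple X) i j : tnth xs i = tnth xs (lift i j) ->
    conf_of (tuple_del i xs) = conf_of xs.
  move=> xij; apply/fsetP => x; rewrite !conf_ofP; apply/tnthP/tnthP.
    by move=> [k ->]; exists (lift i k); rewrite tnth_mktuple.
  move=> [k ->]; have [l ->|->] := unliftP i k.
    by exists l; rewrite tnth_mktuple.
  by exists j; rewrite tnth_mktuple.
apply/seteqP; split=> xs /=.
  move=> Axs; have [u|u] := pselect (off_diag n.+1 xs); [by left|right].
  have : ~ injective (tnth xs) by move=> /tuple_uniqP.
  move=> /existsNP[i] /existsNP[j] /not_implyP[xij ij].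
  have : i != j by apply/eqP.
  move=> /unlift_some[k jk _]; rewrite jk in xij.
  by exists i => //; exists k => //; split => //=; rewrite (E _ _ k).
by case=> [[]//|[i _ [j _ [/= xij]]]]; rewrite (E _ _ _ xij).
Qed.

Lemma measurable_fun_confP d' (Y : measurableType d') (h : conf R d -> Y) :
  measurable_fun setT h <->
  forall n, measurable_fun setT (fun xs : n.-tuple X => h (conf_of xs)).
Proof.
split=> [mh n|mh]; first exact: (measurableT_comp mh (@measurable_conf_of n)).
move=> _ A mA; rewrite setTI.
suff : measurable_conf (h @^-1` A) by [].
move=> n.
apply: measurableI; first exact: measurable_off_diag.
by have := mh n measurableT _ mA; rewrite setTI.
Qed.

Hypothesis d_gt0 : (0 < d)%N.
Local Open Scope ereal_scope.

Lemma conf_measureE n (A : set (conf R d)) : measurable A ->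
  conf_measure n A = TM n (@conf_of R d n @^-1` A).
Proof.
move=> mA; rewrite /conf_measure.
have mcA : measurable (@conf_of R d n @^-1` A).
  by rewrite -[X in measurable X]setTI; exact: measurable_conf_of.
have mo := @measurable_off_diag R d n.
rewrite -[X in _ = TM n X]setTI -(setUv (@off_diag R d n)) setIUl measureU//.
- rewrite [X in _ = _ + X](_ : _ = 0) ?adde0//.
  apply: (subset_measure0 _ _ _ (tuple_measure_diag d_gt0 n)); last exact: subIsetl.
  + by apply: measurableI => //; exact: measurableC.
  + exact: measurableC.
- exact: measurableI.
- by apply: measurableI => //; exact: measurableC.
- by rewrite setIACA setICr set0I.
Qed.

Lemma lebesgue_poisson_null (A : set (conf R d)) : measurable A ->
  lp A = 0 <-> forall n, TM n (@conf_of R d n @^-1` A) = 0.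
Proof.
move=> mA; rewrite lebesgue_poisson_eq0.
by split=> H n; have := H n; rewrite conf_measureE.
Qed.

Lemma ge0_integral_conf_measure n (h : conf R d -> \bar R) :
  measurable_fun setT h -> (forall xi, 0 <= h xi) ->
  \int[conf_measure n]_xi h xi = \int[TM n]_xs h (conf_of xs).
Proof.
move=> mh h0.
pose s : {mfun (n.-tuple X) >-> conf R d} :=
  HB.pack (@conf_of R d n) (isMeasurableFun.Build _ _ _ _ _ (@measurable_conf_of n)).
transitivity (\int[pushforward (TM n) s]_xi h xi).
  by apply: eq_measure_integral => A mA _; exact: conf_measureE.
by rewrite ge0_integral_pushforward// preimage_setT.
Qed.

Lemma ge0_integral_lp (h : conf R d -> \bar R) :
  measurable_fun setT h -> (forall xi, 0 <= h xi) ->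
  \int[lp]_xi h xi =
  \sum_(n <oo) ((n`!%:R^-1)%:E * \int[TM n]_xs h (conf_of xs)).
Proof.
move=> mh h0; rewrite ge0_integral_measure_series//.
apply: eq_eseriesr => n _.
by rewrite ge0_integral_mscale//= ge0_integral_conf_measure.
Qed.

Section parameter.
Context {d' : measure_display} {P : measurableType d'}.

(* Configurations are read off through tuples, so that Tonelli's theorem applies to
   the sigma-finite [tuple_measure]s. *)
Definition jointly_measurable d'' (Y : measurableType d'')
    (H : P -> conf R d -> Y) :=
  forall n, measurable_fun setT
    (fun q : P * n.-tuple X => H q.1 (conf_of q.2)).

Lemma jointly_measurable_section d'' (Y : measurableType d'')
    (H : P -> conf R d -> Y) p :
  jointly_measurable H -> measurable_fun setT (H p).
Proof.
move=> mH; apply/measurable_fun_confP => n.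
exact: (measurableT_comp (mH n) (measurable_pair1 p)).
Qed.

Lemma ge0_measurable_integral_lp (H : P -> conf R d -> \bar R) :
  jointly_measurable H -> (forall p xi, 0 <= H p xi) ->
  measurable_fun setT (fun p => \int[lp]_xi H p xi).
Proof.
move=> mH H0; under eq_fun => p.
  rewrite ge0_integral_lp//; last exact: jointly_measurable_section.
  over.
apply: ge0_emeasurable_sum => n.
  move=> p _; rewrite mule_ge0 ?integral_ge0//.
move=> _; apply: measurable_funeM.
exact: (measurable_fun_fubini_tonelli_F (fun q => H q.1 (conf_of q.2)) (mH n) (fun q => H0 q.1 _)).
Qed.

Lemma measurable_integral_lp (H : P -> conf R d -> \bar R) :
  jointly_measurable H -> measurable_fun setT (fun p => \int[lp]_xi H p xi).
Proof.
move=> mH; under eq_fun do rewrite integralE.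
apply: emeasurable_funB; apply: ge0_measurable_integral_lp => // n.
- by have := measurable_funepos (mH n); rewrite unlock.
- by have := measurable_funeneg (mH n); rewrite unlock.
Qed.

(** Tonelli is applied in each layer of fixed cardinality, and the series over the layers is
    exchanged with the integral over [P] by positivity. *)
Lemma tonelli_lp (m : {sigma_finite_measure set P -> \bar R})
    (H : P -> conf R d -> \bar R) :
  jointly_measurable H -> (forall p xi, 0 <= H p xi) ->
  \int[lp]_xi \int[m]_p H p xi = \int[m]_p \int[lp]_xi H p xi.
Proof.
move=> mH H0; rewrite ge0_integral_lp; last 2 first.
- apply/measurable_fun_confP => n.
  exact: (measurable_fun_fubini_tonelli_G (fun q => H q.1 (conf_of q.2)) (mH n)
    (fun q => H0 q.1 _)).
- by move=> xi; exact: integral_ge0.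
transitivity (\int[m]_p \sum_(n <oo)
    ((n`!%:R^-1)%:E * \int[TM n]_xs H p (conf_of xs))); last first.
  apply: eq_integral => p _; rewrite ge0_integral_lp//.
  exact: jointly_measurable_section.
have mF n : measurable_fun setT (fun p => \int[TM n]_xs H p (conf_of xs)).
  exact: (measurable_fun_fubini_tonelli_F (fun q => H q.1 (conf_of q.2)) (mH n)
    (fun q => H0 q.1 _)).
rewrite integral_nneseries//; last 2 first.
- by move=> n; exact: measurable_funeM.
- by move=> n p _; rewrite mule_ge0 ?integral_ge0.
apply: eq_eseriesr => n _; rewrite ge0_integralZl//; last first.
  by move=> p _; exact: integral_ge0.
congr (_ * _).
exact/esym/(fubini_tonelli (fun q => H q.1 (conf_of q.2)) (mH n) (fun q => H0 q.1 _)).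
Qed.

End parameter.

End configuration_space.

(** * Lebesgue-Poisson exponentials *)

Section econf_theory.
Context {R : realType} {d : nat}.
Local Notation X := (Rd R d).
Local Notation leb := (lebesgue_Rd R d).
Local Notation lp := (lebesgue_poisson R d).
Local Notation TM n := (tuple_measure leb n).

Lemma econf_ge0 (f : X -> R) (w : conf R d) : (forall x, 0 <= f x) -> 0 <= econf f w.
Proof. by move=> f0; exact: prodr_ge0. Qed.

Lemma econf_le1 (f : X -> R) (w : conf R d) :
  (forall x, 0 <= f x <= 1) -> econf f w <= 1.
Proof. by move=> f1; apply: prodr_ile1 => x _. Qed.

Lemma normr_econf (f : X -> R) (w : conf R d) :
  `|econf f w| = econf (fun x => `|f x|) w.
Proof. exact: normr_prod. Qed.

Lemma econf_cst (s : R) (w : conf R d) : econf (fun=> s) w = s ^+ #|` w|.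
Proof. by rewrite /econf big_const_seq count_predT iter_mulr mulr1. Qed.

Lemma econfM (f g : X -> R) (w : conf R d) :
  econf (fun x => f x * g x) w = econf f w * econf g w.
Proof. exact: big_split. Qed.

Lemma econf_conf_of n (f : X -> R) (xs : n.-tuple X) : off_diag n xs ->
  econf f (conf_of xs) = \prod_(x <- xs) f x.
Proof.
move=> u; rewrite /econf (big_conf_of _ _ u).
by rewrite (big_tuple _ _ xs xpredT f).
Qed.

Lemma econf_conf_of_cons n (f : X -> R) x (xs : n.-tuple X) :
  econf f (conf_of (tuple_cons (x, xs))) =
  if x \in xs then econf f (conf_of xs) else f x * econf f (conf_of xs).
Proof.
rewrite conf_of_cons; case: ifPn => xxs.
  congr econf; apply/fsetP => y; rewrite in_fset1U conf_ofP.
  by case: eqVneq => // ->.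
by rewrite /econf big_fsetU1//= conf_ofP.
Qed.

(** On a tuple with repetitions [econf] counts each point once, so adding a head multiplies by a
    factor or not according to membership in the tail, a measurable condition. *)
Lemma jointly_measurable_econf d' (P : measurableType d') (f : P -> X -> R) :
  measurable_fun setT (fun q : P * X => f q.1 q.2) ->
  jointly_measurable (fun p => econf (f p)).
Proof.
move=> mf; elim=> [|n IH].
  rewrite (_ : (fun _ => _) = cst 1); first exact: measurable_cst.
  apply/funext => q; rewrite /econf (_ : conf_of q.2 = fset0) ?big_seq_fset0//.
  by apply/fsetP => y; rewrite conf_ofP tuple0 in_fset0.
pose uncons (q : P * n.+1.-tuple X) : P * n.-tuple X := (q.1, [tuple of behead q.2]).
have mu : measurable_fun setT uncons.
  apply/measurable_fun_pair => //=.
  by apply: (measurableT_comp (@measurable_behead _ _ n)).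
have mh : measurable_fun setT (fun q : P * n.+1.-tuple X => thead q.2).
  by apply: (measurableT_comp (measurable_tnth ord0)).
have mI := measurableT_comp IH mu.
rewrite (_ : (fun _ => _) = fun q => if thead q.2 \in tval [tuple of behead q.2] then
    econf (f q.1) (conf_of [tuple of behead q.2])
    else f q.1 (thead q.2) * econf (f q.1) (conf_of [tuple of behead q.2])).
  apply: measurable_fun_ifT => //.
  - apply: measurable_fun_inRd => //.
    by apply: (measurableT_comp (@measurable_behead _ _ n)).
  - apply: measurable_funM => //.
    apply: (measurableT_comp (f := fun q : P * X => f q.1 q.2)
      (g := fun q : P * n.+1.-tuple X => (q.1, thead q.2))) => //.
    by apply/measurable_fun_pair.
apply/funext => -[p xs] /=.
rewrite -econf_conf_of_cons; congr (econf _ (conf_of _)).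
by rewrite [LHS]tuple_eta; exact: val_inj.
Qed.

Lemma measurable_econf (f : X -> R) : measurable_fun setT f ->
  measurable_fun setT (econf f).
Proof.
move=> mf.
apply: (jointly_measurable_section (P := unit) (H := fun=> econf f) tt).
by apply: jointly_measurable_econf; exact: measurableT_comp.
Qed.

Lemma measurable_fun_card_pow (s : R) :
  measurable_fun setT (fun w : conf R d => s ^+ #|` w|).
Proof.
under eq_fun do rewrite -econf_cst.
by apply: measurable_econf; exact: measurable_cst.
Qed.

Lemma conf_tuple (w : conf R d) :
  exists n (ys : n.-tuple X), conf_of ys = w /\ off_diag n ys.
Proof.
exists #|` w|, (in_tuple (enum_fset w)); split; last exact: fset_uniq.
by apply/fsetP => y; rewrite conf_ofP.
Qed.

Lemma measurable_fsetU d' (Y : measurableType d') (k : conf R d -> Y) (w : conf R d) :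
  measurable_fun setT k -> measurable_fun setT (fun xi : conf R d => k (xi `|` w)%fset).
Proof.
move=> mk; have [m [ys [<- _]]] := conf_tuple w.
apply/measurable_fun_confP => n; under eq_fun do rewrite -conf_of_cat.
apply: (measurableT_comp mk); apply: (measurableT_comp (@measurable_conf_of R d _)).
by apply: (measurableT_comp (@measurable_tuple_cat _ _ _ _)); exact: measurable_pair2.
Qed.

Hypothesis d_gt0 : (0 < d)%N.
Local Open Scope ereal_scope.

Lemma ae_off_diag n : {ae TM n, forall xs, off_diag n xs}.
Proof.
exists (~` off_diag n); split => //; last exact: tuple_measure_diag.
by apply: measurableC; exact: measurable_off_diag.
Qed.

(** Off the null diagonals [econf] is a product of functions of separate entries, so the layer of
    [n] points contributes the [n]-th term of the exponential series. *)
Lemma integral_lp_econf (f : X -> R) (r : R) : measurable_fun setT f ->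
  (forall x, (0 <= f x)%R) -> \int[leb]_x (f x)%:E = r%:E ->
  \int[lp]_xi (econf f xi)%:E = (expR r)%:E.
Proof.
move=> mf f0 fr; rewrite ge0_integral_lp//; last 2 first.
- by apply/measurable_EFinP; exact: measurable_econf.
- by move=> xi; rewrite lee_fin econf_ge0.
under eq_eseriesr => n _.
  rewrite (_ : \int[TM n]_xs (econf f (conf_of xs))%:E = (r ^+ n)%:E).
    rewrite -EFinM; over.
  rewrite EFin_expe -fr -integral_tuple_prod//.
  apply: ge0_ae_eq_integral => //.
  - apply/measurable_EFinP.
    exact: (measurableT_comp (measurable_econf mf) (@measurable_conf_of R d n)).
  - apply/measurable_EFinP; under eq_fun do rewrite big_tuple.
    apply: measurable_prod => j _.
    exact: (measurableT_comp mf (measurable_tnth j)).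
  - by move=> xs _; rewrite lee_fin econf_ge0.
  - by move=> xs _; rewrite lee_fin prodr_ge0.
  - by apply: filterS (ae_off_diag n) => xs u _; rewrite econf_conf_of.
rewrite /expR -EFin_lim; last exact: is_cvg_series_exp_coeff.
apply: (congr1 (fun u => limn u)); apply/funext => n /=.
rewrite sumEFin /series /=; congr EFin; apply: eq_bigr => i _.
by rewrite mulrC.
Qed.

End econf_theory.

(** * Almost everywhere bounds *)

Section domination.
Context {R : realType} {d : nat}.
Hypothesis d_gt0 : (0 < d)%N.
Local Notation X := (Rd R d).
Local Notation leb := (lebesgue_Rd R d).
Local Notation lp := (lebesgue_poisson R d).
Local Notation TM n := (tuple_measure leb n).
Implicit Types (k : conf R d -> R) (C s : R) (w : conf R d).

Definition bounded_by k C s := {ae lp, forall xi, `|k xi| <= C * s ^+ #|` xi|}.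

(** The exponent is the sum of the two cardinalities, not the cardinality of the union: the weight
    then splits into a constant and a product over [xi]. The two agree for almost every [xi]. *)
Definition dominated k C s w :=
  {ae lp, forall xi : conf R d, `|k (xi `|` w)%fset| <= C * s ^+ (#|` xi| + #|` w|)}.

(** These are the configurations at which the operator reads [k]: the first part serves the loss,
    the second the gain, where a point [y] of [w] is exchanged for a new point [x]. *)
Definition well_dominated k C s w := dominated k C s w /\
  forall y, y \in w -> {ae leb, forall x, (x \notin w) /\ dominated k C s (x |` (w `\ y))%fset}.

Lemma measurable_bound k C s : measurable_fun setT k ->
  measurable [set xi | `|k xi| <= C * s ^+ #|` xi|].
Proof.
move=> mk; rewrite -[X in measurable X]setTI.
apply: (measurable_fun_le (f := fun xi => `|k xi|)
  (g := fun xi : conf R d => C * s ^+ #|` xi|)) => //.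
  exact: measurableT_comp.
by apply: measurable_funM => //; exact: measurable_fun_card_pow.
Qed.

Lemma measurable_dominated k C s w : measurable_fun setT k ->
  measurable [set xi : conf R d | `|k (xi `|` w)%fset| <= C * s ^+ (#|` xi| + #|` w|)].
Proof.
move=> mk; rewrite -[X in measurable X]setTI.
apply: (measurable_fun_le (f := fun xi : conf R d => `|k (xi `|` w)%fset|)
  (g := fun xi : conf R d => C * s ^+ (#|` xi| + #|` w|))) => //.
  by apply: measurableT_comp => //; exact: measurable_fsetU.
apply: measurable_funM => //; under eq_fun do rewrite exprD.
by apply: measurable_funM => //; exact: measurable_fun_card_pow.
Qed.

Lemma ae_lpP (A : set (conf R d)) : measurable A ->
  {ae lp, forall xi, A xi} <-> forall n, {ae TM n, forall xs, A (conf_of xs)}.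
Proof.
move=> mA.
have mAn n : measurable (@conf_of R d n @^-1` ~` A).
  by rewrite -[X in measurable X]setTI; apply: measurable_conf_of => //; exact: measurableC.
split=> [H n|H].
  have : lp (~` A) = 0%E by apply: measure_negligible => //; exact: measurableC.
  move/(lebesgue_poisson_null d_gt0 (measurableC mA)) => /(_ n) H0.
  exists (@conf_of R d n @^-1` ~` A); split; [exact: mAn|exact: H0|].
  by move=> xs.
apply/negligibleP; first exact: measurableC.
apply/(lebesgue_poisson_null d_gt0 (measurableC mA)) => n.
exact: measure_negligible (mAn n) (H n).
Qed.

Lemma ae_notin (s : seq X) : {ae leb, forall x, x \notin s}.
Proof.
by apply: negligibleS (lebesgue_Rd_seq d_gt0 s) => x /= /negP; rewrite negbK.
Qed.

Lemma ae_dominated k C s n : measurable_fun setT k -> bounded_by k C s ->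
  {ae TM n, forall ys, off_diag n ys -> dominated k C s (conf_of ys)}.
Proof.
move=> mk /(ae_lpP (measurable_bound C s mk)) kb.
(* The diagonals are included so that outside the bad set a concatenation has exactly [m + n]
   points. *)
pose Bad m : set (m.-tuple X) :=
  [set xs | ~ (`|k (conf_of xs)| <= C * s ^+ #|` conf_of xs|)] `|` ~` off_diag m.
have mBad m : measurable (Bad m).
  apply: measurableU; last by apply: measurableC; exact: measurable_off_diag.
  rewrite (_ : [set _ | _] = @conf_of R d m @^-1` ~` [set xi | `|k xi| <= C * s ^+ #|` xi|])//.
  rewrite -[X in measurable X]setTI; apply: measurable_conf_of => //.
  by apply: measurableC; exact: measurable_bound.
have Bad0 m : TM m (Bad m) = 0%E.
  apply: measure_negligible; first exact: mBad.
  have kbm : (TM m).-negligible [set xs | ~ (`|k (conf_of xs)| <= C * s ^+ #|` conf_of xs|)].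
    exact: (kb m).
  have od : (TM m).-negligible (~` off_diag m).
    exact: (ae_off_diag d_gt0 m).
  exact: negligibleU kbm od.
have H : {ae TM n, forall ys, forall m, TM m [set xs | Bad (m + n)%N (tuple_cat (xs, ys))] = 0%E}.
  by apply: ae_foralln => m; exact: null_tuple_cat.
apply: filterS H => ys H u; apply/ae_lpP; first exact: measurable_dominated.
move=> m.
have mc : measurable_fun setT (fun xs : m.-tuple X => tuple_cat (xs, ys)).
  by apply: (measurableT_comp (@measurable_tuple_cat _ _ m n)); exact: measurable_pair2.
exists [set xs | Bad (m + n)%N (tuple_cat (xs, ys))]; split => //.
  by have := mc measurableT _ (mBad (m + n)%N); rewrite setTI.
move=> xs /= K; have [uu|uu] := pselect (off_diag _ (tuple_cat (xs, ys))); [left|by right].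
move: K; rewrite /= conf_of_cat (card_conf_of u) card_conf_of.
  rewrite -conf_of_cat (card_conf_of uu); exact.
by move: uu; rewrite /off_diag /= cat_uniq => /and3P[].
Qed.

(** For the exchange, [W] collects the bad tuples of full length and [B] the shorter tuples over
    which the section of [W] is not null. Since [B] is null, so is its preimage under each deletion;
    hence for almost every tuple, whichever entry is deleted, almost every replacement avoids
    [W]. *)
Lemma ae_well_dominated k C s n : measurable_fun setT k -> bounded_by k C s ->
  {ae TM n, forall xs, off_diag n xs -> well_dominated k C s (conf_of xs)}.
Proof.
move=> mk kb.
have H1 := ae_dominated n mk kb.
suff H2 : {ae TM n, forall xs, off_diag n xs -> forall y, y \in tval xs ->
    {ae leb, forall x, dominated k C s (x |` (conf_of xs `\ y))%fset}}.
  apply: filterS2 H1 H2 => xs H1 H2 u; split; first exact: H1.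
  move=> y; rewrite conf_ofP => /(H2 u); apply: filterS2 (ae_notin (tval xs)).
  by move=> x; rewrite conf_ofP.
case: n H1 => [H1|n _].
  by apply: aeW => xs _ y; rewrite tuple0.
have [W [mW W0 WE]] := ae_dominated n.+1 mk kb.
have [B [mB B0 BE]] := (null_tupleSrP leb mW).1 W0.
have H (i : 'I_n.+1) : {ae TM n.+1, forall xs, ~ B (tuple_del i xs)}.
  exists (tuple_del i @^-1` B); split => //.
  - by rewrite -[X in measurable X]setTI; exact: measurable_tuple_del.
  - exact: null_tuple_del.
  - by move=> xs /= /contrapT.
have {}H : {ae TM n.+1, forall xs, forall i : 'I_n.+1, ~ B (tuple_del i xs)}.
  (* Indices are read as natural numbers, with nothing required beyond [n], so that [ae_foralln]
     applies. *)
  pose P (i : nat) xs := forall j : 'I_n.+1, j = i :> nat -> ~ B (tuple_del j xs).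
  have HP i : {ae TM n.+1, forall xs, P i xs}.
    have [ni|ni] := leqP n.+1 i.
      by apply: aeW => xs j ji; move: (ltn_ord j); rewrite ji ltnNge ni.
    apply: filterS (H (Ordinal ni)) => xs Bxs j ji.
    by rewrite (_ : j = Ordinal ni)//; exact: val_inj.
  by have := ae_foralln HP; apply: filterS => xs Hxs i; exact: (Hxs i i).
apply: filterS H => xs H u y /tnthP[i ->].
have : leb [set x | W (tuple_cons (x, tuple_del i xs))] = 0%E.
  by apply: contrapT => K; apply: (H i); exact: BE.
move=> W0i.
have aeW' : {ae leb, forall x, ~ W (tuple_cons (x, tuple_del i xs))}.
  exists [set x | W (tuple_cons (x, tuple_del i xs))]; split.
  - exact: measurable_tuple_consVr.
  - exact: W0i.
  - by move=> x /= /contrapT.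
apply: filterS2 aeW' (ae_notin (tval (tuple_del i xs))) => x Wx xxs.
apply: contrapT => K; apply: Wx; apply: WE => /= K'.
apply: K; rewrite (conf_of_del _ u) -conf_of_cons; apply: K'.
by rewrite /off_diag /= xxs; exact: off_diag_del.
Qed.

End domination.

(** * Measurability of the operator *)

Section Rintegral_lemmas.
Context {disp : measure_display} {T : measurableType disp} {R : realType}.
Variable m : {measure set T -> \bar R}.

(** [Rintegral] has a default value on divergent integrals, so each bound comes together with
    integrability, on which the linearity of the operator rests. *)
Lemma Rintegral_dominated (f g : T -> R) (b : R) :
  measurable_fun setT f -> measurable_fun setT g ->
  {ae m, forall x, `|f x| <= g x} -> (forall x, 0 <= g x) ->
  (\int[m]_x (g x)%:E <= b%:E)%E ->
  m.-integrable setT (EFin \o f) /\ `|\int[m]_x f x| <= b.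
Proof.
move=> mf mg fg g0 gb.
have fb : (\int[m]_x `|(EFin \o f) x| <= b%:E)%E.
  apply: le_trans gb; apply: ae_ge0_le_integral => //.
  - by apply: measurableT_comp => //; exact/measurable_EFinP.
  - by move=> x _; rewrite lee_fin.
  - exact/measurable_EFinP.
  - by apply: filterS fg => x fgx _; rewrite /= lee_fin.
have fi : m.-integrable setT (EFin \o f).
  apply/integrableP; split; first exact/measurable_EFinP.
  by apply: le_lt_trans fb _; rewrite ltry.
split => //; apply: le_trans (le_normr_Rintegral measurableT fi) _.
rewrite /Rintegral -lee_fin fineK//.
have /integrableP[_] := fi; rewrite ge0_fin_numE//.
by apply: integral_ge0 => x _; rewrite lee_fin.
Qed.

Lemma Rintegral_ae_linear (f f1 f2 : T -> R) (c : R) : measurable_fun setT f ->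
  m.-integrable setT (EFin \o f1) -> m.-integrable setT (EFin \o f2) ->
  {ae m, forall x, f x = f1 x + c * f2 x} ->
  \int[m]_x f x = \int[m]_x f1 x + c * \int[m]_x f2 x.
Proof.
move=> mf i1 i2 fE.
have i2' : m.-integrable setT (EFin \o (fun x => c * f2 x)).
  rewrite (_ : _ \o _ = fun x => (c%:E * (EFin \o f2) x)%E)//.
  exact: integrableZl.
rewrite -RintegralZl// -RintegralD//; congr fine.
apply: ae_eq_integral => //.
- exact/measurable_EFinP.
- have /integrableP[m1 _] := i1; have /integrableP[m2 _] := i2'.
  by apply/measurable_EFinP; apply: measurable_funD; exact/measurable_EFinP.
- by apply: filterS fE => x -> _.
Qed.

End Rintegral_lemmas.

Lemma measurable_Rintegral_param d1 d2 (P : measurableType d1) (T : measurableType d2)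
    (R : realType) (m : {sigma_finite_measure set T -> \bar R}) (F : P -> T -> R) :
  measurable_fun setT (fun q : P * T => F q.1 q.2) ->
  measurable_fun setT (fun p => \int[m]_x F p x).
Proof.
move=> mF; rewrite /Rintegral; apply: measurableT_comp => //.
under eq_fun do rewrite integralE.
have mF' : measurable_fun setT (fun q : P * T => (F q.1 q.2)%:E) by exact/measurable_EFinP.
apply: emeasurable_funB.
- apply: (measurable_fun_fubini_tonelli_F (fun q => (fun x => (F q.1 x)%:E)^\+ q.2))%E.
    by have := measurable_funepos mF'; rewrite unlock.
  by move=> q; exact: funepos_ge0.
- apply: (measurable_fun_fubini_tonelli_F (fun q => (fun x => (F q.1 x)%:E)^\- q.2))%E.
    by have := measurable_funeneg mF'; rewrite unlock.
  by move=> q; exact: funeneg_ge0.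
Qed.

Lemma measurable_Rintegral_lp (R : realType) (d : nat) (d_gt0 : (0 < d)%N) d1
    (P : measurableType d1) (F : P -> conf R d -> R) : jointly_measurable F ->
  measurable_fun setT (fun p => \int[lebesgue_poisson R d]_xi F p xi).
Proof.
move=> mF; apply: measurableT_comp => //.
apply: (measurable_integral_lp d_gt0 (H := fun p xi => (F p xi)%:E)) => n.
by apply/measurable_EFinP; exact: mF.
Qed.

Section kinetic.
Context {R : realType} {d : nat}.
Hypothesis d_gt0 : (0 < d)%N.
Local Notation X := (Rd R d).
Local Notation leb := (lebesgue_Rd R d).
Local Notation lp := (lebesgue_poisson R d).
Variables a phi : X -> R.
Hypothesis a_meas : measurable_fun setT a.
Hypothesis phi_meas : measurable_fun setT phi.

Local Notation t_ := (t_ phi).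
Local Notation tau_ := (tau_ phi).
Implicit Types (k : conf R d -> R) (C s : R) (w : conf R d).

Definition inner_integral k y w := \int[lp]_xi (econf (t_ y) xi * k (xi `|` w)%fset).

Definition gain_term k w y := \int[leb]_x
  (a (subRd x y) * econf (tau_ y) (x |` (w `\ y))%fset * inner_integral k y (x |` (w `\ y))%fset).

Definition loss_rate w xi := \sum_(x <- w) \int[leb]_y
  (a (subRd x y) * econf (tau_ y) w * econf (t_ y) xi).

Definition loss_term k w := \int[lp]_xi (k (xi `|` w)%fset * loss_rate w xi).

Lemma LDeltaE k w : LDelta a phi k w = \sum_(y <- w) gain_term k w y - loss_term k w.
Proof. by []. Qed.

Lemma measurable_a2 d1 (P : measurableType d1) (f g : P -> X) :
  measurable_fun setT f -> measurable_fun setT g ->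
  measurable_fun setT (fun p => a (subRd (f p) (g p))).
Proof. by move=> mf mg; apply: (measurableT_comp a_meas); exact: measurable_subRd. Qed.

Lemma measurable_t d1 (P : measurableType d1) (f g : P -> X) :
  measurable_fun setT f -> measurable_fun setT g ->
  measurable_fun setT (fun p => t_ (f p) (g p)).
Proof.
move=> mf mg; apply: measurable_funB; last exact: measurable_cst.
apply: measurableT_comp => //; apply: measurableT_comp => //.
by apply: (measurableT_comp phi_meas); exact: measurable_subRd.
Qed.

Lemma measurable_tau d1 (P : measurableType d1) (f g : P -> X) :
  measurable_fun setT f -> measurable_fun setT g ->
  measurable_fun setT (fun p => tau_ (f p) (g p)).
Proof.
by move=> mf mg; apply: measurable_funD; [exact: measurable_t|exact: measurable_cst].
Qed.

Lemma measurable_econf_tuple d1 (P : measurableType d1) n (f : X -> X -> R)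
    (g : P -> X) (xs : P -> n.-tuple X) :
  measurable_fun setT (fun q : X * X => f q.1 q.2) ->
  measurable_fun setT g -> measurable_fun setT xs ->
  measurable_fun setT (fun p => econf (f (g p)) (conf_of (xs p))).
Proof.
move=> mf mg mxs.
have mj : jointly_measurable (fun p => econf (f p)) := jointly_measurable_econf mf.
apply: (measurableT_comp (mj n) (g := fun p => (g p, xs p))).
by apply/measurable_fun_pair.
Qed.

Lemma measurable_inner d1 (P : measurableType d1) n k (g : P -> X)
    (xs : P -> n.-tuple X) : measurable_fun setT k ->
  measurable_fun setT g -> measurable_fun setT xs ->
  measurable_fun setT (fun p => inner_integral k (g p) (conf_of (xs p))).
Proof.
move=> mk mg mxs; apply: measurable_Rintegral_lp => // l.
apply: measurable_funM.
  apply: measurable_econf_tuple => //.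
    by apply: measurable_t.
  exact: (measurableT_comp mg).
under eq_fun do rewrite -conf_of_cat.
apply: (measurableT_comp mk); apply: (measurableT_comp (@measurable_conf_of R d _)).
apply: (measurableT_comp (@measurable_tuple_cat _ _ l n)).
by apply/measurable_fun_pair => //; exact: (measurableT_comp mxs).
Qed.

Lemma measurable_gain_integrand d1 (P : measurableType d1) n k (f g : P -> X)
    (xs : P -> n.-tuple X) : measurable_fun setT k ->
  measurable_fun setT f -> measurable_fun setT g -> measurable_fun setT xs ->
  measurable_fun setT (fun p => a (subRd (f p) (g p)) *
    econf (tau_ (g p)) (conf_of (tuple_cons (f p, xs p))) *
    inner_integral k (g p) (conf_of (tuple_cons (f p, xs p)))).
Proof.
move=> mk mf mg mxs.
have mc : measurable_fun setT (fun p => tuple_cons (f p, xs p)).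
  apply: (measurableT_comp (@measurable_tuple_cons _ _ n)).
  by apply/measurable_fun_pair.
apply: measurable_funM; last exact: measurable_inner.
apply: measurable_funM; first exact: measurable_a2.
by apply: measurable_econf_tuple => //; exact: measurable_tau.
Qed.

Lemma measurable_rate_term d1 (P : measurableType d1) n l (f : P -> X)
    (xs : P -> n.-tuple X) (zs : P -> l.-tuple X) :
  measurable_fun setT f -> measurable_fun setT xs -> measurable_fun setT zs ->
  measurable_fun setT (fun p => \int[leb]_y
    (a (subRd (f p) y) * econf (tau_ y) (conf_of (xs p)) * econf (t_ y) (conf_of (zs p)))).
Proof.
move=> mf mxs mzs.
apply: measurable_Rintegral_param.
apply: measurable_funM; last first.
  apply: measurable_econf_tuple => //; first by apply: measurable_t.
  exact: (measurableT_comp mzs).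
apply: measurable_funM.
  by apply: measurable_a2 => //; exact: (measurableT_comp mf).
apply: measurable_econf_tuple => //; first by apply: measurable_tau.
exact: (measurableT_comp mxs).
Qed.

(** Only tuples with distinct entries are tested. There the sums over the points become sums over
    indices and the removal of a point becomes [tuple_del]; [F n] is the resulting expression,
    measurable on all tuples. *)
Lemma measurable_LDelta k : measurable_fun setT k ->
  measurable_fun setT (LDelta a phi k).
Proof.
move=> mk.
have mtn n (i : 'I_n) : measurable_fun setT (fun xs : n.-tuple X => tnth xs i).
  exact: measurable_tnth.
pose rate' n (xs : n.-tuple X) xi := \sum_(i < n) \int[leb]_y
  (a (subRd (tnth xs i) y) * econf (tau_ y) (conf_of xs) * econf (t_ y) xi).
pose G n (i : 'I_n.+1) (xs : n.+1.-tuple X) := \int[leb]_x (a (subRd x (tnth xs i)) *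
     econf (tau_ (tnth xs i)) (conf_of (tuple_cons (x, tuple_del i xs))) *
     inner_integral k (tnth xs i) (conf_of (tuple_cons (x, tuple_del i xs)))).
pose F n (xs : n.+1.-tuple X) := \sum_(i < n.+1) G n i xs
  - \int[lp]_xi (k (xi `|` conf_of xs)%fset * rate' n.+1 xs xi).
have mF n : measurable_fun setT (F n).
  apply: measurable_funB.
    apply: measurable_sum => i.
    apply: measurable_Rintegral_param.
    apply: measurable_gain_integrand => //; first exact: (measurableT_comp (mtn _ _)).
    exact: (measurableT_comp (measurable_tuple_del i)).
  apply: measurable_Rintegral_lp => // l; apply: measurable_funM.
    under eq_fun do rewrite -conf_of_cat.
    apply: (measurableT_comp mk); apply: (measurableT_comp (@measurable_conf_of R d _)).
    apply: (measurableT_comp (@measurable_tuple_cat _ _ l n.+1)).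
    by apply/measurable_fun_pair.
  apply: measurable_sum => i; apply: measurable_rate_term => //.
  exact: (measurableT_comp (mtn _ _)).
move=> _ A mA; rewrite setTI.
suff : measurable_conf (LDelta a phi k @^-1` A) by [].
case=> [|n].
  rewrite (_ : _ `&` _ = off_diag 0 `&` [set xs | A (LDelta a phi k fset0)]).
    apply: measurableI; first exact: measurable_off_diag.
    by have [H|H] := pselect (A (LDelta a phi k fset0));
      [rewrite (_ : [set _ | _] = setT)|rewrite (_ : [set _ | _] = set0)] => //;
      apply/seteqP; split.
  have E (xs : 0.-tuple X) : conf_of xs = fset0.
    by apply/fsetP => y; rewrite conf_ofP tuple0 in_fset0.
  by apply/seteqP; split=> xs /=; rewrite E.
have := mF n measurableT _ mA; rewrite setTI => mFA.
rewrite (_ : _ `&` _ = off_diag n.+1 `&` F n @^-1` A).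
  by apply: measurableI => //; exact: measurable_off_diag.
have E (xs : n.+1.-tuple X) : off_diag n.+1 xs -> LDelta a phi k (conf_of xs) = F n xs.
  move=> u.
  have E1 : \sum_(y <- conf_of xs) gain_term k (conf_of xs) y =
      \sum_(i < n.+1) gain_term k (conf_of xs) (tnth xs i).
    exact: (big_conf_of _ (gain_term k (conf_of xs)) u).
  have E2 xi : loss_rate (conf_of xs) xi = rate' n.+1 xs xi.
    exact: (big_conf_of _ (fun x => \int[leb]_y
      (a (subRd x y) * econf (tau_ y) (conf_of xs) * econf (t_ y) xi)) u).
  have E3 i : gain_term k (conf_of xs) (tnth xs i) = G n i xs.
    apply: eq_Rintegral => x _.
    by rewrite (conf_of_del _ u) conf_of_cons.
  have E4 : loss_term k (conf_of xs) =
      \int[lp]_xi (k (xi `|` conf_of xs)%fset * rate' n.+1 xs xi).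
    by apply: eq_Rintegral => xi _; rewrite E2.
  have E5 : \sum_(i < n.+1) gain_term k (conf_of xs) (tnth xs i) = \sum_(i < n.+1) G n i xs.
    by apply: eq_bigr => i _; exact: E3.
  exact: (congr2 (fun u v => u - v) (etrans E1 E5) E4).
by apply/seteqP; split=> xs /= [u]; rewrite E.
Qed.

End kinetic.

(** * Bounds for the operator *)

Section kinetic_bounds.
Context {R : realType} {d : nat}.
Hypothesis d_gt0 : (0 < d)%N.
Local Notation X := (Rd R d).
Local Notation leb := (lebesgue_Rd R d).
Local Notation lp := (lebesgue_poisson R d).
Variables a phi : X -> R.
Hypothesis a_meas : measurable_fun setT a.
Hypothesis phi_meas : measurable_fun setT phi.
Hypothesis a_ge0 : forall x, 0 <= a x.
Hypothesis phi_ge0 : forall x, 0 <= phi x.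
Hypothesis a_even : forall x, a (oppRd x) = a x.
Hypothesis phi_even : forall x, phi (oppRd x) = phi x.
Hypothesis a_int : (\int[leb]_x (a x)%:E < +oo)%E.
Hypothesis phi_int : (\int[leb]_x (1 - expR (- phi x))%:E < +oo)%E.

Local Notation t_ := (t_ phi).
Local Notation tau_ := (tau_ phi).
Local Notation inner := (inner_integral phi).
Local Notation gain := (gain_term a phi).
Local Notation rate := (loss_rate a phi).
Local Notation loss := (loss_term a phi).
Implicit Types (k : conf R d -> R) (C s : R) (w : conf R d).

Let alpha := \int[leb]_x a x.
Let c_phi := \int[leb]_x (1 - expR (- phi x)).

Lemma oppRd_sub (x y : X) : oppRd (subRd x y) = subRd y x.
Proof. by apply: eq_from_tnth => i; rewrite !tnth_mktuple opprB. Qed.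

Lemma one_sub_expRN_ge0 x : 0 <= 1 - expR (- phi x).
Proof. by rewrite subr_ge0 -expR0 ler_expR oppr_le0. Qed.

Lemma alphaE : (\int[leb]_x (a x)%:E)%E = alpha%:E.
Proof.
rewrite fineK// ge0_fin_numE//.
by apply: integral_ge0 => x _; rewrite lee_fin.
Qed.

Lemma c_phiE : (\int[leb]_x (1 - expR (- phi x))%:E)%E = c_phi%:E.
Proof.
rewrite fineK// ge0_fin_numE//.
by apply: integral_ge0 => x _; rewrite lee_fin one_sub_expRN_ge0.
Qed.

Lemma alpha_ge0 : 0 <= alpha.
Proof. by apply: Rintegral_ge0 => x _. Qed.

Lemma c_phi_ge0 : 0 <= c_phi.
Proof. by apply: Rintegral_ge0 => x _; exact: one_sub_expRN_ge0. Qed.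

Lemma integral_a_l y : (\int[leb]_x (a (subRd x y))%:E)%E = alpha%:E.
Proof.
rewrite (ge0_integral_subRd (f := fun x => (a x)%:E)) ?alphaE//.
exact/measurable_EFinP.
Qed.

(** The gain integrates [a] in its first argument and the loss in its second; evenness gives both
    the mass [alpha]. *)
Lemma integral_a_r x : (\int[leb]_y (a (subRd x y))%:E)%E = alpha%:E.
Proof.
rewrite -(integral_a_l x); apply: eq_integral => y _.
by rewrite -(oppRd_sub x y) a_even.
Qed.

Lemma norm_t y z : `|t_ y z| = 1 - expR (- phi (subRd y z)).
Proof. by rewrite distrC ger0_norm ?one_sub_expRN_ge0. Qed.

Lemma norm_t_le1 y z : 0 <= `|t_ y z| <= 1.
Proof. by rewrite normr_ge0 norm_t lerBlDr lerDl expR_ge0. Qed.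

Lemma tau_01 y z : 0 <= tau_ y z <= 1.
Proof.
by rewrite /Defs.tau_ /Defs.t_ subrK expR_ge0 -[leRHS]expR0 ler_expR oppr_le0 phi_ge0.
Qed.

Lemma integral_norm_t y : (\int[leb]_z `|t_ y z|%:E)%E = c_phi%:E.
Proof.
rewrite -c_phiE.
rewrite -(ge0_integral_subRd (f := fun x => (1 - expR (- phi x))%:E) y).
- by apply: eq_integral => z _; rewrite norm_t -(oppRd_sub y z) phi_even.
- apply/measurable_EFinP; apply: measurable_funB => //.
  by apply: measurableT_comp => //; exact: measurableT_comp.
- by move=> x; rewrite lee_fin one_sub_expRN_ge0.
Qed.

Lemma measurable_norm_t y : measurable_fun setT (fun z => `|t_ y z|).
Proof. by apply: measurableT_comp => //; apply: measurable_t. Qed.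

Lemma integral_lp_norm_t s y : 0 <= s ->
  (\int[lp]_xi (econf (fun z => (s * `|t_ y z|)%R) xi)%:E = (expR (s * c_phi))%:E)%E.
Proof.
move=> s0; apply: integral_lp_econf => //.
- by apply: measurable_funM => //; exact: measurable_norm_t.
- by move=> x; rewrite mulr_ge0.
- under eq_integral do rewrite EFinM.
  rewrite ge0_integralZl//; last by apply/measurable_EFinP; exact: measurable_norm_t.
  by rewrite integral_norm_t.
Qed.

Let E s := expR (s * c_phi).

(** The part of the weight that depends on [xi] is absorbed into the product, which becomes [econf]
    of [s] times the norm of [t_ y], with known integral. *)
Lemma inner_dominated k C s w y : 0 <= s -> 0 <= C -> measurable_fun setT k ->
  dominated k C s w ->
  lp.-integrable setT (EFin \o (fun xi => econf (t_ y) xi * k (xi `|` w)%fset)) /\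
  `|inner k y w| <= C * s ^+ #|` w| * E s.
Proof.
move=> s0 C0 mk kw.
pose g xi := C * s ^+ #|` w| * econf (fun z => s * `|t_ y z|) xi.
have me : measurable_fun setT (econf (fun z => s * `|t_ y z|)).
  by apply: measurable_econf; apply: measurable_funM => //; exact: measurable_norm_t.
apply: (@Rintegral_dominated _ _ _ _ _ g) => //.
- apply: measurable_funM; last exact: measurable_fsetU.
  by apply: measurable_econf; exact: measurable_t.
- exact: measurable_funM.
- apply: filterS kw => xi kxi; rewrite normrM normr_econf /g.
  rewrite econfM econf_cst mulrA mulrC ler_wpM2r ?econf_ge0//.
  by apply: le_trans kxi _; rewrite exprD -mulrA [_ * s ^+ #|`w|]mulrC.
- by move=> xi; rewrite /g !mulr_ge0 ?exprn_ge0// econf_ge0// => z; rewrite mulr_ge0.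
- under eq_integral do rewrite EFinM.
  rewrite ge0_integralZl//; last 3 first.
  + exact/measurable_EFinP.
  + by move=> xi _; rewrite lee_fin econf_ge0// => z; rewrite mulr_ge0.
  + by rewrite lee_fin mulr_ge0// exprn_ge0.
  by rewrite integral_lp_norm_t.
Qed.

Lemma card_exchange w x y : y \in w -> x \notin w -> #|` (x |` (w `\ y))%fset| = #|` w|.
Proof.
move=> yw xw; rewrite cardfsU1 in_fsetD1 (negbTE xw) andbF.
by rewrite (cardfsD1 y w) yw.
Qed.

Lemma measurable_gain_section k w y : measurable_fun setT k ->
  measurable_fun setT (fun x => a (subRd x y) * econf (tau_ y) (x |` (w `\ y))%fset *
    inner k y (x |` (w `\ y))%fset).
Proof.
move=> mk; have [n [ys [<- _]]] := conf_tuple (w `\ y)%fset.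
under eq_fun do rewrite -conf_of_cons.
exact: (measurable_gain_integrand d_gt0 a_meas phi_meas mk (f := idfun)
  (g := cst y) (xs := cst ys) (@measurable_id _ _ _) (measurable_cst _) (measurable_cst _)).
Qed.

Lemma econf_tau_01 y w : 0 <= econf (tau_ y) w <= 1.
Proof.
rewrite econf_ge0 ?econf_le1//; first exact: tau_01.
by move=> z; have /andP[] := tau_01 y z.
Qed.

(** Exchanging [y] for almost any [x] keeps the number of points, so the bound on the inner integral
    is constant in [x]; the product of the [tau_ y] is at most 1, and only the mass of [a]
    remains. *)
Lemma gain_dominated k C s w y : 0 <= s -> 0 <= C -> measurable_fun setT k ->
  well_dominated k C s w -> y \in w ->
  leb.-integrable setT (EFin \o (fun x => a (subRd x y) *
    econf (tau_ y) (x |` (w `\ y))%fset * inner k y (x |` (w `\ y))%fset)) /\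
  `|gain k w y| <= alpha * (C * s ^+ #|` w| * E s).
Proof.
move=> s0 C0 mk [_ kw] yw.
have K0 : 0 <= C * s ^+ #|` w| * E s.
  by rewrite !mulr_ge0 ?exprn_ge0 ?expR_ge0.
have ma : measurable_fun setT (fun x => a (subRd x y)) by apply: measurable_a2.
apply: (@Rintegral_dominated _ _ _ _ _ (fun x => a (subRd x y) * (C * s ^+ #|` w| * E s))).
- exact: measurable_gain_section.
- exact: measurable_funM.
- apply: filterS (kw y yw) => x [xw kx]; rewrite !normrM.
  rewrite (ger0_norm (a_ge0 _)) -mulrA ler_wpM2l//.
  have [_ ] := inner_dominated y s0 C0 mk kx.
  rewrite card_exchange// => le1.
  have /andP[e0 e1] := econf_tau_01 y (x |` (w `\ y))%fset.
  by rewrite ger0_norm// (le_trans _ le1)// ler_piMl.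
- by move=> x; rewrite mulr_ge0.
- under eq_integral do rewrite EFinM.
  rewrite ge0_integralZr//; last 2 first.
  + exact/measurable_EFinP.
  + by move=> x _; rewrite lee_fin.
  by rewrite integral_a_l.
Qed.

Lemma measurable_rate w : measurable_fun setT (rate w).
Proof.
have [n [xs [<- u]]] := conf_tuple w.
apply/measurable_fun_confP => l; rewrite /loss_rate.
under eq_fun do rewrite (big_conf_of _ _ u).
apply: measurable_sum => i.
exact: (measurable_rate_term a_meas phi_meas (f := cst (tnth xs i)) (xs := cst xs)
  (zs := idfun) (measurable_cst _) (measurable_cst _) (@measurable_id _ _ _)).
Qed.

(* [s ^+ #|xi|] times the rate is dominated by an integral to which Tonelli
   applies. *)
Let rbound s x xi := \int[leb]_y (a (subRd x y) * econf (fun z => s * `|t_ y z|) xi).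

Let integrand_measurable s x : jointly_measurable (fun y xi =>
  a (subRd x y) * econf (fun z => s * `|t_ y z|) xi).
Proof.
move=> n; apply: measurable_funM; first by apply: measurable_a2.
apply: (measurable_econf_tuple (f := fun y z => s * `|t_ y z|)) => //.
apply: measurable_funM => //; apply: measurableT_comp => //.
exact: measurable_t.
Qed.

(** Finiteness is the point: the norm of [t_ y] is at most 1, so the product is bounded by a power
    of [s] that does not depend on [y]. *)
Lemma rboundE s x xi : 0 <= s -> (rbound s x xi)%:E =
  (\int[leb]_y (a (subRd x y) * econf (fun z => s * `|t_ y z|) xi)%:E)%E.
Proof.
move=> s0; rewrite fineK// ge0_fin_numE; last first.
  apply: integral_ge0 => y _; rewrite lee_fin mulr_ge0// econf_ge0// => z.
  by rewrite mulr_ge0.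
apply: (@le_lt_trans _ _ (\int[leb]_y (a (subRd x y) * s ^+ #|` xi|)%:E)%E).
  apply: ge0_le_integral => //.
  - by move=> y _; rewrite lee_fin mulr_ge0// econf_ge0// => z; rewrite mulr_ge0.
  - apply/measurable_EFinP; have [n [xs [<- _]]] := conf_tuple xi.
    exact: (measurableT_comp (integrand_measurable s x (n := n)) (measurable_pair2 xs)).
  - by apply/measurable_EFinP; apply: measurable_funM => //; apply: measurable_a2.
  - move=> y _; rewrite lee_fin ler_wpM2l// econfM econf_cst ler_piMr ?exprn_ge0//.
    by apply: econf_le1 => z; exact: norm_t_le1.
under eq_integral do rewrite EFinM.
rewrite ge0_integralZr//.
- by rewrite integral_a_r -EFinM ltry.
- by apply/measurable_EFinP; apply: measurable_a2.
- by move=> y _; rewrite lee_fin.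
- by rewrite lee_fin exprn_ge0.
Qed.

Lemma integral_rbound s x : 0 <= s ->
  (\int[lp]_xi (rbound s x xi)%:E = (alpha * E s)%:E)%E.
Proof.
move=> s0; under eq_integral do rewrite rboundE//.
rewrite (tonelli_lp d_gt0 leb (H := fun y xi =>
  (a (subRd x y) * econf (fun z => s * `|t_ y z|) xi)%:E)); last 2 first.
- by move=> n; apply/measurable_EFinP; exact: integrand_measurable.
- by move=> y xi; rewrite lee_fin mulr_ge0// econf_ge0// => z; rewrite mulr_ge0.
transitivity (\int[leb]_y ((a (subRd x y))%:E * (E s)%:E))%E.
  apply: eq_integral => y _; under eq_integral do rewrite EFinM.
  rewrite ge0_integralZl ?lee_fin//; last 2 first.
  + apply/measurable_EFinP; apply: measurable_econf; apply: measurable_funM => //.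
    exact: measurable_norm_t.
  + by move=> xi _; rewrite lee_fin econf_ge0// => z; rewrite mulr_ge0.
  by rewrite integral_lp_norm_t.
rewrite ge0_integralZr ?lee_fin ?expR_ge0//.
- by rewrite integral_a_r.
- by apply/measurable_EFinP; apply: measurable_a2.
- by move=> y _; rewrite lee_fin.
Qed.

Lemma rate_le s w xi : 0 <= s ->
  s ^+ #|` xi| * `|rate w xi| <= \sum_(x <- w) rbound s x xi.
Proof.
move=> s0; rewrite /loss_rate.
apply: le_trans (ler_wpM2l (exprn_ge0 _ s0) (ler_norm_sum _ _ _)) _.
rewrite mulr_sumr; apply: ler_sum => x _.
have [n [xs [wE _]]] := conf_tuple w.
have [l [zs [xiE _]]] := conf_tuple xi.
have mf : measurable_fun setT (fun y => a (subRd x y) * econf (tau_ y) w * econf (t_ y) xi).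
  rewrite -wE -xiE; apply: measurable_funM; last first.
    exact: (measurable_econf_tuple (f := t_) (g := idfun) (xs := cst zs)
      (measurable_t phi_meas measurable_fst measurable_snd) (@measurable_id _ _ _)
      (measurable_cst _)).
  apply: measurable_funM; first by apply: measurable_a2.
  exact: (measurable_econf_tuple (f := tau_) (g := idfun) (xs := cst xs)
    (measurable_tau phi_meas measurable_fst measurable_snd) (@measurable_id _ _ _)
    (measurable_cst _)).
have ma : measurable_fun setT (fun y => a (subRd x y)) by apply: measurable_a2.
have fle y : `|a (subRd x y) * econf (tau_ y) w * econf (t_ y) xi| <=
    a (subRd x y) * econf (fun z => `|t_ y z|) xi.
  have /andP[e0 e1] := econf_tau_01 y w.
  rewrite !normrM (ger0_norm (a_ge0 _)) (ger0_norm e0) normr_econf.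
  rewrite ler_wpM2r ?econf_ge0// ler_piMr//.
(* Integrability is established first, so that the power of [s] may be moved under the integral. *)
have [fi _] : leb.-integrable setT
      (EFin \o (fun y => a (subRd x y) * econf (tau_ y) w * econf (t_ y) xi)) /\
    `|\int[leb]_y (a (subRd x y) * econf (tau_ y) w * econf (t_ y) xi)| <= alpha.
  apply: (@Rintegral_dominated _ _ _ _ _ (fun y => a (subRd x y))) => //.
    apply: aeW => y; apply: le_trans (fle y) _; rewrite ler_piMr// econf_le1// => z.
    exact: norm_t_le1.
  by rewrite integral_a_r.
have se : `|s ^+ #|` xi| | = s ^+ #|` xi| by rewrite ger0_norm// exprn_ge0.
rewrite -[X in X * _]se -normrM -RintegralZl//.
refine (proj2 (@Rintegral_dominated _ _ _ leb
  (fun y => s ^+ #|` xi| * (a (subRd x y) * econf (tau_ y) w * econf (t_ y) xi))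
  (fun y => a (subRd x y) * econf (fun z => s * `|t_ y z|) xi) (rbound s x xi)
  _ _ _ _ _)).
- by apply: measurable_funM.
- rewrite -xiE.
  exact: (measurableT_comp (integrand_measurable s x (n := l)) (measurable_pair2 zs)).
- apply: aeW => y; rewrite normrM se econfM econf_cst mulrCA.
  by rewrite ler_wpM2l ?exprn_ge0.
- by move=> y; rewrite mulr_ge0// econf_ge0// => z; rewrite mulr_ge0.
- by rewrite rboundE.
Qed.

Lemma measurable_rbound s x : measurable_fun setT (rbound s x).
Proof.
apply/measurable_fun_confP => n.
apply: (measurable_Rintegral_param leb (F := fun (zs : n.-tuple X) y =>
  a (subRd x y) * econf (fun z => s * `|t_ y z|) (conf_of zs))).
pose sw (q : n.-tuple X * X) := (q.2, q.1).
have msw : measurable_fun setT sw by apply/measurable_fun_pair.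
exact: (measurableT_comp (integrand_measurable s x (n := n)) msw).
Qed.

Lemma rbound_ge0 s x xi : 0 <= s -> 0 <= rbound s x xi.
Proof.
move=> s0; apply: Rintegral_ge0 => y _.
by rewrite mulr_ge0// econf_ge0// => z; rewrite mulr_ge0.
Qed.

Lemma loss_dominated k C s w : 0 <= s -> 0 <= C -> measurable_fun setT k ->
  well_dominated k C s w ->
  lp.-integrable setT (EFin \o (fun xi => k (xi `|` w)%fset * rate w xi)) /\
  `|loss k w| <= #|` w|%:R * (alpha * (C * s ^+ #|` w| * E s)).
Proof.
move=> s0 C0 mk [kw _].
pose g xi := C * s ^+ #|` w| * \sum_(x <- w) rbound s x xi.
have K0 : 0 <= C * s ^+ #|` w| by rewrite mulr_ge0// exprn_ge0.
have msum : measurable_fun setT (fun xi => \sum_(x <- w) rbound s x xi).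
  by apply: measurable_sum => x; exact: measurable_rbound.
have sum0 xi : 0 <= \sum_(x <- w) rbound s x xi.
  by apply: sumr_ge0 => x _; exact: rbound_ge0.
apply: (@Rintegral_dominated _ _ _ _ _ g).
- by apply: measurable_funM; [exact: measurable_fsetU|exact: measurable_rate].
- exact: measurable_funM.
- apply: filterS kw => xi kxi; rewrite normrM /g.
  apply: le_trans (ler_wpM2l K0 (rate_le w xi s0)).
  rewrite mulrA ler_wpM2r//; apply: le_trans kxi _.
  by rewrite exprD -mulrA [_ * s ^+ #|`w|]mulrC.
- by move=> xi; rewrite /g mulr_ge0.
- under eq_integral do rewrite EFinM.
  rewrite ge0_integralZl//; last 2 first.
  + exact/measurable_EFinP.
  + by move=> xi _; rewrite lee_fin.
  under eq_integral do rewrite -sumEFin.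
  rewrite ge0_integral_sum//; last 2 first.
  + by move=> x; apply/measurable_EFinP; exact: measurable_rbound.
  + by move=> x xi _; rewrite lee_fin rbound_ge0.
  under eq_bigr do rewrite integral_rbound//.
  rewrite sumEFin -EFinM lee_fin big_const_seq count_predT iter_addr_0.
  rewrite -[in X in X <= _]mulr_natl.
  by rewrite le_eqVlt; apply/orP; left; apply/eqP; ring.
Qed.

(** The sum over the points of [w] gives the factor [#|w|]; gain and loss obey the same bound, hence
    the factor 2. *)
Lemma LDelta_le k C s w : 0 <= s -> 0 <= C -> measurable_fun setT k ->
  well_dominated k C s w ->
  `|LDelta a phi k w| <= #|` w|%:R * (2 * alpha * expR (c_phi * s)) * (C * s ^+ #|` w|).
Proof.
move=> s0 C0 mk kw; rewrite LDeltaE.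
apply: le_trans (ler_normB _ _) _.
have [_ l1] := loss_dominated s0 C0 mk kw.
have g1 : `|\sum_(y <- w) gain k w y| <= #|` w|%:R * (alpha * (C * s ^+ #|` w| * E s)).
  apply: le_trans (ler_norm_sum _ _ _) _.
  rewrite mulr_natl -[X in _ *+ X]/(size w) -(count_predT w) -iter_addr_0 -big_const_seq.
  rewrite big_seq [leRHS]big_seq; apply: ler_sum => y yw.
  by have [_] := gain_dominated s0 C0 mk kw yw.
apply: le_trans (lerD g1 l1) _; rewrite /E [s * c_phi]mulrC.
by rewrite le_eqVlt; apply/orP; left; apply/eqP; ring.
Qed.

(** [Rintegral] is additive on integrable functions only, so linearity is asserted at configurations
    where domination makes every integral involved converge. *)
Lemma LDelta_linear k1 k2 (c : R) C1 C2 s w : 0 <= s -> 0 <= C1 -> 0 <= C2 ->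
  measurable_fun setT k1 -> measurable_fun setT k2 ->
  well_dominated k1 C1 s w -> well_dominated k2 C2 s w ->
  LDelta a phi (fun xi => k1 xi + c * k2 xi) w =
  LDelta a phi k1 w + c * LDelta a phi k2 w.
Proof.
move=> s0 C10 C20 mk1 mk2 k1w k2w.
pose k xi := k1 xi + c * k2 xi.
have mk : measurable_fun setT k.
  by apply: measurable_funD => //; exact: measurable_funM.
have I y v : dominated k1 C1 s v -> dominated k2 C2 s v ->
    inner k y v = inner k1 y v + c * inner k2 y v.
  move=> k1v k2v; apply: Rintegral_ae_linear.
  - apply: measurable_funM; last exact: measurable_fsetU.
    by apply: measurable_econf; exact: measurable_t.
  - by have [] := inner_dominated y s0 C10 mk1 k1v.
  - by have [] := inner_dominated y s0 C20 mk2 k2v.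
  - by apply: aeW => xi; rewrite /k; ring.
have G y : y \in w -> gain k w y = gain k1 w y + c * gain k2 w y.
  move=> yw; apply: Rintegral_ae_linear.
  - exact: measurable_gain_section.
  - by have [] := gain_dominated s0 C10 mk1 k1w yw.
  - by have [] := gain_dominated s0 C20 mk2 k2w yw.
  - apply: filterS2 (k1w.2 y yw) (k2w.2 y yw) => x [_ k1x] [_ k2x].
    by rewrite (I _ _ k1x k2x); ring.
have L : loss k w = loss k1 w + c * loss k2 w.
  apply: Rintegral_ae_linear.
  - by apply: measurable_funM; [exact: measurable_fsetU|exact: measurable_rate].
  - by have [] := loss_dominated s0 C10 mk1 k1w.
  - by have [] := loss_dominated s0 C20 mk2 k2w.
  - by apply: aeW => xi; rewrite /k; ring.
have S : \sum_(y <- w) gain k w y =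
    \sum_(y <- w) gain k1 w y + c * \sum_(y <- w) gain k2 w y.
  rewrite mulr_sumr -big_split /= big_seq [RHS]big_seq.
  by apply: eq_bigr => y yw; exact: G.
rewrite !LDeltaE -/k S L; ring.
Qed.

End kinetic_bounds.

(** * Norms as almost everywhere bounds *)

Section Kspace_bounds.
Context {R : realType} {d : nat}.
Hypothesis d_gt0 : (0 < d)%N.
Local Notation X := (Rd R d).
Local Notation leb := (lebesgue_Rd R d).
Local Notation lp := (lebesgue_poisson R d).
Local Notation TM n := (tuple_measure leb n).
Implicit Types (f g : conf R d -> R) (theta C s : R).

Lemma nu_leP f n C : 0 <= C ->
  (nu f n <= C%:E)%E <-> {ae TM n, forall xs, `|f (conf_of xs)| <= C}.
Proof.
move=> C0; rewrite /nu LinftyE.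
(* On a space of mass zero the essential supremum norm is 0 by convention, and every property holds
   almost everywhere. *)
have [mu0|mu0] := ltP 0%E (TM n setT); last first.
  split=> _; last by rewrite lee_fin.
  by apply: measure0_ae; apply/eqP; rewrite -measure_le0.
split=> [/ess_supP H|H].
  apply: filterS2 H (ae_off_diag d_gt0 n) => xs /= H u.
  by move: H; rewrite /component patchE mem_set// lee_fin.
apply/ess_supP; apply: filterS H => xs H.
by rewrite /= lee_fin /component patchE; case: ifP => //; rewrite normr0.
Qed.

Lemma bounded_byP f C s : 0 <= s -> 0 <= C -> measurable_fun setT f ->
  bounded_by f C s <-> forall n, (nu f n <= (C * s ^+ n)%:E)%E.
Proof.
move=> s0 C0 mf; have Cs n : 0 <= C * s ^+ n by rewrite mulr_ge0// exprn_ge0.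
split=> [/(ae_lpP d_gt0 (measurable_bound C s mf)) H n|H].
  apply/nu_leP => //; apply: filterS2 (H n) (ae_off_diag d_gt0 n) => xs /= H1 u.
  by move: H1; rewrite card_conf_of.
apply/(ae_lpP d_gt0 (measurable_bound C s mf)) => n.
apply: filterS2 ((nu_leP f n (Cs n)).1 (H n)) (ae_off_diag d_gt0 n) => xs /= H1 u.
by rewrite card_conf_of.
Qed.

Lemma expRN_exp theta n : expR (- theta) ^+ n = (expR (theta * n%:R))^-1.
Proof. by rewrite -expRM_natl -expRN mulrN mulrC. Qed.

Lemma Kseminorm_leP f theta C : 0 <= C -> measurable_fun setT f ->
  (Kseminorm theta f <= C%:E)%E <-> bounded_by f C (expR (- theta)).
Proof.
move=> C0 mf; rewrite bounded_byP ?expR_ge0//.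
have E n : ((expR (theta * n%:R))%:E * nu f n <= C%:E)%E =
    (nu f n <= (C * expR (- theta) ^+ n)%:E)%E.
  by rewrite expRN_exp [C * _]mulrC EFinM lee_pdivlMl// expR_gt0.
split=> [H n|H].
  by rewrite -E; apply: le_trans (nu_le_Kseminorm theta f n) H.
by apply: ge_ereal_sup => _ [n _ <-]; rewrite E.
Qed.

Lemma L0_measurable (k : L0 lp) : measurable_fun setT (L0_fun k).
Proof. exact: measurable_funP. Qed.

Lemma Knorm_leP theta (k : Kspace d theta) C : 0 <= C ->
  `|k| <= C <-> bounded_by (L0_fun (Kval k)) C (expR (- theta)).
Proof.
move=> C0; have H := Kseminorm_leP theta C0 (@L0_measurable (Kval k)).
by apply: iff_trans H; rewrite -[Kseminorm _ _]KnormE lee_fin.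
Qed.

Lemma bounded_by_Knorm theta (k : Kspace d theta) :
  bounded_by (L0_fun (Kval k)) `|k| (expR (- theta)).
Proof. exact/Knorm_leP. Qed.

Lemma bounded_by_ae f g C s : f = g %[ae lp] -> bounded_by f C s -> bounded_by g C s.
Proof. by apply: filterS2 => xi /(_ I) ->. Qed.

Lemma bounded_byW f C C' s s' : 0 <= C -> 0 <= s -> C <= C' -> s <= s' ->
  bounded_by f C s -> bounded_by f C' s'.
Proof.
move=> C0 s0 CC ss; apply: filterS => xi H; apply: le_trans H _.
apply: ler_pM => //; first exact: exprn_ge0.
by apply: lerXn2r => //; rewrite nnegrE (le_trans s0 ss)//.
Qed.

Lemma bounded_byD f g C D s c : bounded_by f C s -> bounded_by g D s ->
  bounded_by (fun xi => f xi + c * g xi) (C + `|c| * D) s.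
Proof.
apply: filterS2 => xi fxi gxi.
rewrite mulrDl; apply: le_trans (ler_normD _ _) _; apply: lerD => //.
by rewrite normrM -mulrA ler_wpM2l.
Qed.

Lemma Kspace_exists theta f C : 0 <= C -> measurable_fun setT f ->
  bounded_by f C (expR (- theta)) ->
  exists k : Kspace d theta, L0_fun (Kval k) = f %[ae lp].
Proof.
move=> C0 mf fC.
pose F : {mfun conf R d >-> R} := HB.pack f (isMeasurableFun.Build _ _ _ _ _ mf).
have FE : L0_fun (L0_class lp F) = f %[ae lp] := L0_classK lp F.
have fin : L0_class lp F \in finite_Kseminorm theta.
  rewrite inE (Kseminorm_ae theta FE).
  by apply: le_lt_trans ((Kseminorm_leP theta C0 mf).2 fC) _; rewrite ltry.
by exists (MkKspace fin).
Qed.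

(** Choosing the class with a default value makes this total in [f], so that a curve in the space
    can be defined before its values are shown to be bounded. *)
Definition to_Kspace theta f : Kspace d theta :=
  xget 0 [set k : Kspace d theta | L0_fun (Kval k) = f %[ae lp]].

Lemma to_KspaceE theta f C : 0 <= C -> measurable_fun setT f ->
  bounded_by f C (expR (- theta)) ->
  L0_fun (Kval (to_Kspace theta f)) = f %[ae lp].
Proof.
move=> C0 mf fC; have [k kE] := Kspace_exists C0 mf fC.
by have := @xgetPex _ 0 [set k : Kspace d theta | L0_fun (Kval k) = f %[ae lp]]
  (ex_intro _ k kE).
Qed.

Lemma KvalD theta (k l : Kspace d theta) (c : R) :
  {ae lp, forall xi, L0_fun (Kval (k + c *: l)) xi =
    L0_fun (Kval k) xi + c * L0_fun (Kval l) xi}.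
Proof.
have H1 := L0_addE (Kval k) (Kval (c *: l)).
have H2 := L0_scaleE c (Kval l).
by apply: filterS2 H1 H2 => xi /(_ I) H1 /(_ I) <-.
Qed.

Lemma KvalB theta (k l : Kspace d theta) :
  {ae lp, forall xi, L0_fun (Kval (k - l)) xi =
    L0_fun (Kval k) xi - L0_fun (Kval l) xi}.
Proof.
by rewrite -scaleN1r; apply: filterS (KvalD k l (-1)) => xi ->; rewrite mulN1r.
Qed.

End Kspace_bounds.

(** * The operator between the spaces *)

Section kinetic_Kspace.
Context {R : realType} {d : nat}.
Hypothesis d_gt0 : (0 < d)%N.
Local Notation X := (Rd R d).
Local Notation leb := (lebesgue_Rd R d).
Local Notation lp := (lebesgue_poisson R d).
Local Notation TM n := (tuple_measure leb n).
Variables a phi : X -> R.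
Hypothesis a_meas : measurable_fun setT a.
Hypothesis phi_meas : measurable_fun setT phi.
Hypothesis a_ge0 : forall x, 0 <= a x.
Hypothesis phi_ge0 : forall x, 0 <= phi x.
Hypothesis a_even : forall x, a (oppRd x) = a x.
Hypothesis phi_even : forall x, phi (oppRd x) = phi x.
Hypothesis a_int : (\int[leb]_x (a x)%:E < +oo)%E.
Hypothesis phi_int : (\int[leb]_x (1 - expR (- phi x))%:E < +oo)%E.
Local Notation LDelta := (LDelta a phi).
Implicit Types (f g k : conf R d -> R) (theta C s : R).

Definition LDelta_const theta := 2 * (\int[leb]_x a x) *
  expR ((\int[leb]_x (1 - expR (- phi x))) * expR (- theta)).

Local Notation M := LDelta_const.

Lemma LDelta_const_ge0 theta : 0 <= M theta.
Proof. by rewrite /M !mulr_ge0 ?expR_ge0// alpha_ge0. Qed.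

Lemma LDelta_constS theta theta' : theta <= theta' -> M theta' <= M theta.
Proof.
move=> tt; rewrite ler_wpM2l ?mulr_ge0 ?alpha_ge0// ler_expR ler_wpM2l ?c_phi_ge0//.
by rewrite ler_expR lerN2.
Qed.

Let mL k : measurable_fun setT k -> measurable_fun setT (LDelta k).
Proof. exact: measurable_LDelta. Qed.

(** The factor [n] is kept here. Existence trades it for a smaller index; uniqueness matches it with
    the factor produced by differentiating an exponential weight. *)
Lemma nu_LDelta k C theta n : 0 <= C -> measurable_fun setT k ->
  bounded_by k C (expR (- theta)) ->
  (nu (LDelta k) n <= (n%:R * M theta * (C * expR (- theta) ^+ n))%:E)%E.
Proof.
move=> C0 mk kC; apply/nu_leP => //.
  apply: mulr_ge0 (mulr_ge0 _ (LDelta_const_ge0 _)) (mulr_ge0 C0 _) => //.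
apply: filterS2 (ae_well_dominated d_gt0 n mk kC) (ae_off_diag d_gt0 n) => xs H u.
have := LDelta_le d_gt0 a_meas phi_meas a_ge0 phi_ge0 a_even phi_even a_int phi_int
  (expR_ge0 _) C0 mk (H u).
by rewrite card_conf_of.
Qed.

(** The maximum is attained at [x = e^-1]; the inequality is [1 + y <= expR y] at
    [y = e * x - 1]. *)
Lemma mul_expR_le (e x : R) : 0 < e -> x * expR (- (e * x)) <= (e * expR 1)^-1.
Proof.
move=> e0; rewrite -(ler_pM2l e0) mulrA invfM mulrA divff ?gt_eqF// mul1r.
have := expR_ge1Dx (e * x - 1); rewrite subrKC => H.
rewrite -[leRHS]mul1r -expRN -(ler_pM2r (expR_gt0 (e * x))) -mulrA -expRD addNr expR0.
by rewrite mulr1 mul1r -expRD addrC.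
Qed.

Lemma LDelta_bounded k C theta theta' : theta' < theta -> 0 <= C ->
  measurable_fun setT k -> bounded_by k C (expR (- theta)) ->
  bounded_by (LDelta k) (M theta / ((theta - theta') * expR 1) * C) (expR (- theta')).
Proof.
move=> tt C0 mk kC.
have e0 : 0 < theta - theta' by rewrite subr_gt0.
have D0 : 0 <= M theta / ((theta - theta') * expR 1) * C.
  apply: mulr_ge0 (mulr_ge0 (LDelta_const_ge0 _) _) C0.
  by rewrite invr_ge0 mulr_ge0 ?expR_ge0// ltW.
apply/(bounded_byP d_gt0) => //; [exact: mL|move=> n].
apply: le_trans (nu_LDelta n C0 mk kC) _; rewrite lee_fin.
have -> : expR (- theta) ^+ n = expR (- ((theta - theta') * n%:R)) * expR (- theta') ^+ n.
  by rewrite -!expRM_natl -expRD; congr expR; ring.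
have := mul_expR_le n%:R e0 => H.
have K0 : 0 <= M theta * C * expR (- theta') ^+ n.
  apply: mulr_ge0 (mulr_ge0 (LDelta_const_ge0 _) C0) _.
  by rewrite exprn_ge0 ?expR_ge0.
have := ler_wpM2l K0 H; congr (_ <= _); ring.
Qed.

Lemma LDelta_ae_linear f g (c : R) C D s : 0 <= s -> 0 <= C -> 0 <= D ->
  measurable_fun setT f -> measurable_fun setT g ->
  bounded_by f C s -> bounded_by g D s ->
  {ae lp, forall xi, LDelta (fun eta => f eta + c * g eta) xi =
    LDelta f xi + c * LDelta g xi}.
Proof.
move=> s0 C0 D0 mf mg fC gD.
have mfg : measurable_fun setT (fun eta => f eta + c * g eta).
  by apply: measurable_funD => //; exact: measurable_funM.
have mA : measurable [set xi | LDelta (fun eta => f eta + c * g eta) xi =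
    LDelta f xi + c * LDelta g xi].
  have := measurable_fun_eqr (mL mfg) (measurable_funD (mL mf)
    (measurable_funM (measurable_cst c) (mL mg))) measurableT
    (I : measurable ([set true] : set bool)).
  by rewrite setTI; congr measurable; apply/seteqP; split=> xi /= /eqP.
apply/(ae_lpP d_gt0 mA) => n.
apply: filterS3 (ae_well_dominated d_gt0 n mf fC) (ae_well_dominated d_gt0 n mg gD)
  (ae_off_diag d_gt0 n).
move=> xs fxs gxs u.
exact: (LDelta_linear d_gt0 a_meas phi_meas a_ge0 phi_ge0 a_even phi_even
  a_int phi_int c s0 C0 D0 mf mg (fxs u) (gxs u)).
Qed.

(** The difference [f - g] is bounded with constant 0, so by [LDelta_bounded] its image vanishes
    almost everywhere, whatever index is lost. Linearity concludes. *)
Lemma LDelta_ae f g C s : 0 < s -> 0 <= C ->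
  measurable_fun setT f -> measurable_fun setT g ->
  bounded_by f C s -> f = g %[ae lp] -> LDelta f = LDelta g %[ae lp].
Proof.
move=> s0 C0 mf mg fC fg.
have gC := bounded_by_ae fg fC.
have H1 := LDelta_ae_linear (-1) (ltW s0) C0 C0 mf mg fC gC.
pose h eta := f eta + -1 * g eta.
have mh : measurable_fun setT h.
  by apply: measurable_funD => //; exact: measurable_funM.
pose theta := - ln s.
have sE : s = expR (- theta) by rewrite opprK lnK.
have h0 : bounded_by h 0 s.
  by apply: filterS fg => xi /(_ I) E; rewrite mul0r /h E mulN1r subrr normr0.
have h1 : bounded_by (LDelta h) 0 (expR (- (theta - 1))).
  have -> : 0 = M theta / ((theta - (theta - 1)) * expR 1) * 0 by rewrite mulr0.
  by apply: LDelta_bounded => //; rewrite ?gtrBl// -sE.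
apply: filterS2 H1 h1 => xi E; rewrite mul0r normr_le0.
rewrite -[LDelta h]/(LDelta (fun eta => f eta + -1 * g eta)) E mulN1r subr_eq0.
by move=> /eqP.
Qed.

End kinetic_Kspace.

(** * Scalar power series *)

Section power_series.
Context {R : realType}.
Implicit Types (u : nat -> R) (q x D t h rho : R).

Lemma sum_geometric_le x m n : 0 <= x -> x < 1 -> (m <= n)%N ->
  \sum_(m <= k < n) x ^+ k <= x ^+ m / (1 - x).
Proof.
move=> x0 x1 mn; have y0 : 0 < 1 - x by rewrite subr_gt0.
rewrite ler_pdivlMr//.
have -> : (\sum_(m <= k < n) x ^+ k) * (1 - x) = x ^+ m - x ^+ n.
  elim: n mn => [|n IH].
    by rewrite leqn0 => /eqP ->; rewrite big_geq// mul0r subrr.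
  rewrite leq_eqVlt => /orP[/eqP ->|]; first by rewrite big_geq// mul0r subrr.
  by rewrite ltnS => mn; rewrite big_nat_recr//= mulrDl IH// exprS; ring.
by rewrite gerBl exprn_ge0.
Qed.

Lemma geometric_bound_series u D x : 0 <= x -> x < 1 -> 0 <= D ->
  (forall n, `|u n| <= D * x ^+ n) ->
  cvgn (series u) /\
  forall N, `|limn (series u) - series u N| <= D * x ^+ N / (1 - x).
Proof.
move=> x0 x1 D0 ux.
have cu : cvgn (series u).
  apply: normed_cvg; apply: (@series_le_cvg _ _ (geometric D x)) => //=.
  - by move=> n; rewrite mulr_ge0// exprn_ge0.
  - by apply: is_cvg_geometric_series; rewrite ger0_norm.
split => // N.
have cB : `|series u n - series u N| @[n --> \oo] --> `|limn (series u) - series u N|.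
  by apply: cvg_norm; apply: cvgB => //; exact: cvg_cst.
rewrite -(cvg_lim _ cB)//; apply: limr_le; first exact: cvgP cB.
near=> n; have Nn : (N <= n)%N by near: n; exact: nbhs_infty_ge.
rewrite sub_series Nn; apply: le_trans (ler_norm_sum _ _ _) _.
apply: (@le_trans _ _ (D * \sum_(N <= k < n) x ^+ k)).
  by rewrite mulr_sumr; apply: ler_sum => k _.
by rewrite -mulrA ler_wpM2l// sum_geometric_le.
Unshelve. all: by end_near. Qed.

Definition psum u t := limn (series (fun m => u m * t ^+ m)).

Lemma psum_bound u D q t : 0 <= q -> 0 <= D -> `|t| * q < 1 ->
  (forall n, `|u n| <= D * q ^+ n) ->
  cvgn (series (fun m => u m * t ^+ m)) /\
  forall N, `|psum u t - \sum_(0 <= m < N) u m * t ^+ m| <=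
    D * (`|t| * q) ^+ N / (1 - `|t| * q).
Proof.
move=> q0 D0 tq uq; apply: geometric_bound_series => //; first by rewrite mulr_ge0.
move=> n; rewrite normrM normrX exprMn [X in D * X]mulrC mulrA.
by rewrite ler_wpM2r// exprn_ge0.
Qed.

Lemma psum_le u D q t : 0 <= q -> 0 <= D -> `|t| * q < 1 ->
  (forall n, `|u n| <= D * q ^+ n) -> `|psum u t| <= D / (1 - `|t| * q).
Proof.
move=> q0 D0 tq uq; have [_ /(_ 0)] := psum_bound q0 D0 tq uq.
by rewrite big_geq// subr0 expr0 mulr1.
Qed.

Lemma psum0 u : psum u 0 = u 0.
Proof.
apply/cvg_lim => //; rewrite -(cvg_shiftS (series _)).
rewrite (_ : (fun _ => _) = cst (u 0)); first exact: cvg_cst.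
apply/funext => n; rewrite /series /= big_nat_recl//= expr0 mulr1 big1 ?addr0//.
by move=> i _; rewrite expr0n mulr0.
Qed.

(** With [x = q / q'], the product of [n] and the [n]-th power of [x] is at most the sum of the
    first [n] powers, hence at most [(1 - x)^-1]. *)
Lemma natmul_expr_le q q' : 0 <= q -> q < q' ->
  exists2 A, 0 <= A & forall n, n%:R * q ^+ n <= A * q' ^+ n.
Proof.
move=> q0 qq; have q'0 : 0 < q' by exact: le_lt_trans qq.
pose x := q / q'.
have x0 : 0 <= x by rewrite divr_ge0// ltW.
have x1 : x < 1 by rewrite ltr_pdivrMr// mul1r.
exists (1 - x)^-1; first by rewrite invr_ge0 subr_ge0 ltW.
move=> n; have -> : q = x * q' by rewrite /x divfK ?gt_eqF.
rewrite exprMn mulrA ler_wpM2r ?exprn_ge0 ?(ltW q'0)//.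
have := @sum_geometric_le x 0 n x0 x1 (leq0n _); rewrite expr0 mul1r.
move=> /(le_trans _); apply.
have -> : n%:R * x ^+ n = \sum_(0 <= k < n) x ^+ n.
  by rewrite sumr_const_nat subn0 mulr_natl.
rewrite big_nat [leRHS]big_nat; apply: ler_sum => k /andP[_ kn].
by apply: ler_wiXn2l => //; [exact: ltW|exact: ltnW].
Qed.

Definition dcoef u : nat -> R := fun m => m.+1%:R * u m.+1.

(** The constant is chosen before [u] and [D], since it must serve all configurations at once. *)
Lemma dcoef_bound q q' : 0 <= q -> q < q' ->
  exists2 A, 0 <= A & forall u D, 0 <= D -> (forall n, `|u n| <= D * q ^+ n) ->
    forall n, `|dcoef u n| <= A * D * q' ^+ n.
Proof.
move=> q0 qq; have [A A0 AP] := natmul_expr_le q0 qq.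
have q'0 : 0 < q' by exact: le_lt_trans qq.
exists (A * q'); first by rewrite mulr_ge0// ltW.
move=> u D D0 uq n; rewrite /dcoef normrM ger0_norm//.
apply: (@le_trans _ _ (D * (n.+1%:R * q ^+ n.+1))).
  by rewrite mulrCA ler_wpM2l.
apply: le_trans (ler_wpM2l D0 (AP n.+1)) _; rewrite exprS.
by rewrite le_eqVlt; apply/orP; left; apply/eqP; ring.
Qed.

(** The factor on the left avoids the exponent [m - 2]. The remainder at [m.+1] is [t + h] times the
    one at [m], plus [m%:R * t ^+ m.-1 * h ^+ 2], and [m^2 + m <= (m + 1)^2]. *)
Lemma expr_remainder t h rho m : `|t| <= rho -> `|t + h| <= rho ->
  rho ^+ 2 * `|(t + h) ^+ m - t ^+ m - h * (m%:R * t ^+ m.-1)| <=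
  m%:R ^+ 2 * rho ^+ m * h ^+ 2.
Proof.
move=> tr thr; have r0 : 0 <= rho by exact: le_trans tr.
elim: m => [|m IH].
  by rewrite !expr0 subrr mul0r mulr0 subrr normr0 mulr0 expr0n/= !mul0r.
have -> : (t + h) ^+ m.+1 - t ^+ m.+1 - h * (m.+1%:R * t ^+ m.+1.-1) =
    (t + h) * ((t + h) ^+ m - t ^+ m - h * (m%:R * t ^+ m.-1)) +
    m%:R * t ^+ m.-1 * h ^+ 2.
  case: m {IH} => [|m]; first by rewrite !expr0 !expr1; ring.
  by rewrite /= -(natr1 m.+1) !exprS; ring.
have H1 : rho ^+ 2 * `|(t + h) * ((t + h) ^+ m - t ^+ m - h * (m%:R * t ^+ m.-1))| <=
    m%:R ^+ 2 * rho ^+ m.+1 * h ^+ 2.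
  rewrite normrM mulrCA; apply: le_trans (ler_pM _ _ thr IH) _ => //.
    by rewrite mulr_ge0// exprn_ge0.
  by rewrite [rho ^+ m.+1]exprS le_eqVlt; apply/orP; left; apply/eqP; ring.
have H2 : rho ^+ 2 * `|m%:R * t ^+ m.-1 * h ^+ 2| <= m%:R * rho ^+ m.+1 * h ^+ 2.
  rewrite normrM (ger0_norm (sqr_ge0 h)) normrM (ger0_norm (ler0n _ _)) mulrA.
  rewrite ler_wpM2r ?sqr_ge0//; case: m {IH H1} => [|m]; first by rewrite !mul0r mulr0.
  rewrite /= normrX mulrCA ler_wpM2l// (_ : m.+2 = (2 + m)%N)// exprD.
  by rewrite ler_wpM2l ?exprn_ge0// lerXn2r// nnegrE.
apply: (@le_trans _ _ (m%:R ^+ 2 * rho ^+ m.+1 * h ^+ 2 + m%:R * rho ^+ m.+1 * h ^+ 2)).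
  apply: le_trans (lerD H1 H2); rewrite -mulrDr ler_wpM2l ?exprn_ge0//.
  exact: ler_normD.
rewrite -!mulrDl ler_wpM2r ?sqr_ge0// ler_wpM2r ?exprn_ge0//.
rewrite -(natr1 m) -subr_ge0.
have -> : (m%:R + 1) ^+ 2 - (m%:R ^+ 2 + m%:R) = m%:R + 1 :> R by ring.
by rewrite addr_ge0.
Qed.

(** Again [B] precedes [u], so that pointwise remainders add up to a norm bound. The ratios [q1] and
    [q2] absorb one factor [n] each of the [n ^+ 2] in the termwise remainder. *)
Lemma psum_remainder q rho : 0 <= q -> 0 < rho -> rho * q < 1 ->
  exists2 B, 0 <= B & forall u D, 0 <= D -> (forall n, `|u n| <= D * q ^+ n) ->
  forall t h, `|t| <= rho -> `|t + h| <= rho ->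
  `|psum u (t + h) - psum u t - h * psum (dcoef u) t| <= B * D * h ^+ 2.
Proof.
move=> q0 r0 rq.
have [q1 /andP[qq1 q1r]] : exists q1, q < q1 < rho^-1.
  have qr : q < rho^-1 by rewrite -[ltRHS]mul1r ltr_pdivlMr// mulrC.
  by exists ((q + rho^-1) / 2); rewrite !midf_lt.
have [q2 /andP[qq2 q2r]] : exists q2, q1 < q2 < rho^-1.
  by exists ((q1 + rho^-1) / 2); rewrite !midf_lt.
have q10 : 0 <= q1 by exact: le_trans q0 (ltW qq1).
have q20 : 0 <= q2 by exact: le_trans q10 (ltW qq2).
have [A1 A10 A1P] := natmul_expr_le q0 qq1.
have [A2 A20 A2P] := natmul_expr_le q10 qq2.
have [A3 A30 A3P] := dcoef_bound q0 qq1.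
have q1rho : rho * q1 < 1 by rewrite mulrC -ltr_pdivlMr// mul1r.
have q2rho : rho * q2 < 1 by rewrite mulrC -ltr_pdivlMr// mul1r.
have s0 : 0 <= (1 - rho * q2)^-1 by rewrite invr_ge0 subr_ge0 ltW.
exists (A1 * A2 / rho ^+ 2 / (1 - rho * q2)).
  by rewrite !mulr_ge0// invr_ge0 sqr_ge0.
move=> u D D0 uq t h tr thr.
have lt1 p : 0 <= p -> rho * p < 1 -> forall x, `|x| <= rho -> `|x| * p < 1.
  by move=> p0 rp x xr; apply: le_lt_trans rp; rewrite ler_wpM2r.
have [cv1 _] := psum_bound q0 D0 (lt1 _ q0 rq _ thr) uq.
have [cv2 _] := psum_bound q0 D0 (lt1 _ q0 rq _ tr) uq.
have [cv3 _] := psum_bound q10 (mulr_ge0 A30 D0) (lt1 _ q10 q1rho _ tr) (A3P u D D0 uq).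
pose f m := u m * ((t + h) ^+ m - t ^+ m - h * (m%:R * t ^+ m.-1)).
have fE : psum u (t + h) - psum u t - h * psum (dcoef u) t = limn (series f).
  apply/esym/cvg_lim => //; rewrite -(cvg_shiftS (series f)).
  (* The derived series runs one index behind the other two. *)
  have E n : series f n.+1 = series (fun m => u m * (t + h) ^+ m) n.+1 -
      series (fun m => u m * t ^+ m) n.+1 -
      h * series (fun m => dcoef u m * t ^+ m) n.
    have -> : series (fun m => dcoef u m * t ^+ m) n =
        series (fun m => u m * (m%:R * t ^+ m.-1)) n.+1.
      rewrite /series /= [RHS]big_nat_recl//= !mul0r mulr0 add0r.
      by apply: eq_bigr => i _; rewrite /dcoef; ring.
    rewrite /series /= mulr_sumr -!sumrB; apply: eq_bigr => i _.
    by rewrite /f; ring.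
  under eq_fun do rewrite E.
  apply: cvgB; first apply: cvgB.
  - by rewrite (cvg_shiftS (series (fun m => u m * (t + h) ^+ m))).
  - by rewrite (cvg_shiftS (series (fun m => u m * t ^+ m))).
  - by apply: cvgMr; exact: cv3.
rewrite fE.
have fb n : `|f n| <= (D * A1 * A2 / rho ^+ 2 * h ^+ 2) * (rho * q2) ^+ n.
  have H := expr_remainder n tr thr.
  have n2 : n%:R ^+ 2 * q ^+ n <= A1 * A2 * q2 ^+ n.
    rewrite expr2 -mulrA; apply: le_trans (ler_wpM2l (ler0n _ n) (A1P n)) _.
    by rewrite mulrCA -mulrA ler_wpM2l.
  rewrite /f normrM.
  apply: (@le_trans _ _ (D * q ^+ n * (n%:R ^+ 2 * rho ^+ n * h ^+ 2 / rho ^+ 2))).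
    apply: ler_pM => //.
    by rewrite ler_pdivlMr ?exprn_gt0// [_ * rho ^+ 2]mulrC.
  have K0 : 0 <= D * rho ^+ n * h ^+ 2 / rho ^+ 2.
    apply: mulr_ge0; last by rewrite invr_ge0 sqr_ge0.
    by apply: mulr_ge0 (mulr_ge0 D0 (exprn_ge0 _ (ltW r0))) (sqr_ge0 _).
  have := ler_wpM2l K0 n2; rewrite exprMn; congr (_ <= _); ring.
have x0 : 0 <= rho * q2 by rewrite mulr_ge0// ltW.
have F0 : 0 <= D * A1 * A2 / rho ^+ 2 * h ^+ 2.
  apply: mulr_ge0 (mulr_ge0 (mulr_ge0 (mulr_ge0 D0 A10) A20) _) (sqr_ge0 _).
  by rewrite invr_ge0 sqr_ge0.
have [_ /(_ 0)] := geometric_bound_series x0 q2rho F0 fb.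
rewrite /series /= big_geq// subr0 expr0 mulr1 => /le_trans; apply.
by rewrite le_eqVlt; apply/orP; left; apply/eqP; ring.
Qed.

End power_series.

(** * A mean value inequality *)

Section one_variable.
Context {R : realType} {V : normedModType R}.
Implicit Types (f : R -> V) (A : set R).

Lemma within_continuousP A f : {within A, continuous f} <->
  forall x, A x -> forall e, 0 < e -> exists2 del, 0 < del &
    forall y, A y -> `|y - x| < del -> `|f y - f x| < e.
Proof.
rewrite subspace_continuousP; split=> H x Ax.
  move=> e e0; have /cvgrPdist_lt /(_ e e0) := H x Ax.
  rewrite near_withinE => /nbhs_ballP[del /= del0 D].
  by exists del => // y Ay yx; rewrite distrC; apply: D => //; rewrite /ball /= distrC.
apply/cvgrPdist_lt => e e0; have [del del0 D] := H x Ax e e0.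
rewrite near_withinE; apply/nbhs_ballP; exists del => //= y yx Ay.
by rewrite distrC; apply: D => //; rewrite distrC.
Qed.

Lemma derivable_remainder f x e : derivable f x 1 -> 0 < e ->
  exists2 del, 0 < del & forall h, `|h| < del ->
    `|f (h + x) - f x - h *: derive1 f x| <= e * `|h|.
Proof.
move=> fx e0; have : (fun h => h^-1 *: (f (h + x) - f x)) @ 0^' --> derive1 f x.
  rewrite (_ : (fun _ => _) = fun h => h^-1 *: ((f \o shift x) (h *: 1) - f x)).
    by rewrite derive1E.
  by apply/funext => h /=; rewrite [h *: 1]mulr1.
move=> /cvgrPdist_lt /(_ e e0); rewrite near_withinE => /nbhs_ballP[del /= del0 D].
exists del => // h hdel; have [->|h0] := eqVneq h 0.
  by rewrite add0r subrr scale0r subr0 !normr0 mulr0.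
have := D h; rewrite /ball /= sub0r normrN => /(_ hdel h0) /ltW.
have -> : f (h + x) - f x - h *: derive1 f x =
    - (h *: (derive1 f x - h^-1 *: (f (h + x) - f x))).
  by rewrite scalerBr scalerA divff// scale1r opprB.
by rewrite normrN normrZ mulrC => H; rewrite ler_wpM2r.
Qed.

Lemma derivable_of_remainder f x (l : V) (B del : R) : 0 < del ->
  (forall h, `|h| <= del -> `|f (h + x) - f x - h *: l| <= B * `|h| ^+ 2) ->
  derivable f x 1 /\ derive1 f x = l.
Proof.
move=> del0 H; have fx : (fun h => h^-1 *: (f (h + x) - f x)) @ 0^' --> l.
  apply/cvgrPdist_le => e e0; rewrite near_withinE; apply/nbhs_ballP.
  have B1 : 0 < `|B| + 1 by rewrite ltr_pwDr.
  exists (Num.min del (e / (`|B| + 1))); first by rewrite /= lt_min del0 divr_gt0.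
  move=> h; rewrite /ball /= sub0r normrN lt_min => /andP[hdel hB] h0.
  have -> : l - h^-1 *: (f (h + x) - f x) = - (h^-1 *: (f (h + x) - f x - h *: l)).
    by rewrite [in RHS]scalerBr scalerA mulVf// scale1r opprB.
  rewrite normrN normrZ normfV ler_pdivrMl ?normr_gt0//.
  apply: le_trans (H h (ltW hdel)) _; rewrite expr2 mulrA [leRHS]mulrC.
  rewrite ler_wpM2r//; apply: (@le_trans _ _ ((`|B| + 1) * `|h|)).
    by rewrite ler_wpM2r// (le_trans (ler_norm _))// lerDl.
  by rewrite mulrC -ler_pdivlMr// ltW.
have fE : (fun h => h^-1 *: ((f \o shift x) (h *: 1) - f x)) =
    (fun h => h^-1 *: (f (h + x) - f x)).
  by apply/funext => h /=; rewrite [h *: 1]mulr1.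
split; first by rewrite /derivable fE; exact: cvgP fx.
by rewrite /derive1; exact: cvg_lim fx.
Qed.

End one_variable.

Section mean_value.
Context {R : realType} {V : normedModType R}.
Variables (p : V -> R) (Cp : R).
Hypothesis pD : forall x y, p (x + y) <= p x + p y.
Hypothesis pZ : forall c x, p (c *: x) = `|c| * p x.
Hypothesis p_le : forall x, p x <= Cp * `|x|.

Let p0 : p 0 = 0.
Proof. by rewrite -(scale0r 0) pZ normr0 mul0r. Qed.

(* The largest [y] in [[s, t]] up to which the estimate holds with slack [eps]
   cannot be smaller than [t]. *)
Lemma seminorm_mean_value (f : R -> V) (b : R -> R) (s t : R) : s <= t ->
  {within `[s, t], continuous f} -> {within `[s, t], continuous b} ->
  (forall r, r \in `]s, t[ -> derivable f r 1) ->
  (forall r, r \in `]s, t[ -> derivable b r 1) ->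
  (forall r, r \in `]s, t[ -> p (derive1 f r) <= derive1 b r) ->
  p (f t - f s) <= b t - b s.
Proof.
move=> st /within_continuousP cf /within_continuousP cb df db fb.
pose h y := p (f y - f s) - (b y - b s).
have C0 : 0 < `|Cp| + 1 by rewrite ltr_pwDr.
have pC x : p x <= (`|Cp| + 1) * `|x|.
  apply: le_trans (p_le x) _; rewrite ler_wpM2r// (le_trans (ler_norm _))// lerDl//.
have hD x y : h y <= h x + p (f y - f x) + `|b y - b x|.
  have := pD (f y - f x) (f x - f s).
  rewrite addrA subrK /h => H; have := ler_norm (b x - b y); rewrite distrC; lra.
have hc x : x \in `[s, t] -> forall e, 0 < e -> exists2 del, 0 < del &
    forall y, y \in `[s, t] -> `|y - x| < del -> h y < h x + e /\ h x < h y + e.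
  move=> xst e e0.
  have e1 : 0 < e / 2 / (`|Cp| + 1) by rewrite !divr_gt0.
  have [d1 d10 H1] := cf x xst _ e1.
  have e2 : 0 < e / 2 by rewrite divr_gt0.
  have [d2 d20 H2] := cb x xst _ e2.
  exists (Num.min d1 d2); first by rewrite lt_min d10.
  move=> y yst; rewrite lt_min => /andP[/(H1 y yst) y1 /(H2 y yst) y2].
  have {}y1 : (`|Cp| + 1) * `|f y - f x| < e / 2 by rewrite mulrC -ltr_pdivlMr.
  have P1 := pC (f y - f x).
  have P2 := pC (f x - f y); rewrite distrC in P2.
  have Q1 := hD x y; have Q2 := hD y x; rewrite (distrC (b x)) in Q2.
  by split; lra.
suff H e : 0 < e -> h t <= e * (1 + t - s).
  suff : h t <= 0 by rewrite /h subr_le0.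
  apply/ler_addgt0Pl => e e0; rewrite addr0.
  have K : 0 < 1 + t - s by rewrite -addrA ltr_wpDr// subr_ge0.
  by apply: le_trans (H _ (divr_gt0 e0 K)) _; rewrite divfK// gt_eqF.
move=> e0; pose A := [set y | y \in `[s, t] /\ h y <= e * (1 + y - s)].
have hs : h s = 0 by rewrite /h !subrr p0 subr0.
have As : A s.
  split; first by rewrite in_itv/= lexx.
  by rewrite hs addrK mulr1 ltW.
have At : ubound A t by move=> y [+ _]; rewrite in_itv/= => /andP[].
have Asup : has_sup A by split; [exists s|exists t].
pose sg := sup A.
have sgA y : A y -> y <= sg by move=> Ay; apply: ub_le_sup => //; exists t.
have s_sg : s <= sg by exact: sgA.
have sg_t : sg <= t by apply: ge_sup => //; exists s.
have sgst : sg \in `[s, t] by rewrite in_itv/= s_sg.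
have hsg : h sg <= e * (1 + sg - s).
  rewrite leNgt; apply/negP; rewrite -subr_gt0 => g0.
  have [del del0 D] := hc _ sgst _ g0.
  have [y Ay ysg] := sup_adherent del0 Asup.
  have ylt : `|y - sg| < del.
    by rewrite ler0_norm ?subr_le0 ?sgA// opprB ltrBlDl -ltrBlDr.
  have [_] := D y Ay.1 ylt; have := Ay.2; have := sgA _ Ay.
  move=> H1 H2 H3; have := ler_wpM2l (ltW e0) H1; lra.
have [sgE|sgt] := eqVneq sg t; first by rewrite -sgE.
have {}sgt : sg < t by rewrite lt_neqAle sgt.
exfalso; suff [y [ysg yt hy]] : exists y, [/\ sg < y, y <= t & h y <= e * (1 + y - s)].
  have : A y by split => //; rewrite in_itv/= yt (le_trans s_sg)// ltW.
  by move/sgA; rewrite leNgt ysg.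
(* At [s] only continuity is available; since [h s = 0], the constant 1 in the slack
   [e * (1 + y - s)] leaves room there. *)
have [sgs|sgs] := eqVneq sg s.
  have [del del0 D] := hc _ sgst _ e0.
  pose y := Num.min (sg + del / 2) t.
  have ysg : sg < y by rewrite lt_min sgt ltrDl divr_gt0.
  have yt : y <= t by rewrite ge_min lexx orbT.
  exists y; split => //.
  have yd : y - sg < del.
    have : y <= sg + del / 2 by rewrite ge_min lexx.
    lra.
  have [] := D y; rewrite ?in_itv/= ?yt ?(le_trans s_sg (ltW ysg))//.
    by rewrite gtr0_norm// subr_gt0.
  rewrite sgs hs add0r => /ltW hy _; apply: le_trans hy _.
  by rewrite -[leLHS]mulr1 ler_pM2l// -addrA lerDl subr_ge0 -sgs ltW.
have sgi : sg \in `]s, t[ by rewrite in_itv/= sgt lt_neqAle eq_sym sgs s_sg.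
have e1 : 0 < e / 2 / (`|Cp| + 1) by rewrite !divr_gt0.
have e2 : 0 < e / 2 by rewrite divr_gt0.
have [d1 d10 H1] := derivable_remainder (df _ sgi) e1.
have [d2 d20 H2] := derivable_remainder (db _ sgi) e2.
pose x := Num.min (Num.min (d1 / 2) (d2 / 2)) (t - sg).
have x0 : 0 < x by rewrite !lt_min !divr_gt0//= subr_gt0.
have xn : `|x| = x by rewrite gtr0_norm.
have xt : x <= t - sg by rewrite ge_min lexx orbT.
have x1 : x <= d1 / 2 by rewrite !ge_min lexx.
have x2 : x <= d2 / 2 by rewrite !ge_min lexx orbT.
have {}H1 : `|f (x + sg) - f sg - x *: derive1 f sg| <= e / 2 / (`|Cp| + 1) * x.
  by rewrite -[X in _ <= _ * X]xn H1// xn; lra.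
have {}H2 : `|b (x + sg) - b sg - x *: derive1 b sg| <= e / 2 * x.
  by rewrite -[X in _ <= _ * X]xn H2// xn; lra.
exists (x + sg); split; [by rewrite ltrDr| by rewrite -lerBrDr|].
have P : p (f (x + sg) - f sg) <= e / 2 * x + x * derive1 b sg.
  have := pD (f (x + sg) - f sg - x *: derive1 f sg) (x *: derive1 f sg).
  rewrite subrK pZ xn => /le_trans; apply; apply: lerD.
    apply: le_trans (pC _) _; rewrite mulrC -ler_pdivlMr//.
    by apply: le_trans H1 _; rewrite mulrAC.
  by rewrite ler_pM2l// fb.
have Q : x * derive1 b sg - e / 2 * x <= b (x + sg) - b sg.
  have xE : x *: derive1 b sg = x * derive1 b sg by [].
  move: H2; rewrite xE ler_norml => /andP[+ _]; rewrite -subr_ge0.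
  by set z := x * _; set w := e / 2 * x; lra.
have T : h (x + sg) <= h sg + p (f (x + sg) - f sg) - (b (x + sg) - b sg).
  have := pD (f (x + sg) - f sg) (f sg - f s); rewrite addrA subrK /h; lra.
have -> : e * (1 + (x + sg) - s) = e * (1 + sg - s) + e * x by ring.
lra.
Qed.

End mean_value.

(** * Existence *)

Section Kspace_power_series.
Context {R : realType} {d : nat}.
Hypothesis d_gt0 : (0 < d)%N.
Local Notation lp := (lebesgue_poisson R d).
Variables (theta : R).
Local Notation s := (expR (- theta)).
Implicit Types (c : nat -> conf R d -> R) (D q t : R).

(** The series is summed configuration by configuration and the class is taken afterwards. *)
Definition Kpsum c t : Kspace d theta :=
  to_Kspace theta (fun eta => psum (c ^~ eta) t).

(** The bound holds everywhere and not only almost everywhere, so the scalar series converges at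
    every configuration. *)
Definition geometrically_bounded c D q := (forall m, measurable_fun setT (c m)) /\
  forall m eta, `|c m eta| <= D * q ^+ m * s ^+ #|` eta|.

Definition dcoefs c m eta := dcoef (c ^~ eta) m.

Let Ds_bound c D q eta : geometrically_bounded c D q ->
  forall m, `|c m eta| <= D * s ^+ #|` eta| * q ^+ m.
Proof. by move=> [_ cD] m; rewrite mulrAC. Qed.

Let Ds_ge0 D (eta : conf R d) : 0 <= D -> 0 <= D * s ^+ #|` eta|.
Proof. by move=> D0; rewrite mulr_ge0// exprn_ge0// expR_ge0. Qed.

Lemma dcoefs_bounded c D q q' : 0 <= D -> 0 <= q -> q < q' ->
  geometrically_bounded c D q ->
  exists2 D', 0 <= D' & geometrically_bounded (dcoefs c) D' q'.
Proof.
move=> D0 q0 qq cD; have [A A0 AP] := dcoef_bound q0 qq.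
exists (A * D); first by rewrite mulr_ge0.
split=> [m|m eta].
  by apply: measurable_funM => //; exact: cD.1.
have := AP _ _ (Ds_ge0 eta D0) (Ds_bound eta cD) m.
by congr (_ <= _); ring.
Qed.

Lemma measurable_psum c D q t : 0 <= D -> 0 <= q -> `|t| * q < 1 ->
  geometrically_bounded c D q ->
  measurable_fun setT (fun eta => psum (c ^~ eta) t).
Proof.
move=> D0 q0 tq cD.
apply: (measurable_fun_cvg (h := fun n eta => series (fun m => c m eta * t ^+ m) n)).
  move=> n; rewrite /series /=; apply: measurable_sum => m.
  by apply: measurable_funM => //; exact: cD.1.
move=> eta _.
by have [] := psum_bound q0 (Ds_ge0 eta D0) tq (Ds_bound eta cD).
Qed.

Lemma psum_bounded_by c D q t : 0 <= D -> 0 <= q -> `|t| * q < 1 ->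
  geometrically_bounded c D q ->
  bounded_by (fun eta => psum (c ^~ eta) t) (D / (1 - `|t| * q)) s.
Proof.
move=> D0 q0 tq cD; apply: aeW => eta.
have := psum_le q0 (Ds_ge0 eta D0) tq (Ds_bound eta cD).
by rewrite mulrAC.
Qed.

Lemma KpsumE c D q t : 0 <= D -> 0 <= q -> `|t| * q < 1 ->
  geometrically_bounded c D q ->
  L0_fun (Kval (Kpsum c t)) = (fun eta => psum (c ^~ eta) t) %[ae lp].
Proof.
move=> D0 q0 tq cD; apply: (to_KspaceE d_gt0 _ _ (psum_bounded_by D0 q0 tq cD)).
  by rewrite divr_ge0// subr_ge0 ltW.
exact: measurable_psum cD.
Qed.

(** The constant of [psum_remainder] is the same for all configurations, so the scalar second-order
    remainders give one in the norm of the space. *)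
Lemma derivable_Kpsum c D q t : 0 <= D -> 0 <= q -> `|t| * q < 1 ->
  geometrically_bounded c D q ->
  derivable (Kpsum c) t 1 /\ derive1 (Kpsum c) t = Kpsum (dcoefs c) t.
Proof.
move=> D0 q0 tq cD.
(* A radius between [|t|] and [q^-1]; the case [q = 0] is separate because the inverse of 0 is 0. *)
have [rho [trho r0 rq]] : exists rho, [/\ `|t| < rho, 0 < rho & rho * q < 1].
  have [q00|qn0] := eqVneq q 0.
    exists (`|t| + 1); split; [by rewrite ltrDl| |by rewrite q00 mulr0].
    by apply: ltr_wpDl.
  have qp : 0 < q by rewrite lt_neqAle eq_sym qn0.
  have tq' : `|t| < q^-1 by rewrite -[ltRHS]mul1r ltr_pdivlMr.
  exists ((`|t| + q^-1) / 2); split; first by rewrite midf_lt.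
    by rewrite divr_gt0// ltr_wpDl// invr_gt0.
  by rewrite -ltr_pdivlMr// mul1r midf_lt.
have [q' /andP[qq' rq']] : exists q', q < q' < rho^-1.
  have qr : q < rho^-1 by rewrite -[ltRHS]mul1r ltr_pdivlMr// mulrC.
  by exists ((q + rho^-1) / 2); rewrite !midf_lt.
have q'0 : 0 <= q' by exact: le_trans q0 (ltW qq').
have {}rq' : rho * q' < 1 by rewrite mulrC -ltr_pdivlMr// mul1r.
have [D' D'0 cD'] := dcoefs_bounded D0 q0 qq' cD.
have [B B0 BP] := psum_remainder q0 r0 rq.
have lt1 (p x : R) : 0 <= p -> rho * p < 1 -> `|x| <= rho -> `|x| * p < 1.
  by move=> p0 rp xr; apply: le_lt_trans rp; rewrite ler_wpM2r.
apply: (derivable_of_remainder (del := rho - `|t|) (B := B * D)).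
  by rewrite subr_gt0.
move=> h hdel.
have htr : `|t + h| <= rho.
  by apply: le_trans (ler_normD _ _) _; rewrite -lerBrDl.
have tr : `|t| <= rho by exact: ltW.
rewrite (addrC h t); apply/(Knorm_leP d_gt0).
  by rewrite !mulr_ge0// sqr_ge0.
have E1 := KpsumE D0 q0 (lt1 _ _ q0 rq htr) cD.
have E2 := KpsumE D0 q0 (lt1 _ _ q0 rq tr) cD.
have E3 := KpsumE D'0 q'0 (lt1 _ _ q'0 rq' tr) cD'.
rewrite -scaleNr.
have F1 := KvalD (Kpsum c (t + h) - Kpsum c t) (Kpsum (dcoefs c) t) (- h).
have F2 := KvalB (Kpsum c (t + h)) (Kpsum c t).
near=> eta.
have -> : L0_fun (Kval (Kpsum c (t + h) - Kpsum c t + - h *: Kpsum (dcoefs c) t)) eta =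
    psum (c ^~ eta) (t + h) - psum (c ^~ eta) t - h * psum (dcoef (c ^~ eta)) t.
  rewrite (near F1 eta)// (near F2 eta)// (near E1 eta)// (near E2 eta)//.
  by rewrite (near E3 eta)// mulNr.
rewrite real_normK ?num_real//.
by have := BP _ _ (Ds_ge0 eta D0) (Ds_bound eta cD) t h tr htr; congr (_ <= _); ring.
Unshelve. all: by end_near. Qed.

End Kspace_power_series.

Lemma le0_geometric (R : realType) (x K y : R) : 0 <= y -> y < 1 ->
  (forall N, x <= K * y ^+ N) -> x <= 0.
Proof.
move=> y0 y1 H; have cg : geometric K y @ \oo --> 0.
  by apply: cvg_geometric; rewrite ger0_norm.
rewrite -(cvg_lim _ cg)//; apply: limr_ge; first exact: cvgP cg.
by apply: nearW => n; exact: H.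
Qed.

Section existence.
Context {R : realType} {d : nat}.
Hypothesis d_gt0 : (0 < d)%N.
Local Notation X := (Rd R d).
Local Notation leb := (lebesgue_Rd R d).
Local Notation lp := (lebesgue_poisson R d).
Variables a phi : X -> R.
Hypothesis a_meas : measurable_fun setT a.
Hypothesis phi_meas : measurable_fun setT phi.
Hypothesis a_ge0 : forall x, 0 <= a x.
Hypothesis phi_ge0 : forall x, 0 <= phi x.
Hypothesis a_even : forall x, a (oppRd x) = a x.
Hypothesis phi_even : forall x, phi (oppRd x) = phi x.
Hypothesis a_int : (\int[leb]_x (a x)%:E < +oo)%E.
Hypothesis phi_int : (\int[leb]_x (1 - expR (- phi x))%:E < +oo)%E.
Local Notation LDelta := (LDelta a phi).
Local Notation M := (LDelta_const a phi).
Implicit Types (f g k : conf R d -> R) (theta C D : R).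

Let mL k : measurable_fun setT k -> measurable_fun setT (LDelta k).
Proof. exact: measurable_LDelta. Qed.

Let L_bounded := LDelta_bounded d_gt0 a_meas phi_meas a_ge0 phi_ge0 a_even phi_even
  a_int phi_int.
Let L_linear := LDelta_ae_linear d_gt0 a_meas phi_meas a_ge0 phi_ge0 a_even phi_even
  a_int phi_int.
Let L_ae := LDelta_ae d_gt0 a_meas phi_meas a_ge0 phi_ge0 a_even phi_even
  a_int phi_int.
Let M_ge0 theta : 0 <= M theta.
Proof. exact: LDelta_const_ge0. Qed.
Let M_anti theta theta' : theta <= theta' -> M theta' <= M theta.
Proof. exact: LDelta_constS. Qed.

Fixpoint taylor f m : conf R d -> R :=
  if m is n.+1 then fun eta => n.+1%:R^-1 * LDelta (taylor f n) eta else f.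

Lemma measurable_taylor f m : measurable_fun setT f -> measurable_fun setT (taylor f m).
Proof.
move=> mf; elim: m => [//|m IH] /=.
by apply: measurable_funM; [exact: measurable_cst|exact: mL].
Qed.

(** One term of the exponential series at [m]. The powers of [e] cancel those in the norm bounds of
    the operator, so the radius of convergence comes out as exactly [T]. *)
Lemma expn_le_fact_expR m : m%:R ^+ m <= m`!%:R * expR 1 ^+ m :> R.
Proof.
case: m => [|m]; first by rewrite !expr0 mulr1 fact0.
rewrite -expRM_natl mulr1 mulrC -ler_pdivrMr ?ltr0n ?fact_gt0//.
apply: le_trans (expR_ge1Dxn m (ler0n _ _)).
by rewrite lerDr.
Qed.

(* Going from [theta0] to [theta] in [m] equal steps costs the factor
   [(m M / (e (theta0 - theta))) ^ m], which [m!] absorbs. *)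
Lemma taylor_bounded f C theta0 theta m : theta < theta0 -> 0 <= C ->
  measurable_fun setT f -> bounded_by f C (expR (- theta0)) ->
  bounded_by (taylor f m) (C * (M theta / (theta0 - theta)) ^+ m) (expR (- theta)).
Proof.
move=> tt C0 mf fC; have dt : 0 < theta0 - theta by rewrite subr_gt0.
case: m => [|m].
  rewrite expr0 mulr1; apply: bounded_byW fC => //.
  by rewrite ler_expR lerN2 ltW.
pose e := (theta0 - theta) / m.+1%:R.
have e0 : 0 < e by rewrite divr_gt0.
pose K := M theta / (e * expR 1).
have K0 : 0 <= K by rewrite /K divr_ge0// mulr_ge0 ?expR_ge0// ltW.
have step j : (j <= m.+1)%N ->
    bounded_by (taylor f j) (C * K ^+ j / j`!%:R) (expR (- (theta0 - j%:R * e))).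
  elim: j => [_|j IH jm].
    by rewrite expr0 fact0 mul0r subr0 divr1 mulr1.
  have {}IH := IH (ltnW jm).
  have Cj : 0 <= C * K ^+ j / j`!%:R by rewrite divr_ge0// mulr_ge0// exprn_ge0.
  have lt_j : theta0 - j.+1%:R * e < theta0 - j%:R * e.
    by rewrite ltrD2l ltrN2 ltr_pM2r// ltr_nat.
  have := L_bounded lt_j Cj (measurable_taylor j mf) IH.
  have -> : theta0 - j%:R * e - (theta0 - j.+1%:R * e) = e.
    by rewrite -(natr1 j); ring.
  apply: filterS => xi H /=; rewrite normrM ger0_norm ?invr_ge0//.
  (* All intermediate indices are at least [theta], and [M] is nonincreasing. *)
  have Mle : M (theta0 - j%:R * e) <= M theta.
    apply: M_anti; rewrite lerBrDr -lerBrDl.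
    rewrite /e mulrA ler_pdivrMr// mulrC ler_pM2l// ler_nat; exact: ltnW.
  apply: le_trans (ler_wpM2l _ H) _; first by rewrite invr_ge0.
  have S0 : 0 <= expR (- (theta0 - j.+1%:R * e)) ^+ #|` xi| by rewrite exprn_ge0// expR_ge0.
  have E0 : 0 <= (e * expR 1)^-1 by rewrite invr_ge0 mulr_ge0 ?expR_ge0// ltW.
  have F : (j.+1`!%:R)^-1 = (j.+1%:R)^-1 / j`!%:R :> R.
    by rewrite factS natrM invfM.
  rewrite F exprS /K.
  have := ler_wpM2r (mulr_ge0 (mulr_ge0 (mulr_ge0 E0 Cj) S0)
     (_ : 0 <= (j.+1%:R)^-1 :> R)) Mle.
  rewrite invr_ge0 ler0n => /(_ isT); congr (_ <= _); rewrite /K; ring.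
have := step m.+1 (leqnn _).
have -> : theta0 - m.+1%:R * e = theta.
  by rewrite /e mulrCA divff ?mulr1 ?pnatr_eq0//; ring.
apply: bounded_byW => //.
- by rewrite divr_ge0// mulr_ge0// exprn_ge0.

rewrite -mulrA ler_wpM2l// ler_pdivrMr ?ltr0n ?fact_gt0//.
have -> : K = M theta / (theta0 - theta) * (m.+1%:R / expR 1).
  by rewrite /K /e !invfM invrK; ring.
rewrite exprMn ler_wpM2l ?exprn_ge0 ?divr_ge0 ?(ltW dt)//.
rewrite expr_div_n ler_pdivrMr ?exprn_gt0 ?expR_gt0//.
exact: expn_le_fact_expR.
Qed.

(** Changes a representative on a null set so that an almost everywhere bound holds everywhere. *)
Definition truncate f C s eta := if `|f eta| <= C * s ^+ #|` eta| then f eta else 0.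

Lemma truncate_ae f C s : bounded_by f C s -> truncate f C s = f %[ae lp].
Proof. by apply: filterS => eta H _; rewrite /truncate H. Qed.

Lemma truncate_le f C s eta : 0 <= C -> 0 <= s ->
  `|truncate f C s eta| <= C * s ^+ #|` eta|.
Proof.
move=> C0 s0; rewrite /truncate; case: ifP => // _.
by rewrite normr0 mulr_ge0// exprn_ge0.
Qed.

Lemma measurable_truncate f C s : measurable_fun setT f ->
  measurable_fun setT (truncate f C s).
Proof.
move=> mf; apply: measurable_fun_ifT => //.
apply: (measurable_fun_bool true); rewrite setTI.
exact: measurable_bound.
Qed.

Lemma LDelta0 : LDelta (fun=> 0) = (fun=> 0) %[ae lp].
Proof.
have b0 : bounded_by (fun _ : conf R d => 0) 0 (expR (- 0)).
  by apply: aeW => xi; rewrite normr0 mul0r.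
have := L_bounded (ltrN10 R) (lexx 0) (measurable_cst _) b0.
by rewrite mulr0; apply: filterS => xi; rewrite mul0r normr_le0 => /eqP.
Qed.

(* Both sides are limits of partial sums: the left one because [L] is bounded
   from [K_theta'] to [K_theta] for some intermediate [theta']. *)
Lemma LDelta_psum f C theta0 theta t (c : nat -> conf R d -> R) D q D' q' :
  theta < theta0 -> 0 <= C -> measurable_fun setT f ->
  bounded_by f C (expR (- theta0)) ->
  0 <= t -> t * M theta < theta0 - theta ->
  (forall m, c m = taylor f m %[ae lp]) ->
  0 <= D -> 0 <= q -> t * q < 1 -> geometrically_bounded theta c D q ->
  0 <= D' -> 0 <= q' -> t * q' < 1 -> geometrically_bounded theta (dcoefs c) D' q' ->
  LDelta (fun eta => psum (c ^~ eta) t) = (fun eta => psum (dcoefs c ^~ eta) t) %[ae lp].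
Proof.
move=> tt C0 mf fC t0 tM cE D0 q0 tq cD D'0 q'0 tq' cD'.
have tn : `|t| = t by rewrite ger0_norm.
(* Above [theta], so that the operator has room to act, but below [theta0 - t * M theta], so that
   the series at time [t] still converges with index [theta']. *)
pose theta' := (theta + (theta0 - t * M theta)) / 2.
have [tt' t't0] : theta < theta' /\ theta' < theta0 - t * M theta.
  by rewrite !midf_lt//; lra.
have t't : theta' < theta0.
  by apply: lt_le_trans t't0 _; rewrite gerBl mulr_ge0.
pose s := expR (- theta); pose s' := expR (- theta').
have s0 : 0 <= s by exact: expR_ge0.
have s'0 : 0 < s' by exact: expR_gt0.
pose r := M theta' / (theta0 - theta').
have r0 : 0 <= r by rewrite divr_ge0// subr_ge0 ltW.
have tr : t * r < 1.
  rewrite /r mulrA ltr_pdivrMr ?subr_gt0// mul1r.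
  apply: (@le_lt_trans _ _ (t * M theta)); last by rewrite ltrBrDl -ltrBrDr.
  by rewrite ler_wpM2l// M_anti// ltW.
have mc m : measurable_fun setT (c m) by exact: cD.1.
have cb m : bounded_by (c m) (C * r ^+ m) s'.
  apply: bounded_by_ae (taylor_bounded m t't C0 mf fC).
  exact: ae_eq_sym (cE m).
have Cr m : 0 <= C * r ^+ m by rewrite mulr_ge0// exprn_ge0.
pose u eta := psum (c ^~ eta) t.
pose uN N eta := \sum_(0 <= m < N) c m eta * t ^+ m.
have muN N : measurable_fun setT (uN N).
  by apply: measurable_sum => m; exact: measurable_funM.
have uNS N eta : uN N.+1 eta = uN N eta + t ^+ N * c N eta.
  by rewrite /uN big_nat_recr//= [c N eta * _]mulrC.
have uNb N : exists2 B, 0 <= B & bounded_by (uN N) B s'.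
  elim: N => [|N [B B0 IH]].
    by exists 0 => //; apply: aeW => xi; rewrite /uN big_geq// normr0 mul0r.
  exists (B + `|t ^+ N| * (C * r ^+ N)); first by rewrite addr_ge0// mulr_ge0.
  by apply: filterS (bounded_byD (t ^+ N) IH (cb N)) => xi; rewrite uNS.
have Lc m : LDelta (c m) = (fun eta => dcoefs c m eta) %[ae lp].
  have := L_ae s'0 (Cr m) (mc m) (measurable_taylor m mf) (cb m) (cE m).
  apply: filterS2 (cE m.+1) => eta /(_ I) E /(_ I) -> _.
  by rewrite /dcoefs /dcoef E /= mulVKf.
have LuN N : LDelta (uN N) = (fun eta => \sum_(0 <= m < N) dcoefs c m eta * t ^+ m) %[ae lp].
  elim: N => [|N IH].
    have -> : uN 0 = fun=> 0 by apply/funext => eta; rewrite /uN big_geq.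
    by apply: filterS LDelta0 => eta /(_ I) -> _; rewrite big_geq.
  have [B B0 uB] := uNb N.
  have := L_linear (t ^+ N) (ltW s'0) B0 (Cr N) (muN N) (mc N) uB (cb N).
  have -> : (fun eta => uN N eta + t ^+ N * c N eta) = uN N.+1.
    by apply/funext => eta; rewrite uNS.
  apply: filterS3 IH (Lc N) => eta /(_ I) E1 /(_ I) E2 -> _.
  by rewrite E1 E2 big_nat_recr//= [X in _ + X]mulrC.
have tqn : `|t| * q < 1 by rewrite tn.
have mu : measurable_fun setT u by exact: measurable_psum D0 q0 tqn cD.
have call : {ae lp, forall eta, forall m, `|c m eta| <= C * r ^+ m * s' ^+ #|` eta|}.
  exact: ae_foralln.
pose G N := C * (t * r) ^+ N / (1 - t * r).
have tr0 : 0 <= t * r by rewrite mulr_ge0.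
have G0 N : 0 <= G N.
  by rewrite /G divr_ge0 ?subr_ge0 ?(ltW tr)// mulr_ge0// exprn_ge0.
have tail N : bounded_by (fun eta => u eta + -1 * uN N eta) (G N) s'.
  apply: filterS call => eta H.
  have Cs : 0 <= C * s' ^+ #|` eta| by rewrite mulr_ge0// exprn_ge0// ltW.
  have Hm m : `|c m eta| <= C * s' ^+ #|` eta| * r ^+ m by rewrite mulrAC.
  have trn : `|t| * r < 1 by rewrite tn.
  have [_ /(_ N)] := psum_bound r0 Cs trn Hm.
  by rewrite mulN1r tn /G; congr (_ <= _); ring.
have [Bu Bu0 uBu] : exists2 B, 0 <= B & bounded_by u B s'.
  have [B B0 uB] := uNb 0.
  exists (G 0 + `|1| * B); first by rewrite addr_ge0// mulr_ge0.
  by apply: filterS (bounded_byD 1 (tail 0) uB) => eta; rewrite mul1r mulN1r subrK.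
pose K := M theta' / ((theta' - theta) * expR 1).
have K0 : 0 <= K by rewrite divr_ge0// mulr_ge0 ?expR_ge0// subr_ge0 ltW.
have Ltail N : {ae lp, forall eta, `|LDelta u eta - LDelta (uN N) eta| <= K * G N * s ^+ #|` eta|}.
  have [B B0 uB] := uNb N.
  have mB : measurable_fun setT (fun eta => u eta + -1 * uN N eta).
    by apply: measurable_funD => //; exact: measurable_funM.
  have H1 := L_bounded tt' (G0 N) mB (tail N).
  have H2 := L_linear (-1) (ltW s'0) Bu0 B0 mu (muN N) uBu uB.
  by apply: filterS2 H1 H2 => eta H1 H2; rewrite H2 mulN1r in H1.
have Lall := ae_foralln Ltail.
have LuNall : {ae lp, forall eta, forall N, LDelta (uN N) eta =
    \sum_(0 <= m < N) dcoefs c m eta * t ^+ m}.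
  by apply: ae_foralln => N; apply: filterS (LuN N) => eta /(_ I).
apply: filterS2 Lall LuNall => eta H1 H2 _.
apply/eqP; rewrite -subr_eq0 -normr_le0.
(* One ratio dominating both tails: that of the series for [u], sent through the operator, and that
   of the derived series. *)
pose w := Num.max (t * r) (t * q').
have w0 : 0 <= w by rewrite le_max tr0.
have w1 : w < 1 by rewrite gt_max tr.
have S0 : 0 <= s ^+ #|` eta| by rewrite exprn_ge0.
apply: (@le0_geometric _ _ ((K * C / (1 - t * r) + D' / (1 - t * q')) * s ^+ #|` eta|) w) => // N.
have tq'n : `|t| * q' < 1 by rewrite tn.
have Ds : 0 <= D' * s ^+ #|` eta| by rewrite mulr_ge0.
have Dm m : `|dcoefs c m eta| <= D' * s ^+ #|` eta| * q' ^+ m.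
  by rewrite mulrAC; exact: cD'.2.
have [_ /(_ N) H3] := psum_bound q'0 Ds tq'n Dm.
have {}H1 := H1 N; rewrite H2 in H1.
apply: le_trans (ler_distD (\sum_(0 <= m < N) dcoefs c m eta * t ^+ m) _ _) _.
rewrite [X in _ + X]distrC.
apply: le_trans (lerD H1 H3) _; rewrite tn /G.
have y1 : (t * r) ^+ N <= w ^+ N by rewrite lerXn2r ?nnegrE// le_max lexx.
have y2 : (t * q') ^+ N <= w ^+ N.
  by rewrite lerXn2r ?nnegrE ?mulr_ge0// le_max lexx orbT.
have k1 : 0 <= K * C / (1 - t * r) * s ^+ #|` eta|.
  apply: mulr_ge0 S0; apply: divr_ge0; first exact: mulr_ge0.
  by rewrite subr_ge0 ltW.
have k2 : 0 <= D' / (1 - t * q') * s ^+ #|` eta|.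
  apply: mulr_ge0 S0; apply: divr_ge0; first exact: D'0.
  by rewrite subr_ge0 ltW.
have := lerD (ler_wpM2l k1 y1) (ler_wpM2l k2 y2).
by congr (_ <= _); ring.
Qed.

Lemma classical_solution_exists theta theta0 T (k0 : Kspace d theta0) :
  0 < T -> 0 < M theta -> theta0 = theta + T * M theta ->
  exists k : R -> Kspace d theta, classical_solution a phi T k0 k.
Proof.
move=> T0 M0 t0E.
have tt : theta < theta0 by rewrite t0E ltrDl mulr_gt0.
pose f := L0_fun (Kval k0); pose C := `|k0|.
have C0 : 0 <= C by exact: normr_ge0.
have mf : measurable_fun setT f by exact: L0_measurable.
have fC : bounded_by f C (expR (- theta0)) by exact: bounded_by_Knorm.
pose q := T^-1; have q0 : 0 <= q by rewrite invr_ge0 ltW.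
(* The definition of [theta0] makes the ratio of the Taylor bounds exactly the inverse of [T]. *)
have qE : M theta / (theta0 - theta) = q.
  by rewrite t0E addrAC subrr add0r invfM mulrCA divff ?gt_eqF// mulr1.
pose s := expR (- theta); have s0 : 0 <= s by exact: expR_ge0.
pose c m := truncate (taylor f m) (C * q ^+ m) s.
have Cq m : 0 <= C * q ^+ m by rewrite mulr_ge0// exprn_ge0.
have cE m : c m = taylor f m %[ae lp].
  by apply: truncate_ae; rewrite -qE; exact: taylor_bounded.
have cb : geometrically_bounded theta c C q.
  split=> [m|m eta]; first by apply: measurable_truncate; exact: measurable_taylor.
  exact: truncate_le.
have tq (t : R) : `|t| < T -> `|t| * q < 1 by move=> tT; rewrite ltr_pdivrMr// mul1r.
pose k := Kpsum theta c; pose v := Kpsum theta (dcoefs c).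
have dk (t : R) : `|t| < T -> derivable k t 1 /\ derive1 k t = v t.
  by move=> tT; exact: (derivable_Kpsum d_gt0 C0 q0 (tq t tT) cb).
have dq (t : R) : `|t| < T -> exists D' q', [/\ 0 <= D', 0 <= q', `|t| * q' < 1 &
    geometrically_bounded theta (dcoefs c) D' q'].
  (* Larger than [q], to absorb the factor from differentiation, yet with [|t| * q' < 1]. *)
  move=> tT; pose q' := ((`|t| + T) / 2)^-1.
  have [m1 m2] : `|t| < (`|t| + T) / 2 /\ (`|t| + T) / 2 < T by rewrite !midf_lt.
  have m0 : 0 < (`|t| + T) / 2 by exact: le_lt_trans m1.
  have qq' : q < q' by rewrite /q /q' ltf_pV2.
  have [D' D'0 cD'] := dcoefs_bounded C0 q0 qq' cb.
  exists D', q'; split => //; first exact: le_trans (ltW qq').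
  by rewrite /q' ltr_pdivrMr// mul1r.
have dv (t : R) : `|t| < T -> derivable v t 1.
  move=> /dq[D' [q' [D'0 q'0 tq' cD']]].
  by have [] := derivable_Kpsum d_gt0 D'0 q'0 tq' cD'.
have inT t : t \in `[0, T[ -> 0 <= t /\ `|t| < T.
  by rewrite in_itv/= => /andP[t0 tT]; rewrite ger0_norm.
have ioT t : t \in `]0, T[ -> t \in `[0, T[.
  by rewrite !in_itv/= => /andP[/ltW -> ->].
have Lk t : t \in `[0, T[ -> LDelta_eq a phi (k t) (v t).
  move=> /inT[t0 tT]; have tn : `|t| = t by rewrite ger0_norm.
  have [D' [q' [D'0 q'0 tq' cD']]] := dq t tT.
  have kE := KpsumE d_gt0 C0 q0 (tq t tT) cb.
  have vE := KpsumE d_gt0 D'0 q'0 tq' cD'.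
  have tq1 := tq t tT; rewrite tn in tq1 tq'.
  have tM : t * M theta < theta0 - theta.
    by rewrite t0E addrAC subrr add0r ltr_pM2r// -tn.
  have H := LDelta_psum tt C0 mf fC t0 tM cE C0 q0 tq1 cb D'0 q'0 tq' cD'.
  have mk : measurable_fun setT (fun eta => psum (c ^~ eta) t).
    exact: measurable_psum C0 q0 (tq t tT) cb.
  (* [LDelta_eq] refers to the chosen representative of [k t]; this transfers the identity from the
     pointwise sum to it. *)
  have := L_ae (expR_gt0 _) (normr_ge0 (k t)) (@L0_measurable _ _ (Kval (k t))) mk
    (bounded_by_Knorm d_gt0 (k t)) kE.
  rewrite /LDelta_eq; apply: filterS3 vE H => eta /(_ I) e1 /(_ I) e2 /(_ I) e3 _.
  by rewrite e1 e3 e2.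
exists k; split.
(* The series is differentiable for [|t| < T], on both sides of 0, so continuity at the left end
   point is included. *)
- apply: derivable_within_continuous => t /inT[_ tT]; exact: (dk t tT).1.
- by move=> t /ioT/inT[_ tT]; exact: (dk t tT).1.
- have /within_continuousP cv : {within `]0, T[, continuous v}.
    by apply: derivable_within_continuous => t /ioT/inT[_ tT]; exact: dv.
  apply/within_continuousP => x xT e e0; have [del del0 D] := cv x xT e e0.
  exists del => // y yT yx.
  have [_ /dk[_ ->]] := inT y (ioT y yT); have [_ /dk[_ ->]] := inT x (ioT x xT).
  exact: D.
- by move=> t /Lk Lt; exists (v t).
- move=> t tT; have [_ /dk[_ ->]] := inT t (ioT t tT).
  by apply: Lk; exact: ioT.
- apply/L0_eqP.
  have z0 : `|0 : R| * q < 1 by rewrite normr0 mul0r.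
  have kE := KpsumE d_gt0 C0 q0 z0 cb.
  apply: filterS2 kE (cE 0%N) => eta /(_ I) e1 /(_ I) e2 _.
  by rewrite e1 psum0 e2.
Qed.

End existence.

(** * Uniqueness *)

Section uniqueness.
Context {R : realType} {d : nat}.
Hypothesis d_gt0 : (0 < d)%N.
Local Notation X := (Rd R d).
Local Notation leb := (lebesgue_Rd R d).
Local Notation lp := (lebesgue_poisson R d).
Variables a phi : X -> R.
Hypothesis a_meas : measurable_fun setT a.
Hypothesis phi_meas : measurable_fun setT phi.
Hypothesis a_ge0 : forall x, 0 <= a x.
Hypothesis phi_ge0 : forall x, 0 <= phi x.
Hypothesis a_even : forall x, a (oppRd x) = a x.
Hypothesis phi_even : forall x, phi (oppRd x) = phi x.
Hypothesis a_int : (\int[leb]_x (a x)%:E < +oo)%E.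
Hypothesis phi_int : (\int[leb]_x (1 - expR (- phi x))%:E < +oo)%E.
Local Notation LDelta := (LDelta a phi).
Local Notation M := (LDelta_const a phi).
Variable theta : R.
Implicit Types (k l : Kspace d theta) (u : R -> Kspace d theta).

Let M_ge0 theta' : 0 <= M theta'.
Proof. exact: LDelta_const_ge0. Qed.
Let M_anti theta1 theta2 : theta1 <= theta2 -> M theta2 <= M theta1.
Proof. exact: LDelta_constS. Qed.

(** The seminorms to which the mean value inequality is applied: the equation bounds each of them on
    the derivative, with a factor growing in [n]. *)
Definition Knu n k : R := fine (nu (L0_fun (Kval k)) n).

Lemma nu_Kspace_le n k : (nu (L0_fun (Kval k)) n <= (`|k| * expR (- theta) ^+ n)%:E)%E.
Proof.
exact: (bounded_byP d_gt0 (expR_ge0 _) (normr_ge0 _) (@L0_measurable _ _ (Kval k))).1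
  (bounded_by_Knorm d_gt0 k) n.
Qed.

Lemma KnuE n k : (Knu n k)%:E = nu (L0_fun (Kval k)) n.
Proof.
rewrite fineK// ge0_fin_numE ?nu_ge0//.
by apply: le_lt_trans (nu_Kspace_le n k) _; rewrite ltry.
Qed.

Lemma KnuD n k l : Knu n (k + l) <= Knu n k + Knu n l.
Proof.
rewrite -lee_fin EFinD !KnuE.
by rewrite (nu_ae _ (L0_addE (Kval k) (Kval l))) nuD.
Qed.

Lemma KnuZ n (c : R) k : Knu n (c *: k) = `|c| * Knu n k.
Proof.
apply: EFin_inj; rewrite EFinM !KnuE.
by rewrite (nu_ae _ (L0_scaleE c (Kval k))) nuZ.
Qed.

Lemma Knu_le n k : Knu n k <= expR (- theta) ^+ n * `|k|.
Proof. by rewrite -lee_fin KnuE mulrC nu_Kspace_le. Qed.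

Lemma Knu_bounded k C theta' : 0 <= C ->
  (forall n, Knu n k <= C * expR (- theta') ^+ n) ->
  bounded_by (L0_fun (Kval k)) C (expR (- theta')).
Proof.
move=> C0 H.
apply: (bounded_byP d_gt0 (expR_ge0 _) C0 (@L0_measurable _ _ (Kval k))).2 => n.
by rewrite -KnuE lee_fin.
Qed.

(* In the time-dependent weight [expR (- (theta - kappa * (t - s)))] with
   [kappa > M (theta - 1)], integrating the equation contracts bounds by
   [M (theta - 1) / kappa]. *)
Lemma local_uniqueness u s t1 : s <= t1 -> t1 - s <= (M (theta - 1) + 1)^-1 ->
  {within `[s, t1], continuous u} ->
  (forall r, r \in `]s, t1[ -> derivable u r 1) ->
  (forall r, r \in `]s, t1[ -> LDelta_eq a phi (u r) (derive1 u r)) ->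
  u s = 0 -> u t1 = 0.
Proof.
move=> st ts cu du Lu us.
pose M' := M (theta - 1); pose kap := M' + 1.
have M'0 : 0 <= M' by exact: M_ge0.
have kap0 : 0 < kap by rewrite ltr_wpDl.
have [S S0 uS] : exists2 S, 0 <= S & forall t, t \in `[s, t1] -> `|u t| <= S.
  have cn : {within `[s, t1], continuous (fun t => `|u t|)}.
    move/within_continuousP : cu => cu.
    apply/within_continuousP => x xs e e0; have [del del0 D] := cu x xs e e0.
    exists del => // y ys yx; apply: le_lt_trans (D y ys yx).
    exact: ler_dist_dist.
  have [c _ cmax] := EVT_max st cn.
  by exists `|u c|.
pose x := M' / kap.
have x0 : 0 <= x by rewrite divr_ge0// ltW.
have x1 : x < 1 by rewrite ltr_pdivrMr// mul1r ltrDl.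
pose th r := theta - kap * (r - s).
have thE n r : expR (- th r) ^+ n = expR (kap * n%:R * (r - s) - theta * n%:R).
  by rewrite -expRM_natl; congr expR; rewrite /th; ring.
(* The interval has length at most [kap^-1], so the index drops by at most 1 and [M'] dominates
   every constant that occurs. *)
have thge r : r \in `[s, t1] -> theta - 1 <= th r.
  rewrite in_itv/= => /andP[sr rt]; rewrite lerD2l lerN2.
  apply: (@le_trans _ _ (kap * (t1 - s))); first by rewrite ler_pM2l// lerD2r.
  by rewrite mulrC -ler_pdivlMr// mul1r.
have claim j t n : t \in `[s, t1] -> Knu n (u t) <= S * x ^+ j * expR (- th t) ^+ n.
  elim: j t n => [|j IH] t n tst.
    rewrite expr0 mulr1; apply: le_trans (Knu_le n (u t)) _.
    rewrite mulrC; apply: ler_pM => //; first exact: uS.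
    rewrite lerXn2r ?nnegrE ?expR_ge0// ler_expR lerN2 gerBl mulr_ge0// ?(ltW kap0)// subr_ge0.
    by move: tst; rewrite in_itv/= => /andP[].
  have /andP[s_t t_t1] : s <= t <= t1 by move: tst; rewrite in_itv.
  have Q0 : 0 <= S * x ^+ j by rewrite mulr_ge0// exprn_ge0.
  (* Its derivative is [kap * n%:R * b r]. As [x * kap = M'], this equals [n%:R * M'] times the
     bound of stage [j], which dominates the seminorm of the derivative of [u]. *)
  pose b (r : R) : R := S * x ^+ j.+1 * expR (kap * n%:R * (r - s) - theta * n%:R).
  have db (r : R) : is_derive r 1 b (S * x ^+ j.+1 *
      (expR (kap * n%:R * (r - s) - theta * n%:R) * (kap * n%:R))).
    pose g : R -> R := (kap * n%:R) \*: ((@id R : R -> R) - cst s) - cst (theta * n%:R).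
    have dg : is_derive r 1 g ((kap * n%:R) *: (1 - 0) - 0).
      exact: is_deriveB.
    have := @is_derive1_comp _ expR g r _ _ (is_derive_expR (g r)) dg.
    rewrite !subr0 [_ *: 1]mulr1 => de.
    exact: (@is_deriveZ _ R R (expR \o g) (S * x ^+ j.+1) r 1 _ de).
  have sub r : r \in `]s, t[ -> r \in `]s, t1[.
    by rewrite !in_itv/= => /andP[-> rt]; exact: lt_le_trans rt t_t1.
  have subc r : r \in `]s, t[ -> r \in `[s, t1].
    by rewrite !in_itv/= => /andP[/ltW -> rt]; rewrite (le_trans (ltW rt)).
  have -> : S * x ^+ j.+1 * expR (- th t) ^+ n = b t by rewrite /b thE.
  have b0 : 0 <= b s by rewrite /b !mulr_ge0 ?exprn_ge0 ?expR_ge0.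
  apply: (@le_trans _ _ (b t - b s)); last by rewrite gerBl.
  rewrite -[u t]subr0 -us.
  apply: (seminorm_mean_value (KnuD n) (KnuZ n) (Knu_le n)) => //.
  - apply: continuous_subspaceW cu => r /=; rewrite !in_itv/= => /andP[-> rt].
    exact: le_trans rt t_t1.
  - apply: derivable_within_continuous => r _; exact: ex_derive.
  - by move=> r /sub; exact: du.
  - move=> r rst; have rst1 := subc r rst.
    have -> : derive1 b r = S * x ^+ j.+1 *
      (expR (kap * n%:R * (r - s) - theta * n%:R) * (kap * n%:R)).
      by rewrite derive1E; exact: derive_val.
    rewrite -lee_fin KnuE (nu_ae n (Lu r (sub r rst))).
    have ub := Knu_bounded Q0 (fun m => IH r m rst1).
    apply: le_trans (nu_LDelta d_gt0 a_meas phi_meas a_ge0 phi_ge0 a_even phi_even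
      a_int phi_int n Q0 (@L0_measurable _ _ _) ub) _.
    rewrite lee_fin -thE exprSr.
    have Mr : M (th r) <= M' by apply: M_anti; exact: thge.
    have K0 : 0 <= n%:R * (S * x ^+ j * expR (- th r) ^+ n).
      by rewrite mulr_ge0// mulr_ge0// exprn_ge0// expR_ge0.
    have := ler_wpM2r K0 Mr.
    have xk : x * kap = M' by rewrite /x divfK// gt_eqF.
    rewrite -xk; congr (_ <= _); ring.
have t1st : t1 \in `[s, t1] by rewrite in_itv/= st lexx.
apply/eqP; rewrite -normr_le0; apply/(Knorm_leP d_gt0) => //.
apply: Knu_bounded => // n; rewrite mul0r.
apply: (le0_geometric (K := S * expR (- th t1) ^+ n) x0 x1) => j.
by apply: le_trans (claim j t1 n t1st) _; rewrite mulrAC.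
Qed.

(** The difference solves the same equation by linearity almost everywhere. The length allowed by
    [local_uniqueness] depends on [theta] only, so finitely many steps from 0 reach any [t < T]. *)
Lemma classical_solution_unique theta0 T (k0 : Kspace d theta0) (k k' : R -> Kspace d theta) :
  classical_solution a phi T k0 k -> classical_solution a phi T k0 k' ->
  forall t, t \in `[0, T[ -> k' t = k t.
Proof.
move=> [ck dk _ _ Lk ik] [ck' dk' _ _ Lk' ik'].
pose u t := k' t - k t.
have du t : t \in `]0, T[ -> is_derive t 1 u (derive1 k' t - derive1 k t).
  move=> tT; rewrite !derive1E.
  by apply: is_deriveB; apply: derivableP; [exact: dk'|exact: dk].
have u0 : u 0 = 0 by apply/eqP; rewrite subr_eq0; apply/eqP/val_inj; rewrite /= ik ik'.
have Lu t : t \in `]0, T[ -> LDelta_eq a phi (u t) (derive1 u t).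
  move=> tT; have -> : derive1 u t = derive1 k' t - derive1 k t.
    by rewrite derive1E; have := du t tT => ?; exact: derive_val.
  have mk l := @L0_measurable _ _ (Kval (l : Kspace d theta)).
  have bk l := bounded_by_Knorm d_gt0 (l : Kspace d theta).
  have H1 := LDelta_ae_linear d_gt0 a_meas phi_meas a_ge0 phi_ge0 a_even phi_even
    a_int phi_int (-1) (expR_ge0 (- theta)) (normr_ge0 (k' t)) (normr_ge0 (k t))
    (mk (k' t)) (mk (k t)) (bk (k' t)) (bk (k t)).
  have H2 : L0_fun (Kval (u t)) =
    (fun eta => L0_fun (Kval (k' t)) eta + -1 * L0_fun (Kval (k t)) eta) %[ae lp].
    by apply: filterS (KvalB (k' t) (k t)) => eta -> _; rewrite mulN1r.
  have md : measurable_fun setT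
      (fun eta => L0_fun (Kval (k' t)) eta + -1 * L0_fun (Kval (k t)) eta).
    by apply: measurable_funD; [exact: mk|apply: measurable_funM => //; exact: mk].
  have H3 := LDelta_ae d_gt0 a_meas phi_meas a_ge0 phi_ge0 a_even phi_even
    a_int phi_int (expR_gt0 (- theta)) (normr_ge0 (u t)) (mk (u t)) md (bk (u t)) H2.
  have H4 := KvalB (derive1 k' t) (derive1 k t).
  have H5 := Lk t tT; have H6 := Lk' t tT.
  have H56 : {ae lp, forall eta,
      L0_fun (Kval (derive1 k' t)) eta - L0_fun (Kval (derive1 k t)) eta =
      LDelta (L0_fun (Kval (k' t))) eta - LDelta (L0_fun (Kval (k t))) eta}.
    by apply: filterS2 H5 H6 => eta /(_ I) -> /(_ I) ->.
  have H13 : {ae lp, forall eta, LDelta (L0_fun (Kval (u t))) eta =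
      LDelta (L0_fun (Kval (k' t))) eta - LDelta (L0_fun (Kval (k t))) eta}.
    by apply: filterS2 H1 H3 => eta H1 /(_ I) ->; rewrite H1 mulN1r.
  by apply: filterS3 H4 H56 H13 => eta -> -> -> _.
have cu : {within `[0, T[, continuous u}.
  move/within_continuousP : ck => ck; move/within_continuousP : ck' => ck'.
  apply/within_continuousP => x xT e e0.
  have e2 : 0 < e / 2 by rewrite divr_gt0.
  have [d1 d10 D1] := ck x xT _ e2; have [d2 d20 D2] := ck' x xT _ e2.
  exists (Num.min d1 d2); first by rewrite lt_min d10.
  move=> y yT; rewrite lt_min => /andP[/(D1 y yT) y1 /(D2 y yT) y2].
  have -> : u y - u x = (k' y - k' x) - (k y - k x).
    by rewrite /u !opprD !opprK !addrA; congr (_ + _); rewrite addrAC.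
  by apply: le_lt_trans (ler_normB _ _) _; rewrite [e]splitr ltrD.
pose del := (M (theta - 1) + 1)^-1.
have del0 : 0 < del by rewrite invr_gt0 ltr_wpDl.
suff H N t : t \in `[0, T[ -> t <= N%:R * del -> u t = 0.
  move=> t tT; apply/eqP; rewrite -subr_eq0; apply/eqP.
  apply: (H (Num.truncn (t / del)).+1) => //.
  by rewrite -ler_pdivrMr// ltW// truncnS_gt.
elim: N t => [|N IH] t tT tN.
  suff -> : t = 0 by [].
  by move: tT tN; rewrite in_itv/= mul0r => /andP[t0 _] tN; apply/eqP; rewrite eq_le tN.
have [|Nt] := leP t (N%:R * del); first exact: IH.
move: (tT); rewrite in_itv/= => /andP[t0 tltT].
have N0 : 0 <= N%:R * del by rewrite mulr_ge0// ltW.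
have NT : N%:R * del \in `[0, T[ by rewrite in_itv/= N0 (lt_trans Nt).
have sub r : r \in `]N%:R * del, t[ -> r \in `]0, T[.
  by rewrite !in_itv/= => /andP[Nr rt]; rewrite (le_lt_trans N0)// (lt_trans rt).
apply: (@local_uniqueness u (N%:R * del) t) => //.
- exact: ltW.
- by rewrite lerBlDl -/del; apply: le_trans tN _; rewrite -(natr1 N) mulrDl mul1r.
- apply: continuous_subspaceW cu => r /=; rewrite !in_itv/= => /andP[Nr rt].
  by rewrite (le_trans N0)//= (le_lt_trans rt).
- by move=> r /sub rT; have [] := du r rT.
- by move=> r /sub; exact: Lu.
- exact: IH.
Qed.

(** The constant [M theta] is a factor of the norm bound, so the operator vanishes on the whole
    space. *)
Lemma classical_solution_constant T (k0 : Kspace d theta) : M theta = 0 ->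
  classical_solution a phi T k0 (fun=> k0).
Proof.
move=> M0.
have L0 : LDelta_eq a phi k0 (0 : Kspace d theta).
  have tt : theta - 1 < theta by rewrite gtrBl.
  have := LDelta_bounded d_gt0 a_meas phi_meas a_ge0 phi_ge0 a_even phi_even
    a_int phi_int tt (normr_ge0 k0) (@L0_measurable _ _ (Kval k0))
    (bounded_by_Knorm d_gt0 k0).
  rewrite M0 !mul0r => H; rewrite /LDelta_eq.
  apply: filterS2 H (L0_zeroE lp) => eta; rewrite mul0r normr_le0 => /eqP -> /(_ I) H _.
  exact: H.
have d0 : derive1 (fun _ : R => k0) = fun=> 0 by apply/funext => t; rewrite derive1_cst.
split => //.
- by apply: continuous_subspaceT => t; exact: cvg_cst.
- by rewrite d0; apply: continuous_subspaceT => t; exact: cvg_cst.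
- by move=> t _; exists 0.
- by move=> t _; rewrite d0.
Qed.

End uniqueness.

Theorem theorem3p1 (R : realType) (d : nat) (d_gt0 : (0 < d)%N)
  (a phi : Rd R d -> R)
  (a_meas : measurable_fun [set: Rd R d] a)
  (phi_meas : measurable_fun [set: Rd R d] phi)
  (a_ge0 : forall x, 0 <= a x) (phi_ge0 : forall x, 0 <= phi x)
  (a_even : forall x, a (oppRd x) = a x)
  (phi_even : forall x, phi (oppRd x) = phi x)
  (a_int : (\int[lebesgue_Rd R d]_x (a x)%:E < +oo)%E)
  (phi_int : (\int[lebesgue_Rd R d]_x (1 - expR (- phi x))%:E < +oo)%E)
  (theta T : R) (T_gt0 : 0 < T) :
  let alpha := \int[lebesgue_Rd R d]_x a x in
  let c_phi := \int[lebesgue_Rd R d]_x (1 - expR (- phi x)) in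
  let theta0 := theta + 2 * alpha * T * expR (c_phi * expR (- theta)) in
  forall k0 : Kspace d theta0,
  exists k : R -> Kspace d theta,
    classical_solution a phi T k0 k /\
    forall k' : R -> Kspace d theta, classical_solution a phi T k0 k' ->
      forall t, t \in `[0, T[ -> k' t = k t.
Proof.
move=> alpha c_phi theta0 k0.
have t0E : theta0 = theta + T * LDelta_const a phi theta.
  by rewrite /theta0 /alpha /c_phi /LDelta_const; ring.
suff [k kS] : exists k : R -> Kspace d theta, classical_solution a phi T k0 k.
  exists k; split => // k' k'S.
  exact: (classical_solution_unique d_gt0 a_meas phi_meas a_ge0 phi_ge0 a_even phi_even
    a_int phi_int kS k'S).
have : 0 <= LDelta_const a phi theta by exact: LDelta_const_ge0.
(* When [M theta = 0] the indices [theta0] and [theta] coincide, so there is no interval of indices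
   to subdivide. *)
rewrite le_eqVlt => /orP[/eqP M0|M0]; last first.
  exact: (classical_solution_exists d_gt0 a_meas phi_meas a_ge0 phi_ge0 a_even phi_even
    a_int phi_int k0 T_gt0 M0 t0E).
(* The type of [k0] depends on [theta0]; making [theta0] opaque allows its replacement by [theta] in
   that type. *)
move: k0; clearbody theta0; move: t0E; rewrite -M0 mulr0 addr0 => -> k0.
exists (fun=> k0).
exact: (classical_solution_constant d_gt0 a_meas phi_meas a_ge0 phi_ge0 a_even phi_even
  a_int phi_int T k0 (esym M0)).
Qed.
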